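(* Let $f:X\to X$ be the one-sided full shift on $X=\{0,1,2,3\}^{\mathbb N}$. Let $a=e^{-2}$, $\lambda=3$, $x_1(k)=x_2(k)=e^{7-10k}$ for $k\in\mathbb N$, and let $\ell:[0,a]\to\mathbb R$ be $\ell(x)=-1/\ln x$ for $x>0$, $\ell(0)=0$. Let $\ell_1=\ell$ and $\ell_2=-\ell$, and let $\Phi:X\to\mathbb R^2$ be the potential defined in the context from these data. Then the origin is a smooth exposed point on $\partial\,\mathrm{Rot}(\Phi)$, and for $\alpha=(-1,0)$ there is a non-ergodic measure $\mu$ such that $GS(\alpha)=\{\mu\}$.
   Context: Put $v_i(k)=(x_i(k),\ell_i(x_i(k)))$, $w_i(\infty)=(0,\ell_i(0))$ for $i=1,2$, and $w(0)=(a,0)$. Let $S_1=\{0,1\}$, $S_2=\{2,3\}$. For $i=1,2$ and $k\ge\lambda$ let $Y_i(k)=\{\xi\in X:\xi_1,\dots,\xi_k\in S_i\}$, $Y_i(\infty)=\{\xi\in X:\xi_j\in S_i\text{ for all }j\}$, and $Y_0(\lambda)=X\setminus(Y_1(\lambda)\cup Y_2(\lambda))$. The (continuous) potential $\Phi$ is: $\Phi(\xi)=w(0)$ if $\xi\in Y_0(\lambda)$; $\Phi(\xi)=v_i(k-\lambda)$ if $\xi\in Y_i(k-1)\setminus Y_i(k)$ for some $k>\lambda$ and $i\in\{1,2\}$; $\Phi(\xi)=w_i(\infty)$ if $\xi\in Y_i(\infty)$, $i\in\{1,2\}$. $\mathcal M$ is the set of $f$-invariant Borel probability measures with the weak$^*$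 topology. For $\Phi=(\phi_1,\phi_2)$, $\mathrm{rv}(\mu)=(\int\phi_1\,d\mu,\int\phi_2\,d\mu)$ and $\mathrm{Rot}(\Phi)=\{\mathrm{rv}(\mu):\mu\in\mathcal M\}$, a compact convex set. An equilibrium state of a continuous $\varphi:X\to\mathbb R$ is a $\mu\in\mathcal M$ maximizing $h_\nu(f)+\int\varphi\,d\nu$ over $\nu\in\mathcal M$ ($h_\nu(f)$ is measure-theoretic entropy); $ES(\varphi)$ is the set of these. A ground state of $\varphi$ is a $\mu\in\mathcal M$ for which there are an increasing sequence $t_n\to\infty$ and $\mu_{t_n}\in ES(t_n\varphi)$ with $\mu_{t_n}\to\mu$ weak$^*$. $GS(\alpha)$ is the set of ground states of $\alpha\cdot\Phi=\alpha_1\phi_1+\alpha_2\phi_2$. A point $w$ of a compact convex set $K$ is exposed if $\{w\}=K\cap H$ for some supporting hyperplane (here: line) $H$ of $K$; a boundary point $w$ is smooth if the supporting hyperplane of $K$ containing $w$ is unique. *)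

(* Defs.v *)
From HB Require Import structures.
From mathcomp Require Import all_boot all_order all_algebra.
From mathcomp Require Import all_classical all_reals all_analysis.

Set Implicit Arguments.
Unset Strict Implicit.
Unset Printing Implicit Defensive.

Import Order.TTheory GRing.Theory Num.Theory.
Import numFieldNormedType.Exports.

Local Open Scope classical_set_scope.
Local Open Scope ring_scope.

HB.instance Definition _ (n : nat) := isPointed.Build 'I_n.+1 ord0.

(* [fullshift] is the product of copies of the discrete space ['I_4] and
   carries both the product topology and its Borel sigma-algebra.  The
   coordinates xi_1, xi_2, ... of a point are [xi 0], [xi 1], ... *)
Definition fullshift : Type :=
  prod_topology (fun _ : nat => discrete_topology 'I_4).

HB.instance Definition _ := Pointed.on fullshift.
HB.instance Definition _ := Topological.on fullshift.
HB.instance Definition _ := Measurable.copy fullshift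
  (g_sigma_algebraType (@open fullshift)).

Definition left_shift (xi : fullshift) : fullshift := fun n => xi n.+1.

Definition invariant_measure (R : realType) (d : measure_display)
    (T : measurableType d) (f : T -> T) (mu : probability T R) : Prop :=
  forall A : set T, measurable A -> mu (f @^-1` A) = mu A.

Definition ergodic (R : realType) (d : measure_display)
    (T : measurableType d) (f : T -> T) (mu : probability T R) : Prop :=
  invariant_measure f mu /\
  forall A : set T, measurable A -> f @^-1` A = A ->
    mu A = 0%E \/ mu A = 1%E.

(* A finite measurable partition with at most [m] nonempty cells is given by
   its labelling [c : T -> 'I_m]. *)
Definition measurable_partition (d : measure_display)
    (T : measurableType d) (m : nat) (c : T -> 'I_m) : Prop :=
  forall j : 'I_m, measurable (c @^-1` [set j]).

(* The Shannon entropy of the join of the partitions f^{-i} c, i < n, whose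
   cells are indexed by words [w] of length [n].  Empty or null cells
   contribute 0, since [ln 0 = 0]. *)
Definition join_entropy (R : realType) (d : measure_display)
    (T : measurableType d) (f : T -> T) (mu : probability T R)
    (m : nat) (c : T -> 'I_m) (n : nat) : R :=
  \sum_(w : {ffun 'I_n -> 'I_m})
    let p := fine (mu [set x | forall i : 'I_n, c (iter i f x) = w i]) in
    - (p * ln p).

Definition partition_entropy (R : realType) (d : measure_display)
    (T : measurableType d) (f : T -> T) (mu : probability T R)
    (m : nat) (c : T -> 'I_m) : R :=
  limn (fun n : nat => join_entropy f mu c n / n%:R).

Definition entropy (R : realType) (d : measure_display)
    (T : measurableType d) (f : T -> T) (mu : probability T R) : \bar R :=
  ereal_sup [set h | exists (m : nat) (c : T -> 'I_m),
    measurable_partition c /\ h = (partition_entropy f mu c)%:E].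

Definition weak_cvg (R : realType) (mus : nat -> probability fullshift R)
    (mu : probability fullshift R) : Prop :=
  forall g : fullshift -> R, continuous g ->
    \int[mus n]_x g x @[n --> \oo] --> \int[mu]_x g x.

Definition equilibrium_state (R : realType) (phi : fullshift -> R)
    (mu : probability fullshift R) : Prop :=
  invariant_measure left_shift mu /\
  forall nu : probability fullshift R, invariant_measure left_shift nu ->
    (entropy left_shift nu + (\int[nu]_x phi x)%:E <=
     entropy left_shift mu + (\int[mu]_x phi x)%:E)%E.

Definition ground_state (R : realType) (phi : fullshift -> R)
    (mu : probability fullshift R) : Prop :=
  invariant_measure left_shift mu /\
  exists (t : nat -> R) (mus : nat -> probability fullshift R),
    [/\ {homo t : m n / (m < n)%N >-> m < n},
        t n @[n --> \oo] --> +oo,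
        forall n, equilibrium_state (fun xi => t n * phi xi) (mus n)
      & weak_cvg mus mu].

Definition dot (R : realType) (u v : R * R) : R := u.1 * v.1 + u.2 * v.2.

Definition GS (R : realType) (Phi : fullshift -> R * R) (alpha : R * R) :
    set (probability fullshift R) :=
  ground_state (fun xi => dot alpha (Phi xi)).

Definition rv (R : realType) (Phi : fullshift -> R * R)
    (mu : probability fullshift R) : R * R :=
  (\int[mu]_x (Phi x).1, \int[mu]_x (Phi x).2).

Definition Rot (R : realType) (Phi : fullshift -> R * R) : set (R * R) :=
  [set rv Phi mu | mu in invariant_measure left_shift].

Definition boundary (T : topologicalType) (K : set T) : set T :=
  closure K `\` K^°.

Definition supporting_line (R : realType) (K H : set (R * R)) : Prop :=
  exists (beta : R * R) (c : R),
    [/\ beta != 0, H = [set v | dot beta v = c],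
        (forall v, K v -> dot beta v <= c) & K `&` H !=set0].

Definition exposed_point (R : realType) (K : set (R * R)) (w : R * R) : Prop :=
  exists H, supporting_line K H /\ [set w] = K `&` H.

Definition smooth_point (R : realType) (K : set (R * R)) (w : R * R) : Prop :=
  boundary K w /\ exists! H : set (R * R), supporting_line K H /\ H w.

(* The two-valued index of S_, Y, x, ell is a boolean: [false] stands for 1
   and [true] for 2. *)
Definition S_ (i : bool) : set 'I_4 :=
  [set s | (s : nat) \in (if i then [:: 2; 3] else [:: 0; 1])%N].

Definition Y (i : bool) (k : nat) : set fullshift :=
  [set xi | forall j : nat, (j < k)%N -> S_ i (xi j)].

Definition Yinfty (i : bool) : set fullshift :=
  [set xi | forall j : nat, S_ i (xi j)].

Definition Y0 (lambda : nat) : set fullshift :=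
  ~` (Y false lambda `|` Y true lambda).

(* The defining clauses of the potential as a relation between a point and its
   value; it is functional and total as soon as [0 < lambda]. *)
Definition potential_graph (R : realType) (a : R) (lambda : nat)
    (x : bool -> nat -> R) (ell : bool -> R -> R)
    (xi : fullshift) (v : R * R) : Prop :=
  [\/ Y0 lambda xi /\ v = (a, 0),
      exists (i : bool) (k : nat), [/\ (lambda < k)%N,
        (Y i k.-1 `\` Y i k) xi
      & v = (x i (k - lambda)%N, ell i (x i (k - lambda)%N))]
    | exists i : bool, Yinfty i xi /\ v = (0, ell i 0)].

Definition potential (R : realType) (a : R) (lambda : nat)
    (x : bool -> nat -> R) (ell : bool -> R -> R) (xi : fullshift) : R * R :=
  xget 0 [set v | potential_graph a lambda x ell xi v].

Lemma S_inj (i i' : bool) (s : 'I_4) : S_ i s -> S_ i' s -> i = i'.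
Proof. by case: s => -[|[|[|[|//]]]] ?; case: i; case: i'. Qed.

Lemma potential_graph_total (R : realType) (a : R) (lambda : nat)
    (x : bool -> nat -> R) (ell : bool -> R -> R) (xi : fullshift) :
  exists v, potential_graph a lambda x ell xi v.
Proof.
have [y0|] := pselect (Y0 lambda xi); first by exists (a, 0); constructor 1.
move=> /contrapT y12.
have [i yi] : exists i, Y i lambda xi.
  by case: y12; [exists false|exists true].
have [yinf|nyinf] := pselect (Yinfty i xi).
  by exists (0, ell i 0); constructor 3; exists i.
have nY : exists k, ~~ `[< Y i k xi >].
  move/existsNP: nyinf => [j nj]; exists j.+1; apply/asboolPn => yj.
  by apply: nj; apply: yj.
case: (ex_minnP nY) => k /asboolPn nyk kmin.
have lk : (lambda < k)%N.
  rewrite ltnNge; apply/negP => kl; apply: nyk => j jk.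
  by apply: yi; exact: leq_trans jk kl.
exists (x i (k - lambda)%N, ell i (x i (k - lambda)%N)).
constructor 2; exists i, k; split=> //; split=> //.
apply: contrapT => /asboolPn /kmin.
by case: k lk {nyk kmin} => //= k _; rewrite ltnn.
Qed.

Lemma potential_graph_fun (R : realType) (a : R) (lambda : nat)
    (x : bool -> nat -> R) (ell : bool -> R -> R) (xi : fullshift)
    (v v' : R * R) : (0 < lambda)%N ->
  potential_graph a lambda x ell xi v ->
  potential_graph a lambda x ell xi v' -> v = v'.
Proof.
move=> l0.
have yle i k k' : (k' <= k)%N -> Y i k xi -> Y i k' xi.
  by move=> kk' yk j jk'; apply: yk; exact: leq_trans jk' kk'.
have yinf i k : Yinfty i xi -> Y i k xi by move=> yi j _; exact: yi.
have ypred i k : (lambda < k)%N -> Y i k.-1 xi -> Y i lambda xi.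
  by case: k => // k lk; exact: yle.
have yinj i i' : Y i lambda xi -> Y i' lambda xi -> i = i'.
  by move=> yi yi'; apply: (@S_inj _ _ (xi 0%N)); [exact: yi|exact: yi'].
have n0 i : Y0 lambda xi -> ~ Y i lambda xi.
  by move=> y0 yi; apply: y0; case: i yi; [right|left].
case=> [[y0 ->]|[i [k [lk [yk nyk] ->]]]|[i [yi ->]]];
case=> [[y0' ->]|[i' [k' [lk' [yk' nyk'] ->]]]|[i' [yi' ->]]] //.
- by case: (n0 i' y0); exact: ypred yk'.
- by case: (n0 i' y0); exact: yinf.
- by case: (n0 i y0'); exact: ypred yk.
- have ii' : i = i' by apply: yinj; [exact: ypred yk|exact: ypred yk'].
  subst i'; suff -> : k = k' by [].
  have [kk'|kk'|//] := ltngtP k k'.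
    by case: nyk; apply: yle yk'; case: (k') kk'.
  by case: nyk'; apply: yle yk; case: (k) kk'.
- have ii' : i = i' by apply: yinj; [exact: ypred yk|exact: yinf].
  by subst i'; case: nyk; exact: yinf.
- by case: (n0 i y0'); exact: yinf.
- have ii' : i = i' by apply: yinj; [exact: yinf|exact: ypred yk'].
  by subst i'; case: nyk'; exact: yinf.
- by have -> : i = i' by apply: yinj; exact: yinf.
Qed.

Lemma potentialP (R : realType) (a : R) (lambda : nat)
    (x : bool -> nat -> R) (ell : bool -> R -> R) (xi : fullshift) :
  potential_graph a lambda x ell xi (potential a lambda x ell xi).
Proof.
have := potential_graph_total a lambda x ell xi.
exact: (@xgetPex _ 0 (potential_graph a lambda x ell xi)).
Qed.

(* Only the values on [0, a], a = e^-2, matter: the potential evaluates it at 0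
   and at x_i k with k >= 1, and e^(7 - 10k) <= a for those k. *)
Definition invlog (R : realType) (t : R) : R :=
  if 0 < t then - (ln t)^-1 else 0.

Definition Phi (R : realType) : fullshift -> R * R :=
  potential (expR (- 2)) 3
    (fun _ k => expR (7 - 10 * k%:R))
    (fun i t => if i then - invlog t else invlog t).

(* Main.v *)
Require Import Defs.
From HB Require Import structures.
From mathcomp Require Import all_boot all_order all_algebra.
From mathcomp Require Import all_classical all_reals all_analysis.
From mathcomp Require Import measurable_realfun.
From mathcomp Require Import ring lra.
Import Order.TTheory GRing.Theory Num.Theory.
Import numFieldNormedType.Exports.
Local Open Scope classical_set_scope.
Local Open Scope ring_scope.

Set Implicit Arguments.
Unset Strict Implicit.
Unset Printing Implicit Defensive.

(* Identify 0 with 1 and 2 with 3, and let the run of a point be its longest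
   initial block of letters of one class; the potential is a function of the class
   and of the run.  A point of run k has first coordinate c_k, with c_k summable,
   and second coordinate of modulus at most 1/k but at least 1/(10 k), k >= 3.

   For t > 0 the equilibrium states of - t phi_1 are studied through the renewal
   equation \sum_k z^k exp (- t (c_1 + ... + c_k)) = 1.  An explicit
   eigenfunction h and eigenmeasure give a Gibbs measure with entropy equal to the
   pressure, and for every positive weight whose transfer operator has a
   supersolution the Gibbs inequality bounds the entropy of every invariant
   measure.  Applying the bound to perturbed weights shows that an equilibrium
   state gives equal mass to words that differ in their first letter within a
   class and mass 1/2 to each class; moreover a word w that meets both classes has
   mass at most ln 4 / (t c_|w|).  Hence as t tends to infinity all equilibrium
   states converge to the mean of the Bernoulli measures on {0,1}^N and {2,3}^N,
   which is not ergodic.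

   In Rot(Phi) the first coordinate is nonnegative and vanishes only at the origin.
   The orbits of (0^N 2)^oo and (2^N 0)^oo have first sums bounded and second sums
   comparable to plus or minus the harmonic series, so a supporting line through
   the origin is vertical. *)

(** The explicit Gibbs measure serves to show that the pressure is attained; what passes to the
    limit is a set of linear relations that hold for every equilibrium state nu. Such a nu turns the
    entropy bound of [run_weight] into an equality. If the weight multiplied by 1 + s chi still has
    bounded sums over words, its own entropy bound forces the integral of ln (1 + s chi) against nu
    to be at most 0, and s -> 0 gives a linear inequality between cylinder masses of nu. Each
    perturbation therefore asks for its own supersolution; for the sign of the class this is where
    the symmetry of the two classes and the tail of the tail enter. The exponential decay of the x_i
    serves two opposite ends: the first coordinates are summable, while their inverse logarithms are
    of order 1 / k and are not. *)

(** * Bounded measurable functions and their expectations *)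

Section bounded_measurable.
Context d (T : measurableType d) (R : realType).
Implicit Types f g : T -> R.

(** Integrable for every probability measure and stable under sums and products, so the side
    conditions of linearity and monotonicity of the integral become closure properties. *)
Definition bounded_measurable f :=
  measurable_fun setT f /\ exists M, forall x, `|f x| <= M.

Lemma bounded_measurable_cst (r : R) : bounded_measurable (fun _ : T => r).
Proof. by split; [exact: measurable_cst | exists `|r|]. Qed.

Lemma bounded_measurableD f g : bounded_measurable f ->
  bounded_measurable g -> bounded_measurable (fun x => f x + g x).
Proof.
move=> [mf [M fM]] [mg [N gN]]; split; first exact: measurable_funD.
exists (M + N) => x; apply: le_trans (ler_normD _ _) _.
exact: lerD.
Qed.

Lemma bounded_measurableM f g : bounded_measurable f ->
  bounded_measurable g -> bounded_measurable (fun x => f x * g x).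
Proof.
move=> [mf [M fM]] [mg [N gN]]; split; first exact: measurable_funM.
by exists (M * N) => x; rewrite normrM ler_pM.
Qed.

Lemma bounded_measurableN f :
  bounded_measurable f -> bounded_measurable (fun x => - f x).
Proof.
move=> [mf [M fM]]; split; first exact: measurableT_comp.
by exists M => x; rewrite normrN.
Qed.

Lemma bounded_measurable_sum (I : Type) (r : seq I) (F : I -> T -> R) :
  (forall i, bounded_measurable (F i)) ->
  bounded_measurable (fun x => \sum_(i <- r) F i x).
Proof.
move=> bF; elim: r => [|i r IH].
  rewrite (_ : (fun _ => _) = (fun=> 0)); first exact: bounded_measurable_cst.
  by apply/funext => x; rewrite big_nil.
rewrite (_ : (fun _ => _) = (fun x => F i x + \sum_(j <- r) F j x)).
  exact: bounded_measurableD.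
by apply/funext => x; rewrite big_cons.
Qed.

Lemma bounded_measurable_indic (A : set T) : measurable A ->
  bounded_measurable (\1_A : T -> R).
Proof.
move=> mA; split; first exact: measurable_indic.
by exists 1 => x; rewrite indicE; case: (_ \in _); rewrite ?normr1 ?normr0.
Qed.

Variable mu : probability T R.

Lemma bounded_measurable_integrable f :
  bounded_measurable f -> mu.-integrable setT (EFin \o f).
Proof.
move=> [mf [M fM]]; apply: measurable_bounded_integrable => //.
  by rewrite -[X in (X < _)%E]/(mu setT) probability_setT ltry.
exists M; split; first exact: num_real.
by move=> N MN x _; apply: le_trans (fM x) (ltW MN).
Qed.

Lemma expectD f g : bounded_measurable f -> bounded_measurable g ->
  \int[mu]_x (f x + g x) = \int[mu]_x f x + \int[mu]_x g x.
Proof. by move=> bf bg; apply: RintegralD => //; exact: bounded_measurable_integrable. Qed.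

Lemma expectZ (r : R) f : bounded_measurable f ->
  \int[mu]_x (r * f x) = r * \int[mu]_x f x.
Proof. by move=> bf; apply: RintegralZl => //; exact: bounded_measurable_integrable. Qed.

Lemma expectN f : bounded_measurable f ->
  \int[mu]_x (- f x) = - \int[mu]_x f x.
Proof.
move=> bf; rewrite -mulN1r -expectZ//; apply: eq_Rintegral => x _.
by rewrite mulN1r.
Qed.

Lemma expect_cst (r : R) : \int[mu]_x r = r.
Proof. by rewrite Rintegral_cst//= probability_setT mulr1. Qed.

Lemma le_expect f g : bounded_measurable f -> bounded_measurable g ->
  (forall x, f x <= g x) -> \int[mu]_x f x <= \int[mu]_x g x.
Proof.
move=> bf bg fg; apply: le_Rintegral => //; exact: bounded_measurable_integrable.
Qed.

Lemma expect_sum (I : Type) (r : seq I) (F : I -> T -> R) :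
  (forall i, bounded_measurable (F i)) ->
  \int[mu]_x (\sum_(i <- r) F i x) = \sum_(i <- r) \int[mu]_x F i x.
Proof.
move=> bF; elim: r => [|i r IH].
  rewrite big_nil -[RHS]expect_cst; apply: eq_Rintegral => x _.
  by rewrite big_nil.
rewrite big_cons -IH -expectD//; last exact: bounded_measurable_sum.
by apply: eq_Rintegral => x _; rewrite big_cons.
Qed.

Lemma expect_indic (A : set T) : measurable A ->
  \int[mu]_x (\1_A x) = fine (mu A).
Proof. by move=> mA; rewrite /Rintegral integral_indic// setIT. Qed.

Lemma probability_fineK (A : set T) : measurable A -> (fine (mu A))%:E = mu A.
Proof. by move=> mA; rewrite fineK//; exact: fin_num_measure. Qed.

Lemma fine_probability_ge0 (A : set T) : 0 <= fine (mu A).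
Proof. exact: fine_ge0. Qed.

Lemma fine_probability_le (A B : set T) : measurable A -> measurable B ->
  A `<=` B -> fine (mu A) <= fine (mu B).
Proof.
move=> mA mB AB; rewrite fine_le ?fin_num_measure//.
by apply: le_measure => //; rewrite inE.
Qed.

End bounded_measurable.

(** * Expectations of functions of a finite-valued labelling *)

Section finite_labelling.
Context d (T : measurableType d) (R : realType) (mu : probability T R).
Context (I : finType) (F : T -> I).
Hypothesis mF : forall i, measurable (F @^-1` [set i]).

Lemma labelling_indicE (G : I -> R) x :
  G (F x) = \sum_i G i * \1_(F @^-1` [set i]) x.
Proof.
rewrite (bigD1 (F x))//= indicE mem_set// mulr1 big1 ?addr0// => i iFx.
by rewrite indicE memNset ?mulr0// => /= e; move: iFx; rewrite -e eqxx.
Qed.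

Lemma bounded_measurable_labelling (G : I -> R) :
  bounded_measurable (fun x => G (F x)).
Proof.
rewrite (_ : (fun _ => _) = fun x => \sum_i G i * \1_(F @^-1` [set i]) x).
  apply: bounded_measurable_sum => i; apply: bounded_measurableM.
    exact: bounded_measurable_cst.
  exact: bounded_measurable_indic.
by apply/funext => x; exact: labelling_indicE.
Qed.

Lemma expect_labelling (G : I -> R) :
  \int[mu]_x G (F x) = \sum_i G i * fine (mu (F @^-1` [set i])).
Proof.
under eq_Rintegral do rewrite labelling_indicE.
rewrite expect_sum.
  apply: eq_bigr => i _; rewrite expectZ ?expect_indic//.
  exact: bounded_measurable_indic.
move=> i; apply: bounded_measurableM; first exact: bounded_measurable_cst.
exact: bounded_measurable_indic.
Qed.

Lemma sum_labelling : \sum_i fine (mu (F @^-1` [set i])) = 1.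
Proof.
rewrite -[RHS](expect_cst mu) (expect_labelling (fun=> 1)).
by apply: eq_bigr => i _; rewrite mul1r.
Qed.

End finite_labelling.

(** * Words, cylinders, and the topology and Borel sets they generate *)

Section words.

Definition word (x : fullshift) (n : nat) : seq 'I_4 :=
  mkseq (x : nat -> 'I_4) n.

Definition cyl (w : seq 'I_4) : set fullshift :=
  [set x | word x (size w) = w].

Lemma size_word x n : size (word x n) = n.
Proof. exact: size_mkseq. Qed.

Lemma nth_word x n i : (i < n)%N -> nth ord0 (word x n) i = x i.
Proof. exact: nth_mkseq. Qed.

Lemma wordP x y n : word x n = word y n <->
  (forall i, (i < n)%N -> x i = y i :> 'I_4).
Proof.
split=> [e i ni|e]; first by rewrite -(nth_word x ni) e nth_word.
by apply: (@eq_from_nth _ ord0); rewrite ?size_word// => i ni; rewrite !nth_word// e.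
Qed.

Lemma word_sub x y m n : (m <= n)%N -> word x n = word y n -> word x m = word y m.
Proof.
move=> mn /wordP e; apply/wordP => i im; apply: e; exact: leq_trans im mn.
Qed.

Lemma iter_shift x i j : iter i left_shift x j = x (i + j)%N.
Proof. by elim: i j => [//|i IH] j; rewrite iterS /left_shift IH addnS. Qed.

Lemma wordS x n : word x n.+1 = (x 0%N : 'I_4) :: word (left_shift x) n.
Proof.
by rewrite /word /mkseq /= (iotaDl 1 0 n) -map_comp.
Qed.

Lemma word_rcons x n : word x n.+1 = rcons (word x n) (x n).
Proof. by rewrite /word mkseqS. Qed.

Lemma take_word x k n : (k <= n)%N -> take k (word x n) = word x k.
Proof. by move=> kn; rewrite /word /mkseq -map_take take_iota; have /minn_idPl -> := kn. Qed.

Lemma drop_word x j n : drop j (word x n) = word (iter j left_shift x) (n - j).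
Proof.
elim: j x n => [|j IH] x n; first by rewrite drop0 subn0.
case: n => [|n]; first by rewrite drop_oversize ?size_word// sub0n.
by rewrite wordS /= IH subSS -iterSr.
Qed.

Lemma open_coord n (a : 'I_4) : open [set x : fullshift | x n = a :> 'I_4].
Proof.
rewrite (_ : [set _ | _] = (@proj nat (fun=> discrete_topology 'I_4) n) @^-1` [set a]) //.
apply: open_comp; first by move=> x _; exact: proj_continuous.
exact: discrete_open.
Qed.

Lemma nbhs_word (x : fullshift) n : nbhs x [set y | word y n = word x n].
Proof.
elim: n => [|n IH]; first exact: filterS filterT.
have : nbhs x [set y : fullshift | y n = x n :> 'I_4].
  by apply: open_nbhs_nbhs; split=> //; exact: open_coord.
by apply: filterS2 IH => y /= + yn; rewrite !word_rcons yn => ->.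
Qed.

(** It suffices that the filter generated by the cylinders around [x] converges to [x], and in a
    product topology this is checked one coordinate at a time. *)
Lemma nbhs_wordP (x : fullshift) (A : set fullshift) : nbhs x A ->
  exists n, [set y | word y n = word x n] `<=` A.
Proof.
pose F := filter_from [set: nat] (fun n => [set y : fullshift | word y n = word x n]).
have FF : Filter F.
  apply: filter_from_filter; first by exists 0%N.
  move=> m n _ _; exists (maxn m n) => // y /= e.
  by split; apply: word_sub e; rewrite ?leq_maxl ?leq_maxr.
have Fx : F --> (x : prod_topology _).
  apply/cvg_sup => N U [V] [[W] oW <-] WfN WU.
  apply: (filterS WU); exists N.+1 => // y /= /wordP /(_ N (ltnSn _)) yN.
  by rewrite yN.
by move=> /Fx [n _ nA]; exists n.
Qed.

Lemma open_word (Q : seq 'I_4 -> Prop) n :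
  open [set x : fullshift | Q (word x n)].
Proof.
rewrite openE => x /= Qx; apply: filterS (nbhs_word x n) => y /= ->.
exact: Qx.
Qed.

Lemma measurable_open_fullshift (A : set fullshift) : open A -> measurable A.
Proof. exact: sub_gen_smallest. Qed.

Lemma measurable_word (Q : seq 'I_4 -> Prop) n :
  measurable [set x : fullshift | Q (word x n)].
Proof. by apply: measurable_open_fullshift; exact: open_word. Qed.

Lemma measurable_cyl w : measurable (cyl w).
Proof. exact: (measurable_word (fun v => v = w)). Qed.

Lemma continuous_word (U : topologicalType) (G : seq 'I_4 -> U) n :
  continuous (fun x : fullshift => G (word x n)).
Proof.
move=> x A /nbhs_singleton Ax; apply: filterS (nbhs_word x n) => y /= e.
by rewrite /= e.
Qed.

(** Arbitrary predicates on words, rather than single words, make the family stable under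
    intersection: it is the pi-system used for uniqueness of measures. *)
Definition word_sets : set (set fullshift) :=
  [set A | exists n (Q : seq 'I_4 -> Prop), A = [set x | Q (word x n)]].

Lemma word_setsI : setI_closed word_sets.
Proof.
move=> _ _ [m [Q ->]] [n [S ->]]; exists (maxn m n).
exists (fun w => Q (take m w) /\ S (take n w)).
by apply/seteqP; split=> x /=; rewrite !take_word ?leq_maxl ?leq_maxr.
Qed.

(** The [n]-th member of the union is decided by the first [n] letters, so every open set is a
    countable union of [word_sets]. *)
Lemma open_bigcup_word (A : set fullshift) : open A ->
  A = \bigcup_n [set x | cyl (word x n) `<=` A].
Proof.
move=> oA; apply/seteqP; split=> x.
  rewrite openE in oA => /oA /nbhs_wordP [n nA]; exists n => // y /=.
  by rewrite /cyl /= size_word => /nA.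
by move=> [n _]; apply; rewrite /cyl /= size_word.
Qed.

Lemma measurable_gen_word : (measurable : set (set fullshift)) = <<s word_sets >>.
Proof.
apply/seteqP; split; apply: smallest_sub.
- exact: smallest_sigma_algebra.
- move=> A /open_bigcup_word ->.
  apply: sigma_algebra_bigcup => n; apply: sub_gen_smallest.
  by exists n, (fun w => cyl w `<=` A).
- exact: sigma_algebra_measurable.
- by move=> _ [n [Q ->]]; exact: measurable_word.
Qed.

Canonical word_tuple x n := Tuple (introT eqP (size_word x n)).

Lemma word_tuple_cyl n (w : n.-tuple 'I_4) :
  (word_tuple^~ n) @^-1` [set w] = cyl w.
Proof.
apply/seteqP; split=> x /=; rewrite /cyl /= size_tuple; first by move=> <-.
by move=> e; apply: val_inj.
Qed.

Lemma measurable_word_tuple n (w : n.-tuple 'I_4) :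
  measurable ((word_tuple^~ n) @^-1` [set w]).
Proof. by rewrite word_tuple_cyl; exact: measurable_cyl. Qed.

End words.

(** * Measures described by their cylinder masses; approximation by word sets *)

Section word_measures.
Variable R : realType.
Implicit Types mu nu : probability fullshift R.

Definition pr mu (w : seq 'I_4) : R := fine (mu (cyl w)).

Lemma bounded_measurable_word (G : seq 'I_4 -> R) n :
  bounded_measurable (fun x => G (word x n)).
Proof.
exact: (bounded_measurable_labelling (@measurable_word_tuple n) (fun w => G w)).
Qed.

Lemma expect_word mu (G : seq 'I_4 -> R) n :
  \int[mu]_x G (word x n) = \sum_(w : n.-tuple 'I_4) G w * pr mu w.
Proof.
rewrite (expect_labelling mu (@measurable_word_tuple n) (fun w => G w)).
by apply: eq_bigr => w _; rewrite word_tuple_cyl.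
Qed.

Lemma expect_cyl mu w : \int[mu]_x ((word x (size w) == w)%:R : R) = pr mu w.
Proof.
rewrite /pr -expect_indic; last exact: measurable_cyl.
apply: eq_Rintegral => x _; rewrite indicE; congr (_%:R).
congr nat_of_bool; apply/eqP/idP => [e|/set_mem//]; exact: mem_set.
Qed.

Lemma eq_probability_word mu nu : (forall w, pr mu w = pr nu w) ->
  forall A, measurable A -> mu A = nu A.
Proof.
move=> mn A mA.
apply: (measure_unique word_sets (fun=> setT)) => //.
- exact: measurable_gen_word.
- exact: word_setsI.
- by move=> _; exists 0%N, (fun=> True); apply/seteqP.
- by rewrite bigcup_const.
- move=> _ [n [Q ->]].
  have mQ : measurable [set x : fullshift | Q (word x n)] by exact: measurable_word.
  suff : (fine (mu [set x | Q (word x n)]))%:E = (fine (nu [set x | Q (word x n)]))%:E.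
    by rewrite !probability_fineK.
  congr (_%:E); rewrite -!expect_indic//.
  under eq_Rintegral do rewrite indicE.
  under [RHS]eq_Rintegral do rewrite indicE.
  have E x : (x \in [set x : fullshift | Q (word x n)]) = `[< Q (word x n) >].
    by apply/idP/asboolP; rewrite inE.
  under eq_Rintegral do rewrite E.
  under [RHS]eq_Rintegral do rewrite E.
  rewrite !(expect_word _ (fun w => `[< Q w >]%:R)).
  by apply: eq_bigr => w _; rewrite mn.
- by move=> k; apply: le_lt_trans (ltry 1); rewrite le_eqVlt; apply/orP; left; apply/eqP; exact: probability_setT.
Qed.

Lemma measurable_left_shift : measurable_fun setT left_shift.
Proof.
apply: (@measurability _ _ _ _ _ _ (@open fullshift)) => // _ [B oB <-].
rewrite setTI (open_bigcup_word oB) preimage_bigcup; apply: bigcup_measurable => n _.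
rewrite (_ : _ @^-1` _ = [set x | cyl (behead (word x n.+1)) `<=` B]).
  exact: (measurable_word (fun w => cyl (behead w) `<=` B)).
apply/funext => x; rewrite /preimage /mkset.
by rewrite wordS.
Qed.

Lemma bounded_measurable_shift (f : fullshift -> R) i :
  bounded_measurable f -> bounded_measurable (fun x => f (iter i left_shift x)).
Proof.
move=> [mf [M fM]]; split; last by exists M => x.
elim: i => [//|i IH]; under eq_fun do rewrite iterSr.
by apply: (measurableT_comp IH); exact: measurable_left_shift.
Qed.

Lemma expect_shift mu (f : fullshift -> R) i :
  invariant_measure left_shift mu -> bounded_measurable f ->
  \int[mu]_x f (iter i left_shift x) = \int[mu]_x f x.
Proof.
move=> inv; elim: i f => [//|i IH] f bf.
under eq_Rintegral do rewrite iterS.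
rewrite (IH (fun x => f (left_shift x))); last exact: (bounded_measurable_shift 1).
rewrite /Rintegral; congr fine.
have := @integral_pushforward _ _ _ _ R left_shift measurable_left_shift mu setT (EFin \o f).
rewrite preimage_setT => <-//; last 2 first.
- by apply/measurable_EFinP; case: bf.
- exact/bounded_measurable_integrable/(bounded_measurable_shift 1).
apply: eq_measure_integral => [|mf A mA _]; first exact: measurable_left_shift.
by rewrite -[RHS](inv A mA).
Qed.

Lemma pr_ge0 mu w : 0 <= pr mu w.
Proof. exact: fine_probability_ge0. Qed.

Lemma pr_nil mu : pr mu [::] = 1.
Proof.
rewrite -expect_cyl -[RHS](expect_cst mu); apply: eq_Rintegral => x _.
by rewrite eqxx.
Qed.

Lemma bounded_measurable_cyl (w : seq 'I_4) :
  bounded_measurable (fun x => (word x (size w) == w)%:R : R).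
Proof. exact: (bounded_measurable_word (fun v => (v == w)%:R)). Qed.

Lemma pr_rcons mu w : pr mu w = \sum_(a : 'I_4) pr mu (rcons w a).
Proof.
under eq_bigr do rewrite -expect_cyl.
rewrite -expect_sum; last by move=> a; exact: bounded_measurable_cyl.
rewrite -expect_cyl; apply: eq_Rintegral => x _.
under eq_bigr do rewrite size_rcons word_rcons eqseq_rcons.
rewrite (bigD1 (x (size w) : 'I_4))//= eqxx andbT big1 ?addr0// => a.
by rewrite eq_sym => /negPf ->; rewrite andbF.
Qed.

Lemma pr_preimage_shift mu w :
  fine (mu (left_shift @^-1` cyl w)) = \sum_(b : 'I_4) pr mu (b :: w).
Proof.
under eq_bigr do rewrite -expect_cyl.
rewrite -expect_sum; last by move=> a; exact: bounded_measurable_cyl.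
have E : left_shift @^-1` cyl w = [set x | behead (word x (size w).+1) = w].
  by apply/seteqP; split=> x; rewrite /preimage /cyl /mkset wordS.
rewrite -expect_indic; last first.
  by rewrite E; exact: (measurable_word (fun v => behead v = w)).
apply: eq_Rintegral => x _; rewrite indicE.
have -> : (x \in left_shift @^-1` cyl w) = (word (left_shift x) (size w) == w).
  by apply/idP/eqP => [/set_mem//|e]; exact: mem_set.
rewrite (bigD1 (x 0%N : 'I_4))//= wordS eqseq_cons eqxx /= big1 ?addr0//.
by move=> a ax; rewrite -[X in X == _]/((x 0%N : 'I_4) :: _) eqseq_cons eq_sym (negPf ax).
Qed.

Lemma pr_cons mu w : invariant_measure left_shift mu ->
  \sum_(b : 'I_4) pr mu (b :: w) = pr mu w.
Proof.
move=> inv; rewrite -pr_preimage_shift /pr inv//; exact: measurable_cyl.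
Qed.

(** The left-hand sides are the cylinder masses of the image of [mu] under the shift, so uniqueness
    on cylinders applies. *)
Lemma invariant_prP mu : (forall w, \sum_(b : 'I_4) pr mu (b :: w) = pr mu w) ->
  invariant_measure left_shift mu.
Proof.
move=> H A mA.
pose X : {mfun fullshift >-> fullshift} := MeasurableFun.Pack
  (MeasurableFun.Class (isMeasurableFun.Build _ _ _ _ _ measurable_left_shift)).
suff: distribution mu X A = mu A by [].
apply: eq_probability_word => // w; rewrite -H -pr_preimage_shift.
by [].
Qed.

Lemma sum_tuple_cons (n : nat) (Q : seq 'I_4 -> R) :
  \sum_(v : n.+1.-tuple 'I_4) Q v = \sum_(b : 'I_4) \sum_(w : n.-tuple 'I_4) Q (b :: w).
Proof.
rewrite pair_big /=.
rewrite (reindex (fun p : 'I_4 * n.-tuple 'I_4 => [tuple of p.1 :: p.2]))//=.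
exists (fun v : n.+1.-tuple 'I_4 => (thead v, [tuple of behead v])) => [[b w] _|v _].
  by congr pair; apply: val_inj.
by apply: val_inj; rewrite /= [in RHS](tuple_eta v).
Qed.

Lemma sum_tuple0 (Q : seq 'I_4 -> R) : \sum_(v : 0.-tuple 'I_4) Q v = Q [::].
Proof.
rewrite (big_pred1 [tuple]) // => v /=; apply/esym/eqP; exact: tuple0.
Qed.

(** The symmetric difference, written as a failed equivalence so that inclusions between such sets
    reduce to propositional reasoning. *)
Definition disagree (A B : set fullshift) : set fullshift :=
  [set x | ~ (A x <-> B x)].

Lemma measurable_disagree A B : measurable A -> measurable B ->
  measurable (disagree A B).
Proof.
move=> mA mB; have -> : disagree A B = (A `\` B) `|` (B `\` A).
  by apply/seteqP; split=> x; rewrite /disagree /=; have [?|?] := pselect (A x);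
    have [?|?] := pselect (B x); tauto.
by apply: measurableU; exact: measurableD.
Qed.

Definition word_approximable mu (A : set fullshift) := measurable A /\
  forall e : R, 0 < e -> exists n (Q : seq 'I_4 -> Prop),
    fine (mu (disagree A [set x | Q (word x n)])) < e.

Lemma word_approximableU mu A B : word_approximable mu A ->
  word_approximable mu B -> word_approximable mu (A `|` B).
Proof.
move=> [mA HA] [mB HB]; split; first exact: measurableU.
move=> e e0; have e20 : 0 < e / 2 by rewrite divr_gt0.
have [m [Q HQ]] := HA _ e20; have [n [S HS]] := HB _ e20.
exists (maxn m n), (fun w => Q (take m w) \/ S (take n w)).
rewrite [e]splitr; apply: le_lt_trans (ltrD HQ HS).
set X := disagree _ _; set Y := disagree _ _; set Z := disagree _ _.
have mY : measurable Y by apply: measurable_disagree => //; exact: measurable_word.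
have mZ : measurable Z by apply: measurable_disagree => //; exact: measurable_word.
have mX : measurable X.
  apply: measurable_disagree; first exact: measurableU.
  exact: (measurable_word (fun w => Q (take m w) \/ S (take n w))).
apply: (@le_trans _ _ (fine (mu (Y `|` Z)))).
  apply: fine_probability_le => //; first exact: measurableU.
  move=> x; rewrite /X /Y /Z /disagree /= !take_word ?leq_maxl ?leq_maxr//.
  have [?|?] := pselect (A x); have [?|?] := pselect (B x);
  have [?|?] := pselect (Q (word x m)); have [?|?] := pselect (S (word x n)); tauto.
rewrite -fineD ?fin_num_measure// fine_le ?fin_numD ?fin_num_measure//.
  exact: measurableU.
exact: measureU2.
Qed.

(** The approximable sets form a sigma-algebra containing [word_sets]. For a countable union,
    continuity of [mu] from below leaves a finite union up to e / 2, and the finite union is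
    approximated up to e / 2. *)
Lemma measurable_approximable mu A : measurable A -> word_approximable mu A.
Proof.
have W n Q : word_approximable mu [set x | Q (word x n)].
  split; first exact: measurable_word.
  move=> e e0; exists n, Q.
  rewrite (_ : disagree _ _ = set0) ?measure0// /disagree.
  by apply/seteqP; split=> x //=; tauto.
suff H : <<s word_sets >> `<=` word_approximable mu.
  by rewrite measurable_gen_word => /H.
apply: smallest_sub; last by move=> _ [n [Q ->]]; exact: W.
have W0 : word_approximable mu set0 by exact: (W 0%N (fun=> False)).
split=> //.
- move=> B [mB HB]; split; first exact: measurableD.
  move=> e /HB [n [Q BQ]]; exists n, (fun w => ~ Q w).
  rewrite (_ : disagree _ _ = disagree B [set x | Q (word x n)])//.
  apply/seteqP; split=> x; rewrite /disagree /=;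
  have [?|?] := pselect (B x); have [?|?] := pselect (Q (word x n)); tauto.
- move=> F HF.
  have mF n : measurable (F n) by have [] := HF n.
  have mU : measurable (\bigcup_n F n) by exact: bigcup_measurable.
  pose G N := \big[setU/set0]_(i < N.+1) F i.
  have WG N : word_approximable mu (G N).
    rewrite /G; elim: N => [|N IH]; first by rewrite big_ord1; exact: HF.
    by rewrite big_ord_recr /=; exact: word_approximableU.
  have mG N : measurable (G N) by have [] := WG N.
  have GU N : G N `<=` \bigcup_n F n.
    by rewrite /G -bigcup_mkord => x [i _ Fx]; exists i.
  have UG : \bigcup_N G N = \bigcup_n F n by exact: bigcup_bigsetU_bigcup.
  split=> // e e0; have e20 : 0 < e / 2 by rewrite divr_gt0.
  have cG : fine \o (mu \o G) @ \oo --> fine (mu (\bigcup_n F n)).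
    apply: fine_cvg; rewrite probability_fineK//.
    rewrite -UG; apply: nondecreasing_cvg_mu => //; first by rewrite UG.
    move=> i j ij; apply/subsetPset; rewrite /G -!bigcup_mkord.
    by move=> x [k /= ki Fx]; exists k => //=; exact: leq_trans ki _.
  move/cvgrPdist_lt : cG => /(_ _ e20) [N _ /(_ _ (leqnn N)) /=].
  have -> : fine (mu (\bigcup_n F n)) =
      fine (mu (\bigcup_n F n `\` G N)) + fine (mu (G N)).
    rewrite -fineD ?fin_num_measure//; last exact: measurableD.
    rewrite (measureDI mu mU (mG N)); congr (fine (_ + mu _)).
    by apply/seteqP; split=> [x []//|x Gx]; split=> //; exact: GU Gx.
  rewrite addrK => /ltr_normlW Ne.
  have [n [Q HQ]] := (WG N).2 _ e20; exists n, Q.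
  have mD : measurable (disagree (G N) [set x | Q (word x n)]).
    by apply: measurable_disagree => //; exact: measurable_word.
  rewrite [e]splitr; apply: le_lt_trans (ltrD Ne HQ).
  have mDD : measurable (\bigcup_n F n `\` G N) by exact: measurableD.
  apply: (@le_trans _ _ (fine (mu ((\bigcup_n F n `\` G N) `|` disagree (G N) [set x | Q (word x n)])))).
    apply: fine_probability_le; [|exact: measurableU|].
      by apply: measurable_disagree => //; exact: measurable_word.
    move=> x; rewrite /disagree /setU /setD /mkset; have := GU N x.
    have [?|?] := pselect (G N x); have [?|?] := pselect ((\bigcup_n F n) x);
    have [?|?] := pselect (Q (word x n)); tauto.
  rewrite -fineD ?fin_num_measure// fine_le ?fin_numD ?fin_num_measure//.
    exact: measurableU.
  exact: measureU2.
Qed.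

End word_measures.

(** * The Gibbs inequality for one and for two labellings *)

Section gibbs.
Context d (T : measurableType d) (R : realType) (mu : probability T R).

(** This is ln (q / p) <= q / p - 1 multiplied by [p]; the terms q - p sum to at most 0 when [q] is
    a subprobability. *)
Lemma gibbs_term (p q : R) : 0 <= p -> 0 < q ->
  - (p * ln p) <= - ln q * p + (q - p).
Proof.
rewrite le_eqVlt => /predU1P[<-|p0] q0.
  by rewrite mul0r mulr0 oppr0 add0r addr0 ltW.
have : ln (q / p) <= q / p - 1.
  rewrite {1}(_ : q / p = 1 + (q / p - 1)); last by ring.
  by apply: le_ln1Dx; rewrite ltrBrDl subrr divr_gt0.
rewrite ln_div ?posrE// => /(ler_wpM2l (ltW p0)).
rewrite [p * (q / p - 1)]mulrBr mulr1 mulrCA divff ?gt_eqF// mulr1 mulrBr.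
lra.
Qed.

Lemma gibbs (I : finType) (F : T -> I) (q : I -> R) :
  (forall i, measurable (F @^-1` [set i])) ->
  (forall i, 0 < q i) -> \sum_i q i <= 1 ->
  \sum_i - (fine (mu (F @^-1` [set i])) * ln (fine (mu (F @^-1` [set i])))) <=
  \int[mu]_x - ln (q (F x)).
Proof.
move=> mF q0 q1; rewrite (expect_labelling mu mF (fun i => - ln (q i))).
set p := fun i => fine (mu (F @^-1` [set i])).
apply: (@le_trans _ _ (\sum_i (- ln (q i) * p i + (q i - p i)))).
  by apply: ler_sum => i _; apply: gibbs_term => //; exact: fine_probability_ge0.
rewrite big_split /= gerDl sumrB subr_le0; apply: le_trans q1 _.
by rewrite sum_labelling.
Qed.

Section two_labellings.
Context (I J : finType) (F : T -> I) (G : T -> J).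
Hypothesis mF : forall i, measurable (F @^-1` [set i]).
Hypothesis mG : forall j, measurable (G @^-1` [set j]).

Lemma measurable_labelling_pair (k : I * J) :
  measurable ((fun x => (F x, G x)) @^-1` [set k]).
Proof.
have -> : (fun x => (F x, G x)) @^-1` [set k] =
    F @^-1` [set k.1] `&` G @^-1` [set k.2].
  by case: k => i j; apply/seteqP; split=> x /= [-> ->].
exact: measurableI.
Qed.

(** The entropy of [F] is at most that of the pair, to which [gibbs] applies. Later [F] is the name
    of a point for an arbitrary partition and [G] is its word, on which comparison measures are
    explicit. *)
Lemma gibbs_joint (q : I -> J -> R) :
  (forall i j, 0 < q i j) -> \sum_i \sum_j q i j <= 1 ->
  \sum_i - (fine (mu (F @^-1` [set i])) * ln (fine (mu (F @^-1` [set i])))) <=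
  \int[mu]_x - ln (q (F x) (G x)).
Proof.
move=> q0 q1; rewrite pair_big /= in q1.
have := gibbs measurable_labelling_pair (q := fun k => q k.1 k.2)
  (fun k => q0 k.1 k.2) q1.
apply: le_trans.
set p := fun k => fine (mu ((fun x => (F x, G x)) @^-1` [set k])).
have pE i : fine (mu (F @^-1` [set i])) = \sum_j p (i, j).
  rewrite -expect_indic//.
  transitivity (\int[mu]_x (((F x, G x).1 == i)%:R : R)).
    apply: eq_Rintegral => x _; rewrite indicE; congr (nat_of_bool _)%:R.
    by apply/idP/eqP => [/set_mem//|e]; exact: mem_set.
  rewrite (expect_labelling mu measurable_labelling_pair (fun k => (k.1 == i)%:R)).
  transitivity (\sum_i' \sum_j (i' == i)%:R * p (i', j)).
    by rewrite pair_bigA; apply: eq_bigr => -[].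
  rewrite (bigD1 i)//= [X in _ + X]big1 ?addr0 => [|i' ii'].
    by apply: eq_bigr => j _; rewrite eqxx mul1r.
  by rewrite big1// => j _; rewrite (negPf ii') mul0r.
apply: (@le_trans _ _ (\sum_i \sum_j - (p (i, j) * ln (p (i, j))))); last first.
  by rewrite pair_bigA; apply: ler_sum => -[].
(* Refining increases entropy: each joint mass is at most its row sum, hence so is its logarithm. *)
apply: ler_sum => i _; rewrite pE big_distrl /= -sumrN.
apply: ler_sum => j _; rewrite lerN2.
have : 0 <= p (i, j) by exact: fine_probability_ge0.
rewrite le_eqVlt => /predU1P[<-|pij]; first by rewrite !mul0r.
rewrite ler_pM2l// ler_ln ?posrE//.
  rewrite (bigD1 j)//= lerDl; apply: sumr_ge0 => k _; exact: fine_probability_ge0.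
apply: lt_le_trans pij _.
by rewrite (bigD1 j)//= lerDl; apply: sumr_ge0 => k _; exact: fine_probability_ge0.
Qed.

End two_labellings.
End gibbs.

(** * Entropy bounds from weights on words *)

Lemma prod_le1 (R : realDomainType) (I : Type) (r : seq I) (F : I -> R) :
  (forall i, 0 <= F i <= 1) -> \prod_(i <- r) F i <= 1.
Proof.
move=> F01; suff /andP[] : 0 <= \prod_(i <- r) F i <= 1 by [].
elim/big_ind: _ => [|x y /andP[x0 x1] /andP[y0 y1]|//]; first by rewrite ler01 lexx.
by rewrite mulr_ge0// mulr_ile1.
Qed.

Lemma ln_prod (R : realType) (I : Type) (r : seq I) (F : I -> R) :
  (forall i, 0 < F i) -> ln (\prod_(i <- r) F i) = \sum_(i <- r) ln (F i).
Proof.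
move=> F0; elim: r => [|i r IH]; first by rewrite !big_nil ln1.
by rewrite !big_cons lnM ?posrE// ?IH//; exact: prodr_gt0.
Qed.

Lemma measurable_iter_shift i : measurable_fun setT (iter i left_shift).
Proof.
elim: i => [|i IH]; first exact: measurable_id.
by apply: measurableT_comp IH; exact: measurable_left_shift.
Qed.

Lemma measurable_partition_iter m (c : fullshift -> 'I_m) n :
  measurable_partition c -> forall u : {ffun 'I_n -> 'I_m},
  measurable ((fun x => [ffun i : 'I_n => c (iter i left_shift x)]) @^-1` [set u]).
Proof.
move=> mc u.
have -> : (fun x => [ffun i : 'I_n => c (iter i left_shift x)]) @^-1` [set u] =
    ~` \big[setU/set0]_(i < n) ~` (iter i left_shift @^-1` (c @^-1` [set u i])).
  apply/seteqP; split=> x /=.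
    by move=> <-; rewrite -bigcup_seq => -[i _] /=; rewrite ffunE.
  move=> H; apply/ffunP => i; rewrite ffunE; apply: contrapT => ci; apply: H.
  by rewrite -bigcup_seq; exists i => //=; rewrite mem_index_enum.
apply: measurableC; apply: bigsetU_measurable => i _; apply: measurableC.
rewrite -[X in measurable X]setTI; apply: measurable_iter_shift => //; exact: mc.
Qed.

Lemma join_entropyE (R : realType) (mu : probability fullshift R) m
    (c : fullshift -> 'I_m) n :
  let F x := [ffun i : 'I_n => c (iter i left_shift x)] in
  join_entropy left_shift mu c n =
  \sum_u - (fine (mu (F @^-1` [set u])) * ln (fine (mu (F @^-1` [set u])))).
Proof.
move=> F; apply: eq_bigr => u _.
have -> // : [set x | forall i : 'I_n, c (iter i left_shift x) = u i] = F @^-1` [set u].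
apply/seteqP; split=> x /=; first by move=> H; apply/ffunP => i; rewrite ffunE.
by move=> <- i; rewrite ffunE.
Qed.

(* If [u] diverges then [limn u] is the default point [0]. *)
Lemma limn_le_cvg (R : realType) (u v : nat -> R) (l : R) :
  (forall n, 0 <= u n) -> (forall n, u n <= v n) -> v n @[n --> \oo] --> l ->
  limn u <= l.
Proof.
move=> u0 uv vl; have [cu|/dvgP ->] := pselect (cvgn u).
  have <- : limn v = l by exact/cvg_lim.
  apply: ler_lim => //; first by apply/cvg_ex; exists l.
  exact: nearW.
have -> : (point : R) = 0 by [].
have <- : limn v = l by exact/cvg_lim.
apply: limr_ge; first by apply/cvg_ex; exists l.
by apply: nearW => n; exact: le_trans (u0 n) (uv n).
Qed.

(** Names of length n will be compared with words of length n + N; the look-ahead [N] must not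
    change the average. *)
Lemma cvg_shift_average (R : realType) (u : nat -> R) (l : R) N :
  u n / n%:R @[n --> \oo] --> l -> u (n.+1 + N)%N / n.+1%:R @[n --> \oo] --> l.
Proof.
move=> ul.
have h1 : u (n.+1 + N)%N / (n.+1 + N)%:R @[n --> \oo] --> l.
  have E : (fun n => u (n.+1 + N)%N / (n.+1 + N)%:R) =
      [sequence u (n + N.+1)%N / (n + N.+1)%:R]_n.
    by apply/funext => n /=; rewrite addSn addnS.
  by rewrite E (cvg_shiftn N.+1 (fun n => u n / n%:R)).
have h2 : 1 + N%:R * harmonic n @[n --> \oo] --> (1 + N%:R * 0 : R).
  apply: cvgD; first exact: cvg_cst.
  apply: cvgM; [exact: cvg_cst|exact: cvg_harmonic].
have E : (fun n => u (n.+1 + N)%N / n.+1%:R) =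
    (fun n => u (n.+1 + N)%N / (n.+1 + N)%:R * (1 + N%:R * harmonic n)).
  apply/funext => n; rewrite /harmonic /=.
  have n0 : n.+1%:R != 0 :> R by rewrite pnatr_eq0.
  have nN0 : n.+1%:R + N%:R != 0 :> R by rewrite -natrD pnatr_eq0 addSn.
  have -> : 1 + N%:R / n.+1%:R = (n.+1 + N)%:R / n.+1%:R :> R.
    by rewrite natrD mulrDl mulfV.
  by rewrite mulrA divfK// natrD.
have H := cvgM h1 h2; rewrite mulr0 addr0 mulr1 in H.
by rewrite E; exact: H.
Qed.

Section entropy_upper_bound.
Variables (R : realType) (mu : probability fullshift R).

Lemma measurable_neq_word m (c : fullshift -> 'I_m) N (c' : seq 'I_4 -> 'I_m) :
  measurable_partition c -> measurable [set x | c x <> c' (word x N)].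
Proof.
move=> mc; have -> : [set x | c x <> c' (word x N)] = ~` \big[setU/set0]_i
   (c @^-1` [set i] `&` [set x | c' (word x N) = i]).
  apply/seteqP; split=> x /=.
    by move=> cx; rewrite -bigcup_seq => -[i _ [/= ci c'i]]; apply: cx; rewrite ci c'i.
  move=> nb cx; apply: nb; rewrite -bigcup_seq; exists (c x) => //=.
  by rewrite mem_index_enum.
apply: measurableC; apply: bigsetU_measurable => i _.
by apply: measurableI => //; exact: (measurable_word (fun w => c' w = i)).
Qed.

(** Each cell is replaced by a word set up to e / (m + 1), and [c'] picks a cell whose word set
    contains the word. A wrong pick, and the default [ord0] when there is none, can be wrong only at
    a point where some cell disagrees with its word set. *)
Lemma labelling_approx m (c : fullshift -> 'I_m.+1) (e : R) :
  measurable_partition c -> 0 < e ->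
  exists N (c' : seq 'I_4 -> 'I_m.+1),
    fine (mu [set x | c x <> c' (word x N)]) <= e.
Proof.
move=> mc e0.
have e1 : 0 < e / m.+1%:R by rewrite divr_gt0.
pose good i (nQ : nat * (seq 'I_4 -> Prop)) := fine (mu (disagree (c @^-1` [set i])
   [set x | nQ.2 (word x nQ.1)])) < e / m.+1%:R.
have /choice [nQ HnQ] : forall i, exists nQ, good i nQ.
  move=> i; have [_ /(_ _ e1) [n [Q HQ]]] := measurable_approximable mu (mc i).
  by exists (n, Q).
pose N := (\max_i (nQ i).1)%N.
pose P w i := (nQ i).2 (take (nQ i).1 w).
pose c' w := odflt ord0 [pick i | `[< P w i >]].
exists N, c'.
have mD i : measurable (disagree (c @^-1` [set i]) [set x | (nQ i).2 (word x (nQ i).1)]).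
  by apply: measurable_disagree => //; exact: measurable_word.
have sub : [set x | c x <> c' (word x N)] `<=` \big[setU/set0]_i
    (disagree (c @^-1` [set i]) [set x | (nQ i).2 (word x (nQ i).1)]).
  move=> x /= cx; apply: contrapT => nx; apply: cx.
  have agree i : c x = i <-> P (word x N) i.
    apply: contrapT => H; apply: nx; rewrite -bigcup_seq.
    exists i; first by rewrite /= mem_index_enum.
    rewrite /disagree /=; rewrite /P take_word// in H.
    exact: (@leq_bigmax _ (fun i => (nQ i).1)).
  rewrite /c'; case: pickP => [i /asboolP /agree //|/(_ (c x))].
  by move=> /asboolPn; case; exact/agree.
have mneq := measurable_neq_word N c' mc.
pose D i := disagree (c @^-1` [set i]) [set x | (nQ i).2 (word x (nQ i).1)].
apply: (@le_trans _ _ (\sum_i fine (mu (D i)))); last first.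
  have -> : e = \sum_(i < m.+1) e / m.+1%:R.
    by rewrite sumr_const card_ord -(mulr_natr (e / _)) divfK// pnatr_eq0.
  by apply: ler_sum => i _; exact/ltW/HnQ.
rewrite -expect_indic//.
have -> : \sum_i fine (mu (D i)) = \sum_i \int[mu]_x \1_(D i) x.
  by apply: eq_bigr => i _; rewrite (expect_indic mu (mD i)).
rewrite -expect_sum; last first.
  by move=> i; apply: bounded_measurable_indic; exact: mD.
apply: le_expect; first exact: bounded_measurable_indic.
  by apply: bounded_measurable_sum => i; apply: bounded_measurable_indic; exact: mD.
move=> x; rewrite indicE; case: (boolP (x \in _)) => [/set_mem /sub|_]; last first.
  by apply: sumr_ge0 => i _; rewrite indicE.
rewrite -bigcup_seq => -[i _ Dx]; rewrite (bigD1 i)//= indicE mem_set// lerDl.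
by apply: sumr_ge0 => k _; rewrite indicE.
Qed.

(* The [c]-name of length [n] and the word of length [n + N] are jointly compared
   with the subprobability [q w * \prod_i kap (u_i, c' w_i)], where [c'] is a
   word-measurable approximation of [c] and [kap] charges the errors. *)
Lemma partition_entropy_le (q : nat -> seq 'I_4 -> R) (l : R)
    m (c : fullshift -> 'I_m) :
  invariant_measure left_shift mu -> measurable_partition c ->
  (forall n w, 0 < q n w) -> (forall n, \sum_(w : n.-tuple 'I_4) q n w <= 1) ->
  (\int[mu]_x - ln (q n (word x n))) / n%:R @[n --> \oo] --> l ->
  partition_entropy left_shift mu c <= l.
Proof.
move=> inv mc q0 q1 ql.
case: m c mc => [c _|m c mc]; first by case: (c point).
suff He : forall e : R, 0 < e -> partition_entropy left_shift mu c <= l + e.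
  by apply/ler_addgt0Pr => e; exact: He.
move=> e e0; have e20 : 0 < e / 2 by rewrite divr_gt0.
(* A correct guess has weight [k1] and costs e / 2 per letter of the name. A wrong one has weight
   [k2], a share of the remaining mass; [eta] makes wrong guesses so rare that their expected cost
   is at most e / 2 as well. *)
pose k1 : R := expR (- (e / 2)).
have k11 : k1 < 1 by rewrite -expR0 ltr_expR oppr_lt0.
have k10 : 0 < k1 by exact: expR_gt0.
pose k2 : R := (1 - k1) / m.+1%:R.
have k20 : 0 < k2 by rewrite divr_gt0// subr_gt0.
pose kap (u v : 'I_m.+1) := if u == v then k1 else k2.
have kap0 u v : 0 < kap u v by rewrite /kap; case: ifP.
have kap1 v : \sum_u kap u v <= 1.
  apply: (@le_trans _ _ (k1 + \sum_(u < m.+1) k2)).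
    rewrite (bigD1 v)//= /kap eqxx lerD2l [leRHS](bigD1 v)//= ler_wpDl ?(ltW k20)//.
    by apply: ler_sum => u uv; rewrite (negPf uv).
  rewrite sumr_const card_ord /k2 -(mulr_natr ((1 - k1) / _)) divfK ?pnatr_eq0//; lra.
pose eta := e / 2 / (1 + `|ln k2|).
have lk2 : 0 < 1 + `|ln k2| by rewrite ltr_pwDl.
have eta0 : 0 < eta by rewrite divr_gt0.
have [N [c' Hc']] := labelling_approx mc eta0.
have mneq := measurable_neq_word N c' mc.
pose A n := \int[mu]_x - ln (q n (word x n)).
pose g x := - ln (kap (c x) (c' (word x N))).
have bg : bounded_measurable g.
  have -> : g = fun x => - ln k1 + (ln k1 - ln k2) * \1_[set x | c x <> c' (word x N)] x.
    apply/funext => x; rewrite /g /kap indicE; case: eqP => [cc|cc].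
      by rewrite memNset ?mulr0 ?addr0// => /(_ cc).
    by rewrite mem_set// mulr1; ring.
  apply: bounded_measurableD; first exact: bounded_measurable_cst.
  apply: bounded_measurableM; first exact: bounded_measurable_cst.
  exact: bounded_measurable_indic.
have Eg : \int[mu]_x g x <= e.
  apply: (@le_trans _ _ (\int[mu]_x (e / 2 + `|ln k2| * \1_[set x | c x <> c' (word x N)] x))).
    apply: le_expect => //.
      apply: bounded_measurableD; first exact: bounded_measurable_cst.
      apply: bounded_measurableM; first exact: bounded_measurable_cst.
      exact: bounded_measurable_indic.
    move=> x; rewrite /g /kap indicE; case: eqP => [cc|cc].
      by rewrite memNset ?mulr0 ?addr0 ?expRK ?opprK// => /(_ cc).
    rewrite mem_set// mulr1; apply: le_trans (ler_norm _) _; rewrite normrN.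
    by rewrite lerDr ltW.
  rewrite expectD; last 2 first.
  - exact: bounded_measurable_cst.
  - apply: bounded_measurableM; first exact: bounded_measurable_cst.
    exact: bounded_measurable_indic.
  rewrite expect_cst expectZ ?expect_indic//; last exact: bounded_measurable_indic.
  rewrite [leRHS]splitr lerD2l.
  apply: (@le_trans _ _ ((1 + `|ln k2|) * eta)).
    by apply: ler_pM => //; [exact: fine_probability_ge0|rewrite lerDr].
  by rewrite /eta mulrC divfK// gt_eqF.
pose F n (x : fullshift) : {ffun 'I_n -> 'I_m.+1} := [ffun i : 'I_n => c (iter i left_shift x)].
(* The word has [N] additional letters so that each of the [n] positions of the name sees a full
   window of length [N]. *)
have H n : join_entropy left_shift mu c n <= A (n + N)%N + n%:R * e.
  pose Q (u : {ffun 'I_n -> 'I_m.+1}) (w : (n + N).-tuple 'I_4) :=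
    q (n + N)%N w * \prod_(i < n) kap (u i) (c' (take N (drop i w))).
  have Q0 u w : 0 < Q u w by rewrite /Q mulr_gt0// prodr_gt0.
  have Q1 : \sum_u \sum_w Q u w <= 1.
    rewrite exchange_big /=; apply: le_trans (q1 (n + N)%N).
    apply: ler_sum => w _; rewrite /Q -mulr_sumr ler_piMr ?(ltW (q0 _ _))//.
    rewrite -(bigA_distr_bigA (fun (i : 'I_n) u => kap u (c' (take N (drop i w))))).
    apply: prod_le1 => i; rewrite kap1 andbT.
    by apply: sumr_ge0 => u _; exact: ltW.
  have mF := @measurable_partition_iter _ _ n mc.
  have := @gibbs_joint _ _ _ mu _ _ (F n) (fun x => word_tuple x (n + N)) mF
    (@measurable_word_tuple _) Q Q0 Q1.
  rewrite -join_entropyE => /le_trans; apply.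
  have -> : \int[mu]_x - ln (Q (F n x) (word_tuple x (n + N))) =
      \int[mu]_x (- ln (q (n + N)%N (word x (n + N))) + \sum_(i < n) g (iter i left_shift x)).
    apply: eq_Rintegral => x _; rewrite /Q lnM ?posrE ?prodr_gt0// opprD; congr (_ + _).
    rewrite ln_prod // -sumrN; apply: eq_bigr => i _.
    rewrite /g ffunE drop_word take_word//.
    by rewrite -addnBAC ?(ltnW (ltn_ord i))// leq_addl.
  have bgi i : bounded_measurable (fun x => g (iter i left_shift x)).
    exact: bounded_measurable_shift.
  rewrite expectD; last 2 first.
  - exact: (bounded_measurable_word (fun w => - ln (q (n + N)%N w))).
  - exact: bounded_measurable_sum.
  rewrite lerD2l expect_sum//; apply: (@le_trans _ _ (\sum_(i < n) e)).
    by apply: ler_sum => i _; rewrite expect_shift.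
  by rewrite sumr_const card_ord mulr_natl.
(* Dropping the index 0 changes neither the limit nor, in case of divergence, the default value: the
   two convergence predicates are equal. *)
have -> : partition_entropy left_shift mu c =
    limn (fun n => join_entropy left_shift mu c n.+1 / n.+1%:R).
  rewrite /partition_entropy /lim /lim_in; congr get; apply/funext => z.
  exact: esym (cvg_shiftS (fun n => join_entropy left_shift mu c n / n%:R) (nbhs z)).
apply: (@limn_le_cvg _ _ (fun n => A (n.+1 + N)%N / n.+1%:R + e)).
- move=> n; apply: divr_ge0 => //; rewrite join_entropyE; apply: sumr_ge0 => u _.
  have mu1 := @measurable_partition_iter _ _ n.+1 mc u.
  rewrite oppr_ge0 mulr_ge0_le0 ?fine_probability_ge0// ln_le0//.
  by rewrite -lee_fin probability_fineK// probability_le1.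
- move=> n; rewrite ler_pdivrMr ?ltr0n// mulrDl divfK ?pnatr_eq0// mulrC; exact: H.
- apply: cvgD; last exact: cvg_cst.
  exact: cvg_shift_average ql.
Qed.

Lemma entropy_le (q : nat -> seq 'I_4 -> R) (l : R) :
  invariant_measure left_shift mu ->
  (forall n w, 0 < q n w) -> (forall n, \sum_(w : n.-tuple 'I_4) q n w <= 1) ->
  (\int[mu]_x - ln (q n (word x n))) / n%:R @[n --> \oo] --> l ->
  (entropy left_shift mu <= l%:E)%E.
Proof.
move=> inv q0 q1 ql; apply: ub_ereal_sup => _ [m [c [mc ->]]].
by rewrite lee_fin; exact: partition_entropy_le ql.
Qed.

(** The exponential of a Birkhoff sum read on a finite word: each shift of the point is evaluated on
    the suffix that is still visible. *)
Fixpoint word_weight (W : seq 'I_4 -> R) (w : seq 'I_4) : R :=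
  if w is b :: w' then W w * word_weight W w' else 1.

Lemma word_weight_gt0 (W : seq 'I_4 -> R) w : (forall w, 0 < W w) -> 0 < word_weight W w.
Proof. by move=> W0; elim: w => [//|b w IH] /=; rewrite mulr_gt0. Qed.

(** By invariance each suffix may be read at the origin. The resulting partial sums make the
    averages accessible to the Cesaro theorem. *)
Lemma expect_ln_weight (W : seq 'I_4 -> R) n : invariant_measure left_shift mu ->
  (forall w, 0 < W w) ->
  \int[mu]_x - ln (word_weight W (word x n)) =
  series (fun k => \int[mu]_x - ln (W (word x k.+1))) n.
Proof.
move=> inv W0; elim: n => [|n IH].
  rewrite seriesEnat /= big_geq// -[RHS](expect_cst mu); apply: eq_Rintegral => x _.
  by rewrite ln1 oppr0.
rewrite seriesSr -IH addrC.
rewrite -(expect_shift 1 inv (f := fun x => - ln (word_weight W (word x n)))); last first.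
  exact: (bounded_measurable_word (fun w => - ln (word_weight W w))).
rewrite -expectD; last 2 first.
- exact: (bounded_measurable_word (fun w => - ln (W w))).
- apply: (@bounded_measurable_shift R (fun x => - ln (word_weight W (word x n))) 1).
  exact: (bounded_measurable_word (fun w => - ln (word_weight W w))).
apply: eq_Rintegral => x _; rewrite wordS /= -wordS lnM ?posrE//.
  by rewrite opprD.
exact: word_weight_gt0.
Qed.

(* [H] is a supersolution of the transfer operator with weight [W]. *)
Lemma word_weight_bound (W H : seq 'I_4 -> R) (kappa : R) :
  (forall w, 0 < W w) -> 0 < kappa -> (forall w, kappa <= H w) ->
  (forall w, w != [::] -> \sum_(b : 'I_4) W (b :: w) * H (b :: w) <= H w) ->
  exists2 K : R, 0 < K & forall n, \sum_(w : n.-tuple 'I_4) word_weight W w <= K.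
Proof.
move=> W0 k0 kH WH.
have H0 w : 0 < H w by exact: lt_le_trans (kH w).
have om0 w : 0 < word_weight W w by exact: word_weight_gt0.
pose S n := \sum_(w : n.-tuple 'I_4) word_weight W w * H w.
have SS n : S n.+2 <= S n.+1.
  rewrite /S (sum_tuple_cons n.+1 (fun w => word_weight W w * H w)) exchange_big /=.
  apply: ler_sum => w _.
  under eq_bigr do rewrite mulrAC.
  rewrite -mulr_suml mulrC ler_pM2l// WH//.
  by rewrite -size_eq0 size_tuple.
(* The supersolution inequality is assumed for nonempty words only, so [S] is known to decrease from
   length 1 on. *)
pose K := S 0%N + S 1%N.
have Spos n : 0 <= S n.
  by apply: sumr_ge0 => w _; rewrite mulr_ge0// ltW.
have S00 : 0 < S 0%N by rewrite /S (sum_tuple0 (fun w => word_weight W w * H w)) mulr_gt0.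
have SK n : S n <= K.
  case: n => [|n]; first by rewrite lerDl.
  elim: n => [|n IH]; first by rewrite lerDr.
  exact: le_trans (SS n) IH.
exists (K / kappa); first by rewrite divr_gt0// ltr_wpDr.
move=> n; rewrite ler_pdivlMr//; apply: le_trans (SK n).
by rewrite mulr_suml; apply: ler_sum => w _; rewrite ler_pM2l.
Qed.

Lemma cvg_expect_weight (W : seq 'I_4 -> R) (K l : R) :
  invariant_measure left_shift mu -> (forall w, 0 < W w) -> 0 < K ->
  \int[mu]_x - ln (W (word x k)) @[k --> \oo] --> l ->
  (\int[mu]_x - ln (word_weight W (word x n) * K)) / n%:R @[n --> \oo] --> l.
Proof.
move=> inv W0 K0 Wl.
rewrite -cvg_shiftS.
have E : (fun n => (\int[mu]_x - ln (word_weight W (word x n.+1) * K)) / n.+1%:R) =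
   (fun n => arithmetic_mean (fun k => \int[mu]_x - ln (W (word x k.+1))) n
        + - ln K * harmonic n).
  apply/funext => n.
  rewrite -[RHS]/(n.+1%:R^-1 * series _ n.+1 + - ln K * n.+1%:R^-1).
  rewrite -expect_ln_weight// [X in _ = X + _]mulrC -mulrDl; congr (_ * _).
  rewrite -[- ln K](expect_cst mu) -expectD; last 2 first.
  - exact: (bounded_measurable_word (fun w => - ln (word_weight W w))).
  - exact: bounded_measurable_cst.
  by apply: eq_Rintegral => x _; rewrite lnM ?posrE ?word_weight_gt0// opprD.
rewrite -[X in X @ \oo --> _]/(fun n => (\int[mu]_x - ln (word_weight W (word x n.+1) * K)) / n.+1%:R).
rewrite E -[l]addr0 -[X in l + X](mulr0 (- ln K)).
apply: cvgD; last by apply: cvgM; [exact: cvg_cst|exact: cvg_harmonic].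
apply: cesaro; rewrite (cvg_shiftS (fun k => \int[mu]_x - ln (W (word x k)))).
exact: Wl.
Qed.

Lemma entropy_le_weight (W : seq 'I_4 -> R) (K l : R) :
  invariant_measure left_shift mu ->
  (forall w, 0 < W w) -> 0 < K ->
  (forall n, \sum_(w : n.-tuple 'I_4) word_weight W w <= K) ->
  \int[mu]_x - ln (W (word x k)) @[k --> \oo] --> l ->
  (entropy left_shift mu <= l%:E)%E.
Proof.
move=> inv W0 K0 WK Wl.
apply: (@entropy_le (fun _ w => word_weight W w * K^-1)) => //.
- by move=> n w; rewrite mulr_gt0 ?word_weight_gt0 ?invr_gt0.
- by move=> n; rewrite -mulr_suml ler_pdivrMr// mul1r; exact: WK.
- by apply: cvg_expect_weight => //; rewrite invr_gt0.
Qed.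

Lemma sum_ffun_tuple n (Q : seq 'I_4 -> R) :
  \sum_(u : {ffun 'I_n -> 'I_4}) Q [tuple u i | i < n] =
  \sum_(w : n.-tuple 'I_4) Q w.
Proof.
rewrite [RHS](reindex (fun u : {ffun 'I_n -> 'I_4} => [tuple u i | i < n]))//=.
exists (fun w : n.-tuple 'I_4 => [ffun i => tnth w i]) => [u _|w _].
  by apply/ffunP => i; rewrite ffunE tnth_mktuple.
by apply: eq_from_tnth => i; rewrite tnth_mktuple ffunE.
Qed.

Lemma coordinate_word (x : fullshift) n :
  [tuple [ffun i : 'I_n => (iter i left_shift x 0%N : 'I_4)] i | i < n] = word x n :> seq 'I_4.
Proof.
apply: (@eq_from_nth _ ord0); first by rewrite size_tuple size_word.
move=> i; rewrite size_tuple => ni; rewrite nth_word//.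
rewrite -[i]/(val (Ordinal ni)) -tnth_nth tnth_mktuple ffunE.
by rewrite iter_shift addn0.
Qed.

Lemma measurable_coordinate :
  measurable_partition (fun x : fullshift => x 0%N : 'I_4).
Proof. by move=> a; exact: (measurable_open_fullshift (open_coord 0 a)). Qed.

(** The partition by the first letter attains [l]. The mass bound controls its join entropies from
    below; the Gibbs inequality controls them from above, so that the limit defining
    [partition_entropy] really exists. *)
Lemma entropy_ge_weight (W : seq 'I_4 -> R) (K K' l : R) :
  invariant_measure left_shift mu ->
  (forall w, 0 < W w) -> 0 < K -> 0 < K' ->
  (forall n, \sum_(w : n.-tuple 'I_4) word_weight W w <= K) ->
  (forall w, pr mu w <= word_weight W w * K') ->
  \int[mu]_x - ln (W (word x k)) @[k --> \oo] --> l ->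
  (l%:E <= entropy left_shift mu)%E.
Proof.
move=> inv W0 K0 K0' WK prK Wl.
pose c (x : fullshift) : 'I_4 := x 0%N.
suff -> : l = partition_entropy left_shift mu c.
  apply: ereal_sup_ubound; exists 4%N, c; split=> //; exact: measurable_coordinate.
have mF n := @measurable_partition_iter _ _ n measurable_coordinate.
pose F n (x : fullshift) := [ffun i : 'I_n => c (iter i left_shift x)].
have FE n u : F n @^-1` [set u] = cyl [tuple u i | i < n].
  apply/seteqP; split=> x; rewrite /cyl /= size_map size_enum_ord.
    by move=> <-; rewrite -coordinate_word.
  move=> e; apply/ffunP => i; rewrite ffunE /c iter_shift addn0.
  rewrite -(nth_word x (ltn_ord i)) e (nth_map i) ?size_enum_ord//.
  by rewrite nth_ord_enum.
have lo n : \int[mu]_x - ln (word_weight W (word x n) * K') <= join_entropy left_shift mu c n.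
  rewrite join_entropyE.
  under eq_Rintegral do rewrite -coordinate_word.
  rewrite (expect_labelling mu (mF n) (fun u => - ln (word_weight W [tuple u i | i < n] * K'))).
  apply: ler_sum => u _; rewrite -/c -/(F n) FE mulNr lerN2.
  have : 0 <= pr mu [tuple u i | i < n] by exact: pr_ge0.
  rewrite /pr le_eqVlt => /predU1P[<-|p0]; first by rewrite mul0r mulr0.
  rewrite mulrC ler_pM2r// ler_ln ?posrE ?mulr_gt0 ?word_weight_gt0//.
  exact: prK.
have hi n : join_entropy left_shift mu c n <= \int[mu]_x - ln (word_weight W (word x n) * K^-1).
  rewrite join_entropyE.
  under eq_Rintegral do rewrite -coordinate_word.
  apply: (@gibbs _ _ _ mu _ (F n) (fun u : {ffun 'I_n -> 'I_4} => word_weight W [tuple u i | i < n] * K^-1)).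
  - exact: mF.
  - by move=> u; rewrite mulr_gt0 ?word_weight_gt0 ?invr_gt0.
  - by rewrite -mulr_suml ler_pdivrMr// mul1r sum_ffun_tuple; exact: WK.
apply/esym/cvg_lim => //.
have K1 : 0 < K^-1 by rewrite invr_gt0.
apply: (@squeeze_cvgr _ _ _ _ _ _ _ _ _ (cvg_expect_weight inv W0 K0' Wl)
  (cvg_expect_weight inv W0 K1 Wl)).
by apply: nearW => n; rewrite !ler_wpM2r ?invr_ge0.
Qed.

End entropy_upper_bound.

(** * Existence of a measure with prescribed cylinder masses *)

Section unit_interval.
Variable R : realType.

(* Measures with given cylinder masses are images of Lebesgue measure on [0, 1[
   under the coding of points by nested intervals of these lengths. *)
Definition unit_lebesgue : set (measurableTypeR R) -> \bar R :=
  mrestr (@lebesgue_measure R) (measurable_itv `[0 : R, 1[).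

HB.instance Definition _ := Measure.copy unit_lebesgue
  (mrestr (@lebesgue_measure R) (measurable_itv `[0 : R, 1[)).

Let unit_lebesgueT : unit_lebesgue setT = 1%E.
Proof.
by rewrite /unit_lebesgue /mrestr setTI lebesgue_measure_itv/= lte_fin ltr01 oppr0 adde0.
Qed.

HB.instance Definition _ := Measure_isProbability.Build _ _ _ unit_lebesgue
  unit_lebesgueT.

End unit_interval.

Section cylinder_extension.
Variables (R : realType) (m : seq 'I_4 -> R).
Hypothesis m_ge0 : forall w, 0 <= m w.
Hypothesis m_nil : m [::] = 1.
Hypothesis m_rcons : forall w, m w = \sum_(a : 'I_4) m (rcons w a).

(** The total mass of the words of the same length that precede [w] lexicographically; [threshold]
    lists the division points of the interval of [w] into those of its four extensions. *)
Definition left_end (w : seq 'I_4) : R :=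
  \sum_(i < size w) \sum_(b : 'I_4 | (b < nth ord0 w i)%N) m (rcons (take i w) b).

Definition threshold w k := left_end w + \sum_(b : 'I_4 | (b < k)%N) m (rcons w b).

(** Half-open, so that the slots of words of one length are disjoint and cover the unit interval;
    the slot of a word of mass 0 is empty. *)
Definition slot w : set R := [set u | left_end w <= u < left_end w + m w].

Lemma left_end_rcons w a : left_end (rcons w a) = threshold w a.
Proof.
rewrite /left_end /threshold size_rcons big_ord_recr /=; congr (_ + _).
  apply: eq_bigr => i _; rewrite nth_rcons ltn_ord; apply: eq_bigr => b _.
  by rewrite -[rcons w a]cats1 takel_cat// ltnW.
by rewrite nth_rcons ltnn eqxx -[rcons w a]cats1 take_size_cat.
Qed.

Lemma thresholdS w (a : 'I_4) : threshold w a.+1 = left_end (rcons w a) + m (rcons w a).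
Proof.
rewrite left_end_rcons /threshold -addrA; congr (_ + _).
rewrite (bigD1 a)//= addrC; congr (_ + _); apply: eq_bigl => b.
by rewrite ltnS [in RHS]ltn_neqAle andbC.
Qed.

Lemma le_threshold w j k : (j <= k)%N -> threshold w j <= threshold w k.
Proof.
move=> jk; rewrite /threshold lerD2l [leLHS]big_mkcond [leRHS]big_mkcond /=.
apply: ler_sum => b _; case: ifP => [bj|_]; first by rewrite (leq_trans bj jk).
by case: ifP.
Qed.

Lemma threshold0 w : threshold w 0 = left_end w.
Proof. by rewrite /threshold big_pred0// addr0. Qed.

Lemma threshold4 w : threshold w 4 = left_end w + m w.
Proof. by rewrite /threshold [m w]m_rcons; congr (_ + _); apply: eq_bigl => b; rewrite ltn_ord. Qed.

Lemma slot_rconsE w a u :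
  slot (rcons w a) u <-> threshold w a <= u < threshold w a.+1.
Proof. by rewrite /slot /= thresholdS left_end_rcons. Qed.

Lemma slot_rcons w a : slot (rcons w a) `<=` slot w.
Proof.
move=> u /slot_rconsE /andP[au ua]; apply/andP; split.
  by rewrite -threshold0; apply: le_trans au; exact: le_threshold.
by rewrite -threshold4; apply: lt_le_trans ua _; apply: le_threshold; exact: ltn_ord.
Qed.

Lemma slot_rcons_inj w a a' u :
  slot (rcons w a) u -> slot (rcons w a') u -> a = a'.
Proof.
move=> /slot_rconsE /andP[au ua] /slot_rconsE /andP[a'u ua'].
apply/val_inj => /=; have [aa'|aa'|//] := ltngtP (val a) (val a').
  by have := lt_le_trans ua (le_trans (le_threshold w aa') a'u); rewrite ltxx.
by have := lt_le_trans ua' (le_trans (le_threshold w aa') au); rewrite ltxx.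
Qed.

Lemma slot_split w u : slot w u -> exists a, slot (rcons w a) u.
Proof.
move=> /andP[wu uw].
have ex : exists k, u < threshold w k by exists 4%N; rewrite threshold4.
case: (ex_minnP ex) => k uk kmin.
have k0 : (0 < k)%N.
  by rewrite lt0n; apply/eqP => k0; move: uk; rewrite k0 threshold0 ltNge wu.
have k4 : (k.-1 < 4)%N by rewrite prednK//; apply: kmin; rewrite threshold4.
exists (Ordinal k4); apply/slot_rconsE; rewrite /= prednK// uk andbT leNgt.
by apply/negP => /kmin; case: (k) k0 => // j _; rewrite ltnn.
Qed.

Fixpoint code (u : R) (n : nat) : seq 'I_4 :=
  if n is n'.+1 then let w := code u n' in
    rcons w (odflt ord0 [pick a | `[< slot (rcons w a) u >]])
  else [::].

Lemma size_code u n : size (code u n) = n.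
Proof. by elim: n => //= n IH; rewrite size_rcons IH. Qed.

Lemma slot_code u n : 0 <= u < 1 -> slot (code u n) u.
Proof.
move=> u01; elim: n => [|n IH] /=.
  by rewrite /slot /left_end /= big_ord0 m_nil add0r.
case: pickP => [a /asboolP//|na].
by have [a /asboolP] := slot_split IH; rewrite na.
Qed.

Lemma code_slot u w : slot w u -> code u (size w) = w.
Proof.
elim/last_ind: w => [//|w a IH] wau; rewrite size_rcons /= (IH (slot_rcons wau)).
case: pickP => [b /asboolP /slot_rcons_inj /(_ wau) -> //|/(_ a)].
by move/asboolPn; case.
Qed.

(** Points outside the half-open unit interval are null for [unit_lebesgue]; they are coded like 0
    to keep the map total. *)
Definition decode (u : R) : fullshift :=
  fun n => nth ord0 (code (if 0 <= u < 1 then u else 0) n.+1) n.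

Lemma word_decode u n : word (decode u) n = code (if 0 <= u < 1 then u else 0) n.
Proof.
elim: n => [//|n IH]; rewrite word_rcons IH /decode /=; congr rcons.
by rewrite nth_rcons size_code ltnn eqxx.
Qed.

Lemma measurable_slot w : measurable (slot w).
Proof.
have -> : slot w = `[left_end w, left_end w + m w[%classic.
  by apply/seteqP; split=> u; rewrite /slot /= in_itv.
exact: measurable_itv.
Qed.

Lemma slot_sub w : slot w `<=` `[0, 1[%classic.
Proof.
elim/last_ind: w => [|w a IH]; last exact: subset_trans (@slot_rcons w a) IH.
by move=> u; rewrite /slot /left_end /= big_ord0 m_nil add0r in_itv.
Qed.

Lemma decode_cyl w : decode @^-1` cyl w `&` `[0, 1[ = slot w.
Proof.
apply/seteqP; split=> u /=.
  rewrite /cyl /= word_decode in_itv /= => -[+ u01]; rewrite u01 => <-.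
  exact: slot_code.
move=> wu; have /= := slot_sub wu; rewrite in_itv /= => u01; split=> //.
by rewrite /cyl /= word_decode u01; exact: code_slot.
Qed.

Lemma measurable_decode : measurable_fun setT decode.
Proof.
apply: (@measurability _ _ _ _ _ _ word_sets); first exact: measurable_gen_word.
move=> _ [_ [n [Q ->]] <-]; rewrite setTI.
have -> : decode @^-1` [set x | Q (word x n)] =
    \big[setU/set0]_(w : n.-tuple 'I_4 | `[< Q w >]) (decode @^-1` cyl w).
  rewrite -bigcup_seq_cond; apply/seteqP; split=> u.
    move=> Qu; exists (word_tuple (decode u) n) => /=; last by rewrite /cyl /= size_word.
    by rewrite mem_index_enum; apply/asboolP.
  by move=> [w /= /andP[_ /asboolP]]; rewrite /cyl /= size_tuple => + ->.
apply: bigsetU_measurable => w _.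
have -> : decode @^-1` cyl w = (slot w `&` `[0, 1[) `|`
    (~` `[0, 1[ `&` [set u | code 0 (size w) = w]).
  apply/seteqP; split=> u; rewrite /cyl /= word_decode in_itv /=.
    case: ifP => u01 e; last by right.
    by left; split=> //; rewrite -e; exact: slot_code.
  by case=> [[/code_slot + ->//]|[/negP/negPf ->]].
apply: measurableU; apply: measurableI => //; first exact: measurable_slot.
  by apply: measurableC; exact: measurable_itv.
have [e|ne] := pselect (code 0 (size w) = w).
  have -> : [set _ | code 0 (size w) = w] = [set: R] by apply/seteqP; split=> u.
  exact: measurableT.
by have -> : [set _ | code 0 (size w) = w] = @set0 R by apply/seteqP; split=> u //=.
Qed.

Lemma cylinder_extension : exists mu : probability fullshift R,
  forall w, pr mu w = m w.
Proof.
pose X : {mfun measurableTypeR R >-> fullshift} := MeasurableFun.Pack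
  (MeasurableFun.Class (isMeasurableFun.Build _ _ (measurableTypeR R) _ _ measurable_decode)).
exists (distribution (@unit_lebesgue R) X) => w.
rewrite /pr.
transitivity (fine (@lebesgue_measure R (slot w))).
  by congr fine; rewrite -decode_cyl.
have -> : slot w = `[left_end w, left_end w + m w[%classic.
  by apply/seteqP; split=> u; rewrite /slot /= in_itv.
rewrite lebesgue_measure_itv /= lte_fin; case: ltP => [_|].
  by rewrite -EFinB /= addrAC subrr add0r.
by rewrite gerDl => mw; apply/esym/le_anti; rewrite mw m_ge0.
Qed.

End cylinder_extension.

(** * The renewal equation and its tails *)

Section renewal.
Variables (R : realType) (E : nat -> R) (e0 : R).
Hypothesis e0_gt0 : 0 < e0.
Hypothesis E_ge : forall k, e0 <= E k.
Hypothesis E_le1 : forall k, E k <= 1.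
Hypothesis E_dec : forall k, E k.+1 <= E k.

Definition renewal_sum (y : R) n := \sum_(1 <= k < n) y ^+ k * E k.

Let E_gt0 k : 0 < E k. Proof. exact: lt_le_trans e0_gt0 (E_ge k). Qed.

Lemma renewal_sumS y n : (0 < n)%N ->
  renewal_sum y n.+1 = renewal_sum y n + y ^+ n * E n.
Proof. by move=> n0; rewrite /renewal_sum big_nat_recr. Qed.

Lemma sum_expr (y : R) n : y < 1 ->
  \sum_(0 <= k < n) y ^+ k = (1 - y ^+ n) / (1 - y).
Proof.
move=> y1; have y10 : 1 - y != 0 by rewrite subr_eq0 gt_eqF.
elim: n => [|n IH]; first by rewrite big_geq// expr0 subrr mul0r.
rewrite big_nat_recr//= IH; apply: (mulIf y10).
rewrite mulrDl !divfK// exprS; ring.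
Qed.

Lemma sum_expr_le (y : R) n : 0 <= y -> y < 1 ->
  \sum_(0 <= k < n) y ^+ k <= (1 - y)^-1.
Proof.
move=> y0 y1; have y10 : 0 < 1 - y by rewrite subr_gt0.
by rewrite sum_expr// ler_pdivrMr// mulVf ?gt_eqF// gerBl exprn_ge0.
Qed.

Lemma sum_expr_diff (y z : R) n : 0 <= y -> y <= z -> z < 1 ->
  \sum_(0 <= k < n) (z ^+ k - y ^+ k) <= (z - y) / ((1 - y) * (1 - z)).
Proof.
move=> y0 yz z1; have y1 : y < 1 by exact: le_lt_trans z1.
have z10 : 0 < 1 - z by rewrite subr_gt0.
have y10 : 0 < 1 - y by rewrite subr_gt0.
rewrite sumrB !sum_expr//.
have -> : (1 - z ^+ n) / (1 - z) - (1 - y ^+ n) / (1 - y) =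
    (z - y - (z ^+ n * (1 - y) - y ^+ n * (1 - z))) / ((1 - y) * (1 - z)).
  by field; rewrite !gt_eqF.
rewrite ler_pM2r ?invr_gt0 ?mulr_gt0// gerBl subr_ge0.
have z0 := le_trans y0 yz.
by apply: ler_pM; rewrite ?exprn_ge0 ?lerXn2r ?nnegrE ?subr_ge0 ?(ltW z1)// lerD2l lerN2.
Qed.

(** The root is the supremum of the y >= 0 whose partial sums are all at most 1. The value 1/2
    qualifies because E <= 1, and E >= e0 excludes y >= 1. Continuity of each partial sum keeps the
    bound at the supremum; if the sums at [z] stayed below 1 - e, a slightly larger y would still
    qualify. *)
Lemma renewal_root : exists z : R, [/\ 0 < z, z < 1,
  forall n, renewal_sum z n <= 1 & renewal_sum z n @[n --> \oo] --> (1 : R)].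
Proof.
pose A : set R := [set y | 0 <= y /\ forall n, renewal_sum y n <= 1].
have A2 : A 2^-1.
  split; first by rewrite invr_ge0.
  move=> n; case: n => [|n]; first by rewrite /renewal_sum big_geq.
  apply: (@le_trans _ _ (\sum_(1 <= k < n.+1) 2^-1 ^+ k)).
    by apply: ler_sum => k _; rewrite ler_piMr// exprn_ge0// invr_ge0.
  have : \sum_(0 <= k < n.+1) (2^-1 : R) ^+ k <= (1 - 2^-1)^-1.
    by apply: sum_expr_le; rewrite ?invr_ge0// invf_lt1// ltr1n.
  have -> : (1 - 2^-1)^-1 = 2 :> R by rewrite (_ : 1 - 2^-1 = 2^-1) ?invrK//; lra.
  rewrite big_nat_recl// expr0 [X in _ -> X <= _]big_add1 /=; lra.
have Aub y : A y -> y < 1.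
  move=> [y0 Ay]; rewrite ltNge; apply/negP => y1.
  have [N HN] : exists N : nat, 1 < N%:R * e0.
    exists (Num.truncn e0^-1).+1.
    by rewrite -ltr_pdivrMr// div1r truncnS_gt.
  have := Ay N.+1; rewrite leNgt => /negP; apply.
  apply: lt_le_trans HN _; rewrite /renewal_sum big_add1 /=.
  apply: (@le_trans _ _ (\sum_(0 <= i < N) e0)).
    by rewrite sumr_const_nat subn0 mulr_natl.
  by apply: ler_sum => k _; rewrite -[leLHS]mul1r; apply: ler_pM => //; [exact: ltW|exact: exprn_ege1].
have supA : has_sup A.
  by split; [exists 2^-1 | exists 1 => y /Aub /ltW].
pose z := sup A.
have zA y : A y -> y <= z by move=> Ay; exact: sup_upper_bound.
have z0 : 0 < z by apply: lt_le_trans (zA _ A2); rewrite invr_gt0.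
have z1 n : renewal_sum z n <= 1.
  rewrite leNgt; apply/negP => zn.
  have cF : continuous (fun y => renewal_sum y n).
    elim: n {zn} => [|[|n] IH] y.
    - rewrite (_ : (fun y => _) = cst 0); first exact: cvg_cst.
      by apply/funext => x; rewrite /renewal_sum big_geq.
    - rewrite (_ : (fun y => _) = cst 0); first exact: cvg_cst.
      by apply/funext => x; rewrite /renewal_sum big_geq.
    - rewrite (_ : (fun y => _) = fun y => renewal_sum y n.+1 + y ^+ n.+1 * E n.+1); last first.
        by apply/funext => x; rewrite renewal_sumS.
      apply: cvgD; first exact: IH.
      apply: cvgM; last exact: cvg_cst.
      exact: exprn_continuous.
  have /cF : nbhs (renewal_sum z n) [set v | 1 < v] by exact: lt_nbhsr.
  move=> /nbhs_ballP[e /= e0' He].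
  have [y Ay zy] : exists2 y, A y & z - e < y.
    by apply: sup_adherent.
  have := He y; rewrite /ball /= ger0_norm ?subr_ge0 ?zA// ltrBlDr => /(_ _).
  rewrite addrC -ltrBlDr => /(_ zy); rewrite ltNge; have [_ ->//] := Ay.
have Az : A z by split=> //; exact: ltW.
have zlt1 : z < 1 by exact: Aub.
exists z; split=> //.
have z10 : 0 < 1 - z by rewrite subr_gt0.
have mono m n : (m <= n)%N -> renewal_sum z m <= renewal_sum z n.
  move=> mn; elim: n mn => [|n IH]; first by rewrite leqn0 => /eqP ->.
  rewrite leq_eqVlt => /predU1P[->//|mn]; apply: le_trans (IH mn) _.
  case: n {IH mn} => [|n]; first by rewrite /renewal_sum !big_geq.
  by rewrite (renewal_sumS _ (ltn0Sn n)) lerDl mulr_ge0 ?exprn_ge0// ltW.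
apply/cvgrPdist_le => e ep.
have [n Hn] : exists n, 1 - e < renewal_sum z n.
  apply: contrapT => /forallNP H.
  (* Passing from [z] to [y] adds at most d / ((1 - d) (1 - z)) to any partial sum. With d <= 1/2
     this is at most 2 d / (1 - z), hence at most e. *)
  pose d := Num.min 2^-1 (e * (1 - z) / 2).
  have d0 : 0 < d by rewrite lt_min invr_gt0 ltr0n divr_gt0// mulr_gt0.
  have d1 : d <= 2^-1 by rewrite ge_min lexx.
  have d2 : d <= e * (1 - z) / 2 by rewrite ge_min lexx orbT.
  pose y := z + d * (1 - z).
  have zy : z < y by rewrite ltrDl mulr_gt0.
  have y1E : 1 - y = (1 - d) * (1 - z) by rewrite /y; ring.
  have y1 : y < 1 by rewrite -subr_gt0 y1E mulr_gt0//; lra.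
  suff Ay : A y by have := zA _ Ay; rewrite leNgt zy.
  split; first exact: le_trans (ltW z0) (ltW zy).
  move=> n; have := H n => /negP; rewrite -leNgt => Hn.
  rewrite -(subrK (renewal_sum z n) (renewal_sum y n)).
  suff : renewal_sum y n - renewal_sum z n <= e by move: Hn; lra.
  apply: (@le_trans _ _ (\sum_(0 <= k < n) (y ^+ k - z ^+ k))).
    rewrite /renewal_sum -sumrB.
    case: n {H Hn} => [|n]; first by rewrite !big_geq.
    rewrite [leRHS]big_nat_recl// subrr add0r big_add1 /=.
    apply: ler_sum => k _; rewrite -mulrBl ler_piMr// subr_ge0.
    by rewrite lerXn2r ?nnegrE ?ltW// (lt_trans z0).
  apply: le_trans (sum_expr_diff n (ltW z0) (ltW zy) y1) _.
  rewrite ler_pdivrMr ?mulr_gt0// ?subr_gt0// y1E.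
  rewrite {1}/y addrAC subrr add0r.
  have h : d <= e * ((1 - z) * (1 - d)).
    apply: le_trans d2 _; rewrite -!mulrA ler_pM2l// ler_pM2l//; lra.
  by rewrite [X in _ <= X](_ : _ = e * ((1 - z) * (1 - d)) * (1 - z)) ?ler_pM2r//; ring.
exists n => // m /= nm.
have := mono _ _ nm; have := z1 m; move=> m1 nm1; rewrite ger0_norm ?subr_ge0//; lra.
Qed.

Section tail_bound.
Variables (z : R) (a b : nat -> R) (B : R).
Hypotheses (z_gt0 : 0 < z) (z_lt1 : z < 1) (B_ge0 : 0 <= B).

(** Telescoping against a geometric bound; applied to the tail of the series and then to the tail of
    these tails. *)
Lemma tail_bound n : (forall k, (n <= k)%N -> a k = b k + a k.+1) ->
  (forall j, b (n + j)%N <= B * z ^+ j) -> a k @[k --> \oo] --> (0 : R) ->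
  a n <= B / (1 - z).
Proof.
move=> aS bB a0.
have H J : a n - a (n + J)%N <= B / (1 - z).
  have -> : a n - a (n + J)%N = \sum_(0 <= j < J) b (n + j)%N.
    elim: J => [|J IH]; first by rewrite addn0 subrr big_geq.
    rewrite big_nat_recr//= -IH addnS.
    have -> : a (n + J)%N = b (n + J)%N + a (n + J).+1 by apply: aS; exact: leq_addr.
    by ring.
  apply: (@le_trans _ _ (\sum_(0 <= j < J) B * z ^+ j)).
    by apply: ler_sum => j _; exact: bB.
  by rewrite -mulr_sumr ler_wpM2l// sum_expr_le// ltW.
have aJ : a n - a (J + n)%N @[J --> \oo] --> a n - 0.
  apply: cvgB; first exact: cvg_cst.
  by rewrite (cvg_shiftn n a).
rewrite subr0 in aJ.
have <- : limn (fun J => a n - a (J + n)%N) = a n by exact/cvg_lim.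
apply: limr_le; first by apply/cvg_ex; exists (a n).
by apply: nearW => J; rewrite addnC.
Qed.

End tail_bound.

(** Since [E] does not increase, the term of index n + j is at most z^j times the term of index n.
    Hence both tails are comparable with their leading term, with constants that depend on [z]
    alone. *)
Lemma renewal_tails : exists (z : R) (T U : nat -> R), [/\ 0 < z < 1, T 1%N = 1,
  (forall n, (0 < n)%N -> T n = z ^+ n * E n + T n.+1),
  (forall n, (0 < n)%N -> U n = T n + U n.+1) &
  (forall n, (0 < n)%N -> z ^+ n * E n <= T n <= z ^+ n * E n / (1 - z) /\
     T n <= U n <= z ^+ n * E n / (1 - z) ^+ 2)].
Proof.
have [z [z0 z1 S1 Scvg]] := renewal_root.
have z10 : 0 < 1 - z by rewrite subr_gt0.
pose p n := z ^+ n * E n; pose T n := 1 - renewal_sum z n.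
have p0 n : 0 < p n by rewrite mulr_gt0 ?exprn_gt0.
have T0 n : 0 <= T n by rewrite subr_ge0.
have TS n : (0 < n)%N -> T n = p n + T n.+1.
  by move=> n0; rewrite /T renewal_sumS// /p; ring.
have Tcvg : T n @[n --> \oo] --> (0 : R).
  rewrite -(subrr 1); apply: cvgB Scvg; exact: cvg_cst.
have pj n j : p (n + j)%N <= p n * z ^+ j.
  elim: j => [|j IH]; first by rewrite addn0 expr0 mulr1.
  rewrite addnS exprSr mulrA; apply: le_trans (ler_wpM2r (ltW z0) IH).
  by rewrite /p exprSr -!mulrA ler_pM2l ?exprn_gt0// mulrC ler_pM2r.
have Tle n : (0 < n)%N -> T n <= p n / (1 - z).
  move=> n0; apply: (@tail_bound z T p) => //; first exact/ltW.
  by move=> k nk; apply: TS; exact: leq_trans nk.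
have Tj n j : (0 < n)%N -> T (n + j)%N <= p n / (1 - z) * z ^+ j.
  move=> n0; apply: le_trans (Tle _ _) _; first by rewrite addn_gt0 n0.
  by rewrite [leRHS]mulrAC ler_pM2r ?invr_gt0.
pose TT n := \sum_(0 <= k < n) T k.+1.
have TTc : cvgn TT.
  apply: nondecreasing_is_cvgn.
    by apply/nondecreasing_seqP => n; rewrite /TT big_nat_recr//= lerDl.
  exists (p 1%N / (1 - z) / (1 - z)) => _ [n _ <-].
  apply: (@le_trans _ _ (\sum_(0 <= k < n) p 1%N / (1 - z) * z ^+ k)).
    by apply: ler_sum => k _; rewrite -add1n Tj.
  rewrite -mulr_sumr ler_wpM2l ?sum_expr_le ?(ltW z0)//.
  by rewrite divr_ge0// ltW.
(* [TT] starts with [T 1], so subtracting [TT n.-1] leaves the sum of the [T k] with k >= n. *)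
pose U n := limn TT - TT n.-1.
have US n : (0 < n)%N -> U n = T n + U n.+1.
  by case: n => // n _; rewrite /U /TT /= big_nat_recr//=; ring.
have Ucvg : U n @[n --> \oo] --> (0 : R).
  have h : limn TT - TT n @[n --> \oo] --> limn TT - limn TT.
    by apply: cvgB; [exact: cvg_cst|exact: TTc].
  by rewrite subrr in h; rewrite -cvg_shiftS; exact: h.
have U0 n : (0 < n)%N -> 0 <= U n.
  move=> n0; rewrite /U subr_ge0; apply: nondecreasing_cvgn_le => //.
  by apply/nondecreasing_seqP => k; rewrite /TT big_nat_recr//= lerDl.
have Ule n : (0 < n)%N -> U n <= p n / (1 - z) ^+ 2.
  move=> n0; rewrite expr2 invfM mulrA.
  apply: (@tail_bound z U T) => //.
  - by rewrite divr_ge0// ltW.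
  - by move=> k nk; apply: US; exact: leq_trans nk.
  - by move=> j; exact: Tj.
exists z, T, U; split=> //; first by rewrite z0.
  by rewrite /T /renewal_sum big_geq// subr0.
move=> n n0; split; apply/andP; split; rewrite ?Tle ?Ule//.
  by rewrite TS// lerDl.
by rewrite US// lerDl U0.
Qed.

End renewal.

(** * Classes of letters and runs of words *)

Definition cls (a : 'I_4) : bool := (2 <= a)%N.

Lemma S_cls i (a : 'I_4) : S_ i a <-> cls a = i.
Proof. by case: a => -[|[|[|[|//]]]] ?; case: i. Qed.

(** Most sums over a letter put before or after a word depend on its class only: two letters
    continue the class [i] and two break it. *)
Lemma sum_cls (R : pzRingType) i (F : bool -> R) :
  \sum_(b : 'I_4) F (cls b) = F i *+ 2 + F (~~ i) *+ 2.
Proof.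
rewrite !big_ord_recl big_ord0 /cls /= addr0 addrA !mulr2n.
by case: i => //=; rewrite addrC.
Qed.

(** A word within one class has its full length as run, although a point extending it may have a
    longer one. The resulting error in the first coordinate is at most [cbar] of the length. *)
Fixpoint run (w : seq 'I_4) : nat :=
  if w is b :: w' then
    if w' is b' :: _ then if cls b == cls b' then (run w').+1 else 1 else 1
  else 0.

Lemma run_cons b w : w != [::] ->
  run (b :: w) = if cls b == cls (head ord0 w) then (run w).+1 else 1%N.
Proof. by case: w. Qed.

Lemma run_gt0 w : w != [::] -> (0 < run w)%N.
Proof. by case: w => //= b [|b' w] //; case: ifP. Qed.

Lemma run_size w : (run w <= size w)%N.
Proof. by elim: w => //= b [|b' w] // IH; case: ifP. Qed.

Lemma run_wordSS (x : fullshift) k : run (word x k.+2) =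
  if cls (x 0%N) == cls (x 1%N) then (run (word (left_shift x) k.+1)).+1 else 1%N.
Proof. by rewrite [word x _]wordS [word (left_shift x) _]wordS. Qed.

Lemma run_word (x : fullshift) r k : (k <= r)%N ->
  (forall j, (j < r)%N -> cls (x j) = cls (x 0%N)) -> run (word x k) = k.
Proof.
elim: k x r => // -[//|k] IH x r kr xr.
rewrite run_wordSS xr ?(leq_trans _ kr)// eqxx (IH _ r.-1) ?(ltn_predRL, leq_trans kr)//.
by move=> j; rewrite ltn_predRL => jr; rewrite /left_shift !xr//; exact: leq_trans kr.
Qed.

Lemma run_word_min (x : fullshift) r k : (0 < r)%N ->
  (forall j, (j < r)%N -> cls (x j) = cls (x 0%N)) -> cls (x r) != cls (x 0%N) ->
  run (word x k) = minn r k.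
Proof.
move=> r0 xr xr'; case: (leqP k r) => [kr|]; first exact: run_word kr xr.
elim: r x k r0 xr xr' => // r IH x k _ xr xr'; case: k => // -[//|k] rk.
rewrite run_wordSS; case: r IH xr xr' rk => [|r] IH xr xr' rk.
  by rewrite eq_sym (negPf xr').
rewrite xr// eqxx IH// => [j jr|].
  by rewrite /left_shift !xr.
by rewrite /left_shift (xr 1%N).
Qed.

(** * The potential as a function of class and run *)

Section potential_values.
Variable R : realType.

(** A point of run k leaves its [Y] at index k + 1, and k + 1 - lambda = k - 2; runs below 3 are
    those of [Y0]. *)
Definition cbar (k : nat) : R :=
  if (k < 3)%N then expR (- 2) else expR (7 - 10 * (k - 2)%:R).

Definition dbar (k : nat) : R := if (k < 3)%N then 0 else invlog (cbar k).

Lemma Phi_graph (x : fullshift) v :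
  potential_graph (expR (- 2)) 3 (fun _ k => expR (7 - 10 * k%:R))
    (fun i t => if i then - invlog t else invlog t) x v -> @Phi R x = v.
Proof. by move=> H; exact: (@potential_graph_fun R _ 3 _ _ x _ v isT (potentialP _ _ _ _ _) H). Qed.

Lemma Phi_run (x : fullshift) r : (0 < r)%N ->
  (forall j, (j < r)%N -> cls (x j) = cls (x 0%N)) -> cls (x r) != cls (x 0%N) ->
  @Phi R x = (cbar r, if cls (x 0%N) then - dbar r else dbar r).
Proof.
move=> r0 xr xr'; apply: Phi_graph; rewrite /dbar /cbar.
case: ltnP => r3.
  rewrite oppr0 if_same; constructor 1; split=> //.
  rewrite /Y0; case=> H; move: (H 0%N isT) (H r r3) => /S_cls e /S_cls e'.
    by move: xr'; rewrite e e'.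
  by move: xr'; rewrite e e'.
constructor 2; exists (cls (x 0%N)), r.+1; split=> //.
  split=> /=; first by move=> j jr; apply/S_cls; exact: xr.
  by move=> H; have /S_cls e := H r (ltnSn r); rewrite e eqxx in xr'.
Qed.

Lemma Phi_norun (x : fullshift) : (forall j, cls (x j) = cls (x 0%N)) ->
  @Phi R x = (0, 0).
Proof.
move=> xr; have -> : (0, 0) = (0, if cls (x 0%N) then - invlog 0 else invlog 0) :> R * R.
  by rewrite /invlog ltxx oppr0 if_same.
apply: Phi_graph; constructor 3; exists (cls (x 0%N)); split=> // j.
exact/S_cls.
Qed.

Lemma runP (x : fullshift) : (forall j, cls (x j) = cls (x 0%N)) \/
  exists r, [/\ (0 < r)%N, (forall j, (j < r)%N -> cls (x j) = cls (x 0%N))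
    & cls (x r) != cls (x 0%N)].
Proof.
have [|nx] := pselect (forall j, cls (x j) = cls (x 0%N)); first by left.
right; have ex : exists r, cls (x r) != cls (x 0%N).
  by move/existsNP : nx => [r /eqP nr]; exists r.
case: (ex_minnP ex) => r nr rmin; exists r; split=> //.
  by rewrite lt0n; apply/eqP => r0; move: nr; rewrite r0 eqxx.
by move=> j jr; apply: contrapT => /eqP /rmin; rewrite leqNgt jr.
Qed.

Lemma cbar_gt0 k : 0 < cbar k.
Proof. by rewrite /cbar; case: ifP => _; exact: expR_gt0. Qed.

Lemma cbarS k : cbar k.+1 <= cbar k.
Proof.
rewrite /cbar; case: (ltnP k.+1 3) => k3; first by rewrite (ltnW k3).
case: (ltnP k 3) => k3'.
  have -> : k = 2%N by apply/eqP; rewrite eqn_leq -ltnS k3' -ltnS k3.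
  by rewrite ler_expR (_ : (3 - 2)%N = 1%N)//; lra.
by rewrite ler_expR subSn// -natr1; lra.
Qed.

Lemma le_cbar j k : (j <= k)%N -> cbar k <= cbar j.
Proof.
move=> jk; rewrite -(subnKC jk); elim: (k - j)%N => [|n IH]; first by rewrite addn0.
by rewrite addnS; apply: le_trans (cbarS _) IH.
Qed.

(** An equality for k >= 3, as 7 - 10 (k - 2) = 27 - 10 k. It makes [cbar] summable, which bounds
    the renewal coefficients away from 0. *)
Lemma cbar_geometric k : cbar k <= expR 27 * expR (- 10) ^+ k.
Proof.
rewrite -expRM_natl -expRD /cbar; case: ltnP => k3; rewrite ler_expR.
  have : k%:R <= 2 :> R by rewrite ler_nat.
  lra.
rewrite natrB; last exact: ltnW.
lra.
Qed.

Lemma expRN10_lt1 : expR (- 10) < 1 :> R.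
Proof. by rewrite -[ltRHS]expR0 ltr_expR; lra. Qed.

Lemma cvg_cbar : cbar k @[k --> \oo] --> (0 : R).
Proof.
have h : expR 27 * expR (- 10) ^+ k @[k --> \oo] --> (0 : R).
  rewrite -(mulr0 (expR 27)); apply: cvgM; first exact: cvg_cst.
  by apply: cvg_expr; rewrite ger0_norm ?expR_ge0// expRN10_lt1.
apply: (@squeeze_cvgr _ _ _ _ (fun=> 0) _ _ _ _ (cvg_cst _) h).
by apply: nearW => k; rewrite ltW ?cbar_gt0//= cbar_geometric.
Qed.

Definition Cbar (k : nat) : R := \sum_(1 <= i < k.+1) cbar i.

Lemma Cbar0 : Cbar 0 = 0. Proof. by rewrite /Cbar big_geq. Qed.

Lemma CbarS k : Cbar k.+1 = Cbar k + cbar k.+1.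
Proof. by rewrite /Cbar big_nat_recr. Qed.

Lemma Cbar_ge0 k : 0 <= Cbar k.
Proof. by apply: sumr_ge0 => i _; exact/ltW/cbar_gt0. Qed.

Definition Cmax : R := expR 27 / (1 - expR (- 10)).

Lemma Cbar_le k : Cbar k <= Cmax.
Proof.
apply: (@le_trans _ _ (\sum_(0 <= i < k.+1) cbar i)).
  by rewrite [leRHS]big_nat_recl// /Cbar big_add1 /= lerDr ltW// cbar_gt0.
apply: (@le_trans _ _ (\sum_(0 <= i < k.+1) expR 27 * expR (- 10) ^+ i)).
  by apply: ler_sum => i _; exact: cbar_geometric.
rewrite -mulr_sumr ler_pM2l ?expR_gt0//.
apply: sum_expr_le; [exact: expR_ge0|exact: expRN10_lt1].
Qed.

Definition phi (x : fullshift) : R := (@Phi R x).1.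

Lemma phi_approx (x : fullshift) k :
  0 <= cbar (run (word x k)) - phi x <= cbar k.
Proof.
rewrite /phi; case: (runP x) => [xr|[r [r0 xr xr']]].
  rewrite Phi_norun// (@run_word x k k)//= subr0 lexx ltW ?cbar_gt0//.
rewrite (Phi_run r0 xr xr') /= (run_word_min _ r0 xr xr').
rewrite subr_ge0 le_cbar ?geq_minl//=.
case: (leqP r k) => _; first by rewrite subrr ltW// cbar_gt0.
by rewrite gerBl ltW// cbar_gt0.
Qed.

Lemma phi_ge0 x : 0 <= phi x.
Proof.
rewrite /phi; case: (runP x) => [xr|[r [r0 xr xr']]]; first by rewrite Phi_norun.
by rewrite (Phi_run r0 xr xr') /= ltW// cbar_gt0.
Qed.

Lemma phi_le1 x : phi x <= 1.
Proof.
rewrite /phi; case: (runP x) => [xr|[r [r0 xr xr']]]; first by rewrite Phi_norun.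
rewrite (Phi_run r0 xr xr') /=; apply: le_trans (le_cbar (leq0n _)) _.
by rewrite /cbar /= -[leRHS]expR0 ler_expR; lra.
Qed.

Lemma phi_cvg x : cbar (run (word x k)) @[k --> \oo] --> phi x.
Proof.
have h : phi x + cbar k @[k --> \oo] --> phi x.
  by rewrite -[X in _ --> X]addr0; apply: cvgD; [exact: cvg_cst|exact: cvg_cbar].
apply: (@squeeze_cvgr _ _ _ _ (fun=> phi x) _ _ _ _ (cvg_cst _) h).
by apply: nearW => k; have /andP[] := phi_approx x k; lra.
Qed.

Lemma bounded_measurable_phi : bounded_measurable phi.
Proof.
split; last by exists 1 => x; rewrite ger0_norm ?phi_ge0 ?phi_le1.
apply: (measurable_fun_cvg (h := fun k x => cbar (run (word x k)))).
  by move=> k; exact: (bounded_measurable_word (fun w => cbar (run w)) k).1.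
by move=> x _; exact: phi_cvg.
Qed.

Lemma expect_phi_approx (mu : probability fullshift R) k :
  0 <= \int[mu]_x cbar (run (word x k)) - \int[mu]_x phi x <= cbar k.
Proof.
have b1 := bounded_measurable_word (fun w => cbar (run w)) k.
have b2 := bounded_measurable_phi.
rewrite -(expectN mu b2) -expectD//; last exact: bounded_measurableN.
have bb : bounded_measurable (fun x => cbar (run (word x k)) - phi x).
  by apply: bounded_measurableD => //; exact: bounded_measurableN.
apply/andP; split.
  by apply: Rintegral_ge0 => x _; have /andP[] := phi_approx x k.
rewrite -[leRHS](expect_cst mu); apply: le_expect => //.
  exact: bounded_measurable_cst.
by move=> x; have /andP[] := phi_approx x k.
Qed.

Lemma expect_phi_cvg (mu : probability fullshift R) :
  \int[mu]_x cbar (run (word x k)) @[k --> \oo] --> \int[mu]_x phi x.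
Proof.
have h : \int[mu]_x phi x + cbar k @[k --> \oo] --> \int[mu]_x phi x.
  by rewrite -[X in _ --> X]addr0; apply: cvgD; [exact: cvg_cst|exact: cvg_cbar].
apply: (@squeeze_cvgr _ _ _ _ (fun=> \int[mu]_x phi x) _ _ _ _ (cvg_cst _) h).
by apply: nearW => k; have /andP[] := expect_phi_approx mu k; lra.
Qed.

End potential_values.

(** * The Gibbs measure at a fixed parameter, and perturbations of its weight *)

Lemma run_rcons w a : w != [::] -> run (rcons w a) =
  if run w == size w then
    if cls a == cls (head ord0 w) then (size w).+1 else size w
  else run w.
Proof.
elim: w => // b [|b' w] IH _; first by rewrite /= eq_sym.
rewrite rcons_cons run_cons; last by rewrite -size_eq0 size_rcons.
rewrite IH// [run [:: b, b' & w]]run_cons//.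
have -> : head ord0 (rcons (b' :: w) a) = b' by [].
have -> : size [:: b, b' & w] = (size (b' :: w)).+1 by [].
have -> : head ord0 [:: b, b' & w] = b by [].
have -> : head ord0 (b' :: w) = b' by [].
case: (boolP (cls b == cls b')) => [/eqP ->|bb'].
  by rewrite eqSS; case: ifP => // _; case: ifP.
by [].
Qed.

Lemma run_cons_size b w : w != [::] -> (run (b :: w) == size (b :: w)) =
  (cls b == cls (head ord0 w)) && (run w == size w).
Proof.
move=> w0; rewrite run_cons//; case: ifP => _ //=.
by case: w w0.
Qed.

Section renewal_weights.
Variables (R : realType) (t : R).
Hypothesis t_ge0 : 0 <= t.

Definition decay (k : nat) : R := expR (- (t * cbar R k)).
Definition decay_prod (k : nat) : R := expR (- (t * Cbar R k)).

Lemma decay_gt0 k : 0 < decay k. Proof. exact: expR_gt0. Qed.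

Lemma decay_le1 k : decay k <= 1.
Proof. by rewrite -[leRHS]expR0 ler_expR oppr_le0 mulr_ge0// ltW// cbar_gt0. Qed.

Lemma decay_prod_gt0 k : 0 < decay_prod k. Proof. exact: expR_gt0. Qed.

Lemma decay_prodS k : decay_prod k.+1 = decay_prod k * decay k.+1.
Proof. by rewrite /decay_prod CbarS mulrDr opprD expRD. Qed.

Lemma decay_prod0 : decay_prod 0 = 1.
Proof. by rewrite /decay_prod Cbar0 mulr0 oppr0 expR0. Qed.

(* [T] is the tail of the renewal series \sum z^k decay_prod k, whose sum is [1],
   and [U] is the tail of [T]. *)
Definition renewal_data (z : R) (T U : nat -> R) := [/\ 0 < z < 1, T 1%N = 1,
  (forall n, (0 < n)%N -> T n = z ^+ n * decay_prod n + T n.+1),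
  (forall n, (0 < n)%N -> U n = T n + U n.+1) &
  (forall n, (0 < n)%N ->
     z ^+ n * decay_prod n <= T n <= z ^+ n * decay_prod n / (1 - z) /\
     T n <= U n <= z ^+ n * decay_prod n / (1 - z) ^+ 2)].

Lemma renewal_data_exists : exists z T U, renewal_data z T U.
Proof.
apply: (@renewal_tails R decay_prod (expR (- (t * Cmax R)))).
- exact: expR_gt0.
- by move=> k; rewrite ler_expR lerN2 ler_wpM2l// Cbar_le.
- by move=> k; rewrite -[leRHS]expR0 ler_expR oppr_le0 mulr_ge0// Cbar_ge0.
- by move=> k; rewrite decay_prodS ler_piMr ?decay_le1// ltW// decay_prod_gt0.
Qed.

Variables (z : R) (T U : nat -> R).
Hypothesis D : renewal_data z T U.

Let p n := z ^+ n * decay_prod n.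
(** Dividing by the leading term turns the recursions of the tails into equations along the run: [h]
    is the eigenfunction, and [v] enters its first-order response to a tilt between the classes. *)
Let h n := T n / p n.
Let v n := U n / p n.

Let z_gt0 : 0 < z. Proof. by case: D => /andP[]. Qed.
Let z_lt1 : z < 1. Proof. by case: D => /andP[]. Qed.
Let z1_gt0 : 0 < 1 - z. Proof. by rewrite subr_gt0 z_lt1. Qed.
Let p_gt0 n : 0 < p n.
Proof. by rewrite mulr_gt0 ?exprn_gt0 ?z_gt0 ?decay_prod_gt0. Qed.

Let pS n : p n.+1 = p n * (z * decay n.+1).
Proof. by rewrite /p exprSr decay_prodS; ring. Qed.

Let T1 : T 1%N = 1. Proof. by case: D. Qed.
Let TS n : (0 < n)%N -> T n = p n + T n.+1. Proof. by case: D => _ _ + _ _; apply. Qed.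
Let US n : (0 < n)%N -> U n = T n + U n.+1. Proof. by case: D => _ _ _ + _; apply. Qed.
Let pT n : (0 < n)%N -> p n <= T n <= p n / (1 - z).
Proof. by case: D => _ _ _ _ H /H []. Qed.
Let TU n : (0 < n)%N -> T n <= U n <= p n / (1 - z) ^+ 2.
Proof. by case: D => _ _ _ _ H /H []. Qed.

Let hS n : (0 < n)%N -> h n = 1 + z * decay n.+1 * h n.+1.
Proof.
move=> n0; rewrite /h TS// mulrDl divff ?gt_eqF// pS; congr (_ + _).
have h1 := p_gt0 n; have h2 := z_gt0; have h3 := decay_gt0 n.+1.
by field; rewrite !gt_eqF.
Qed.

Let vS n : (0 < n)%N -> v n = h n + z * decay n.+1 * v n.+1.
Proof.
move=> n0; rewrite /v /h US// mulrDl pS; congr (_ + _).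
have h1 := p_gt0 n; have h2 := z_gt0; have h3 := decay_gt0 n.+1.
by field; rewrite !gt_eqF.
Qed.

Let p1 : p 1%N = z * decay 1. Proof. by rewrite (pS 0) /p expr0 decay_prod0 !mul1r. Qed.

Let h1E : z * decay 1 * h 1%N = 1.
Proof. by rewrite /h T1 -p1 mulrC divfK// gt_eqF. Qed.

Let v1E : z * decay 1 * v 1%N = U 1%N.
Proof. by rewrite /v -p1 mulrC divfK// gt_eqF. Qed.

Let h_bounds n : (0 < n)%N -> 1 <= h n <= (1 - z)^-1.
Proof.
move=> n0; have /andP[h1 h2] := pT n0.
by rewrite /h ler_pdivlMr// mul1r h1 /= ler_pdivrMr// mulrC.
Qed.

Let v_bounds n : (0 < n)%N -> h n <= v n <= ((1 - z) ^+ 2)^-1.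
Proof.
move=> n0; have /andP[h1 h2] := TU n0.
by rewrite /v /h ler_pM2r ?invr_gt0// h1 /= ler_pdivrMr// mulrC.
Qed.

Let U1_ge1 : 1 <= U 1%N.
Proof. by have /andP[+ _] := TU (ltn0Sn 0); rewrite T1. Qed.

(* [h \o run] is an eigenfunction of the transfer operator of [- t phi]. *)
Lemma eigen_run w : w != [::] ->
  \sum_(b : 'I_4) z / 2 * decay (run (b :: w)) * h (run (b :: w)) = h (run w).
Proof.
move=> w0.
pose F i := if i == cls (head ord0 w) then
   z / 2 * decay (run w).+1 * h (run w).+1 else z / 2 * decay 1 * h 1%N.
rewrite (eq_bigr (fun b => F (cls b))); last first.
  by move=> b _; rewrite run_cons// /F; case: ifP.
rewrite (sum_cls (cls (head ord0 w))) /F eqxx.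
have -> : (~~ cls (head ord0 w) == cls (head ord0 w)) = false by case: cls.
rewrite [RHS](hS (run_gt0 w0)).
have -> : z / 2 * decay 1 * h 1%N = (z * decay 1 * h 1%N) / 2 by field.
by rewrite h1E; field.
Qed.

(** The tail of the tails from 1 on is the sum of the n p n, the mean of the renewal law; it
    normalises the Gibbs measure. *)
Let m := U 1%N.
Let m_gt0 : 0 < m. Proof. exact: lt_le_trans U1_ge1. Qed.

(* Cylinder masses of the eigenmeasure of the dual transfer operator; the Gibbs
   measure below is its product with the eigenfunction. *)
Fixpoint conformal (w : seq 'I_4) : R :=
  if w is _ :: w' then
    if run w == size w then 2^-1 ^+ size w * T (size w) / 2
    else z / 2 * decay (run w) * conformal w'
  else 1.

Lemma conformal_const w : w != [::] -> run w == size w ->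
  conformal w = 2^-1 ^+ size w * T (size w) / 2.
Proof. by case: w => // b w _ /= ->. Qed.

Lemma conformal_cons b w : run (b :: w) != size (b :: w) ->
  conformal (b :: w) = z / 2 * decay (run (b :: w)) * conformal w.
Proof. by move=> H; rewrite [LHS]/= -[(if w is _ :: _ then _ else _)]/(run (b :: w)) -[(size w).+1]/(size (b :: w)) (negPf H). Qed.

(** A change of class right after [w] fixes the run to [size w], so the single term [p] replaces the
    tail [T]. *)
Lemma conformal_break w a : w != [::] -> run w == size w ->
  cls a != cls (head ord0 w) ->
  conformal (rcons w a) = 2^-1 ^+ size w * p (size w) / 4.
Proof.
elim: w => // b [|b' w] IH _ wc ab.
  have ab' : (cls b == cls a) = false by move: ab => /=; rewrite eq_sym => /negPf.
  by rewrite rcons_cons conformal_cons /= ab'// T1 p1; field.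
have w0 : b' :: w != [::] by [].
move: wc; rewrite run_cons_size// => /andP[bb' wc].
have r : run (rcons [:: b, b' & w] a) = size [:: b, b' & w].
  by rewrite run_rcons// run_cons_size// bb' wc (negPf ab).
rewrite rcons_cons in r *.
rewrite conformal_cons; last by rewrite r /= size_rcons /= eqn_leq ltnn andbF.
rewrite r IH//; last by rewrite /= -(eqP bb').
by rewrite -[size [:: b, b' & w]]/(size (b' :: w)).+1 pS exprS; field.
Qed.

Lemma conformal_rcons w : w != [::] ->
  conformal w = \sum_(a : 'I_4) conformal (rcons w a).
Proof.
elim: w => // b w IH w0.
case: (boolP (run (b :: w) == size (b :: w))) => wc.
  have wr0 a : rcons (b :: w) a != [::] by rewrite -size_eq0 size_rcons.
  set n := size (b :: w).
  pose F i := if i == cls b then 2^-1 ^+ n.+1 * T n.+1 / 2 else 2^-1 ^+ n * p n / 4.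
  rewrite (eq_bigr (fun a => F (cls a))) => [|a _]; last first.
    rewrite /F; case: ifP => ab; last by rewrite conformal_break//= ab.
    by rewrite conformal_const ?size_rcons ?wr0 ?run_rcons ?wc ?ab.
  rewrite (sum_cls (cls b)) /F eqxx (_ : (~~ cls b == cls b) = false); last by case: cls.
  by rewrite conformal_const// -/n (TS (ltn0Sn _ : 0 < n)%N) exprS; field.
have w'0 : w != [::] by apply: contraNneq wc => ->.
rewrite conformal_cons// IH// mulr_sumr; apply: eq_bigr => a _.
have r : run (rcons (b :: w) a) = run (b :: w) by rewrite run_rcons// (negPf wc).
rewrite rcons_cons in r *.
rewrite conformal_cons r//.
rewrite -[size (b :: rcons w a)]/(size (rcons w a)).+1 size_rcons neq_ltn ltnS.
by apply/orP; left; exact: run_size (b :: w).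
Qed.

(** The normalised integral of the eigenfunction over the cylinder. On a word within one class the
    run is still open: summing h k * p k = T k over k >= size w produces [U]. *)
Definition gibbs_mass (w : seq 'I_4) : R :=
  if w == [::] then 1
  else if run w == size w then 2^-1 ^+ size w * U (size w) / (2 * m)
  else h (run w) * conformal w / m.

Let h_gt0 n : (0 < n)%N -> 0 < h n.
Proof. by move=> /h_bounds /andP[+ _]; exact: lt_le_trans. Qed.

Let U_gt0 n : (0 < n)%N -> 0 < U n.
Proof.
move=> n0; have /andP[TUn _] := TU n0; have /andP[pTn _] := pT n0.
exact: lt_le_trans (p_gt0 n) (le_trans pTn TUn).
Qed.

Lemma conformal_gt0 w : 0 < conformal w.
Proof.
elim: w => // b w IH.
case: (boolP (run (b :: w) == size (b :: w))) => wc.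
  rewrite conformal_const//; have /andP[+ _] := pT (ltn0Sn (size w)).
  move=> /(lt_le_trans (p_gt0 _)) T0.
  by rewrite divr_gt0// mulr_gt0// exprn_gt0// invr_gt0.
by rewrite conformal_cons// !mulr_gt0 ?decay_gt0 ?z_gt0 ?invr_gt0.
Qed.

Lemma gibbs_mass_ge0 w : 0 <= gibbs_mass w.
Proof.
rewrite /gibbs_mass; case: eqP => // /eqP w0; case: ifP => _; apply/ltW.
  rewrite divr_gt0 ?mulr_gt0 ?exprn_gt0 ?invr_gt0//; apply: U_gt0.
  by rewrite lt0n size_eq0.
by rewrite divr_gt0// mulr_gt0 ?conformal_gt0// h_gt0 ?run_gt0.
Qed.

Lemma gibbs_mass_const w : w != [::] -> run w == size w ->
  gibbs_mass w = 2^-1 ^+ size w * U (size w) / (2 * m).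
Proof. by rewrite /gibbs_mass => /negPf -> ->. Qed.

Lemma gibbs_mass_nonconst w : w != [::] -> run w != size w ->
  gibbs_mass w = h (run w) * conformal w / m.
Proof. by rewrite /gibbs_mass => /negPf -> /negPf ->. Qed.

Lemma gibbs_mass1 a : gibbs_mass [:: a] = 4^-1.
Proof. by rewrite gibbs_mass_const//= -/m; have := m_gt0 => m0; field; rewrite gt_eqF. Qed.

Let h_p n : h n * p n = T n.
Proof. by rewrite /h divfK// gt_eqF. Qed.

Lemma gibbs_mass_rcons w : gibbs_mass w = \sum_(a : 'I_4) gibbs_mass (rcons w a).
Proof.
have m0 : m != 0 by rewrite gt_eqF.
have [->|w0] := eqVneq w [::].
  rewrite (eq_bigr (fun=> 4^-1)) => [|a _]; last exact: gibbs_mass1.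
  rewrite sumr_const card_ord {1}/gibbs_mass /=.
  by field.
have wr0 a : rcons w a != [::] by rewrite -size_eq0 size_rcons.
case: (boolP (run w == size w)) => wc; last first.
  rewrite gibbs_mass_nonconst// conformal_rcons// mulr_sumr mulr_suml.
  apply: eq_bigr => a _.
  have r : run (rcons w a) = run w by rewrite run_rcons// (negPf wc).
  rewrite gibbs_mass_nonconst// r//.
  by rewrite size_rcons neq_ltn ltnS run_size.
set n := size w.
have n0 : (0 < n)%N by rewrite lt0n size_eq0.
pose F i := if i == cls (head ord0 w) then 2^-1 ^+ n.+1 * U n.+1 / (2 * m)
  else h n * (2^-1 ^+ n * p n / 4) / m.
rewrite (eq_bigr (fun a => F (cls a))) => [|a _]; last first.
  rewrite /F; case: ifP => ab.
    by rewrite gibbs_mass_const ?size_rcons// run_rcons// wc ab.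
  have r : run (rcons w a) = n by rewrite run_rcons// wc ab.
  rewrite gibbs_mass_nonconst// r ?conformal_break ?ab//.
  by rewrite size_rcons neq_ltn ltnSn.
rewrite (sum_cls (cls (head ord0 w))) /F eqxx.
rewrite (_ : (~~ cls (head ord0 w) == cls (head ord0 w)) = false); last by case: cls.
rewrite gibbs_mass_const// -/n (US n0) exprS -(h_p n).
by field.
Qed.

(** For a word meeting both classes this is the eigenfunction equation. For a word within one class,
    the two letters that break the class contribute [T] through z * decay 1 * h 1 = 1, and the other
    two contribute the next [U]. *)
Lemma gibbs_mass_cons w : \sum_(b : 'I_4) gibbs_mass (b :: w) = gibbs_mass w.
Proof.
have m0 : m != 0 by rewrite gt_eqF.
have [->|w0] := eqVneq w [::].
  rewrite (eq_bigr (fun=> 4^-1)) => [|a _]; last exact: gibbs_mass1.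
  rewrite sumr_const card_ord {1}/gibbs_mass /=.
  by field.
case: (boolP (run w == size w)) => wc; last first.
  rewrite (gibbs_mass_nonconst w0)// -(eigen_run w0) !mulr_suml.
  apply: eq_bigr => b _.
  have nc : run (b :: w) != size (b :: w) by rewrite run_cons_size// (negPf wc) andbF.
  rewrite gibbs_mass_nonconst// conformal_cons//; ring.
set n := size w.
have n0 : (0 < n)%N by rewrite lt0n size_eq0.
pose F i := if i == cls (head ord0 w) then 2^-1 ^+ n.+1 * U n.+1 / (2 * m)
  else h 1%N * (z / 2 * decay 1 * (2^-1 ^+ n * T n / 2)) / m.
rewrite (eq_bigr (fun a => F (cls a))) => [|a _]; last first.
  rewrite /F; case: ifP => ab.
    by rewrite gibbs_mass_const// run_cons_size// ab.
  have r : run (a :: w) = 1%N by rewrite run_cons// ab.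
  have nc : run (a :: w) != size (a :: w) by rewrite run_cons_size// ab.
  by rewrite gibbs_mass_nonconst// conformal_cons// r conformal_const.
rewrite (sum_cls (cls (head ord0 w))) /F eqxx.
rewrite (_ : (~~ cls (head ord0 w) == cls (head ord0 w)) = false); last by case: cls.
rewrite gibbs_mass_const// -/n (US n0) exprS.
have -> : h 1%N * (z / 2 * decay 1 * (2^-1 ^+ n * T n / 2)) / m =
  (z * decay 1 * h 1%N) * (2^-1 ^+ n * T n / 4) / m by field.
by rewrite h1E; field.
Qed.

Definition run_weight (w : seq 'I_4) : R := z / 2 * decay (run w).

Lemma run_weight_gt0 w : 0 < run_weight w.
Proof. by rewrite !mulr_gt0 ?decay_gt0 ?z_gt0 ?invr_gt0. Qed.

Lemma word_weight_const w : run w == size w ->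
  word_weight run_weight w = 2^-1 ^+ size w * p (size w).
Proof.
elim: w => [|b w IH] wc.
  by rewrite /= expr0 mul1r /p expr0 decay_prod0 mulr1.
have [w0|w0] := eqVneq w [::].
  by rewrite w0 /= /run_weight /= p1; field.
rewrite -[LHS]/(run_weight (b :: w) * word_weight run_weight w).
rewrite IH; last by move: wc; rewrite run_cons_size// => /andP[].
by rewrite /run_weight (eqP wc) -[size (b :: w)]/(size w).+1 pS exprS; field.
Qed.

Lemma conformal_le w : conformal w <= word_weight run_weight w / (1 - z).
Proof.
elim: w => [|b w IH].
  by rewrite /= div1r invf_ge1// gerBl ltW// z_gt0.
case: (boolP (run (b :: w) == size (b :: w))) => wc.
  rewrite conformal_const// word_weight_const// -[leLHS]mulrA -[leRHS]mulrA ler_pM2l ?exprn_gt0 ?invr_gt0//.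
  have /andP[Tp Tle] := pT (ltn0Sn (size w)).
  apply: le_trans Tle; rewrite ger_pMr ?invf_le1 ?ler1n//.
  exact: lt_le_trans Tp.
rewrite conformal_cons// -[word_weight _ _]/(run_weight (b :: w) * word_weight run_weight w).
by rewrite -[leRHS]mulrA ler_pM2l// run_weight_gt0.
Qed.

(** The half of the Gibbs property that bounds the entropy of the measure from below. *)
Lemma gibbs_mass_le w :
  gibbs_mass w <= word_weight run_weight w * ((1 - z) ^+ 2)^-1.
Proof.
have z20 : 0 < (1 - z) ^+ 2 by rewrite exprn_gt0.
have z21 : (1 - z) ^+ 2 <= 1.
  by rewrite exprn_ile1// ?(ltW z1_gt0)// gerBl ltW// z_gt0.
have [->|w0] := eqVneq w [::].
  by rewrite /gibbs_mass /= mul1r invf_ge1.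
have n0 : (0 < size w)%N by rewrite lt0n size_eq0.
case: (boolP (run w == size w)) => wc.
  rewrite gibbs_mass_const// word_weight_const// -[leLHS]mulrA -[leRHS]mulrA ler_pM2l ?exprn_gt0 ?invr_gt0//.
  have /andP[_ Ule] := TU n0.
  apply: le_trans Ule; rewrite ger_pMr ?U_gt0// invf_le1 ?mulr_gt0//.
  have := U1_ge1; rewrite -/m; lra.
rewrite gibbs_mass_nonconst//.
have /andP[h1 h2] := h_bounds (run_gt0 w0).
apply: (@le_trans _ _ (h (run w) * conformal w)).
  rewrite ler_pdivrMr// ler_peMr ?U1_ge1// mulr_ge0 ?(ltW (conformal_gt0 _))//.
  exact: le_trans h1.
apply: (@le_trans _ _ ((1 - z)^-1 * (word_weight run_weight w / (1 - z)))).
  by apply: ler_pM; rewrite ?(ltW (conformal_gt0 _)) ?conformal_le// (le_trans _ h1).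
by rewrite expr2 invfM; rewrite mulrCA mulrA.
Qed.

(** The empty word has run 0, whereas the renewal data constrain [h] from 1 on. *)
Definition supersolution (w : seq 'I_4) : R := if w == [::] then 1 else h (run w).

Lemma supersolution_ge1 w : 1 <= supersolution w.
Proof.
rewrite /supersolution; case: eqP => // /eqP w0.
by have /andP[] := h_bounds (run_gt0 w0).
Qed.

Lemma run_weight_bound :
  exists2 K : R, 0 < K & forall n, \sum_(w : n.-tuple 'I_4) word_weight run_weight w <= K.
Proof.
apply: (@word_weight_bound _ run_weight supersolution 1) => //.
- exact: run_weight_gt0.
- exact: supersolution_ge1.
- by move=> w w0; rewrite /supersolution (negPf w0) /run_weight eigen_run.
Qed.

(** By [eigen_run], the operator with weight [decay (run w)] has eigenvalue 2 / z on the
    eigenfunction; this is its logarithm. *)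
Definition pressure : R := - ln (z / 2).

Lemma pressure_gt0 : 0 < pressure.
Proof. by rewrite oppr_gt0 ln_lt0// divr_gt0 ?z_gt0//= ltr_pdivrMr// mul1r; have := z_lt1; lra. Qed.

Lemma expect_run_weight (nu : probability fullshift R) :
  \int[nu]_x - ln (run_weight (word x k)) @[k --> \oo] -->
  pressure + t * \int[nu]_x phi R x.
Proof.
have -> : (fun k => \int[nu]_x - ln (run_weight (word x k))) =
    (fun k => pressure + t * \int[nu]_x cbar R (run (word x k))).
  apply/funext => k.
  have b : bounded_measurable (fun x => cbar R (run (word x k))).
    exact: (bounded_measurable_word (fun w => cbar R (run w))).
  rewrite -expectZ// -[in RHS](expect_cst nu pressure) -expectD//.
  - apply: eq_Rintegral => x _.
    by rewrite /run_weight lnM ?posrE ?decay_gt0 ?divr_gt0 ?z_gt0// opprD /decay expRK opprK.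
  - exact: bounded_measurable_cst.
  - apply: bounded_measurableM => //; exact: bounded_measurable_cst.
by apply: cvgD; [exact: cvg_cst|apply: cvgM; [exact: cvg_cst|exact: expect_phi_cvg]].
Qed.

Lemma entropy_le_pressure (nu : probability fullshift R) :
  invariant_measure left_shift nu ->
  (entropy left_shift nu <= (pressure + t * \int[nu]_x phi R x)%:E)%E.
Proof.
move=> inv; have [K K0 WK] := run_weight_bound.
apply: (entropy_le_weight inv run_weight_gt0 K0 WK); exact: expect_run_weight.
Qed.

Lemma gibbs_measure : exists mu : probability fullshift R,
  [/\ invariant_measure left_shift mu, forall w, pr mu w = gibbs_mass w &
  entropy left_shift mu = (pressure + t * \int[mu]_x phi R x)%:E].
Proof.
have [mu muE] := cylinder_extension gibbs_mass_ge0 (erefl _) gibbs_mass_rcons.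
have inv : invariant_measure left_shift mu.
  apply: invariant_prP => w; under eq_bigr do rewrite muE.
  by rewrite muE gibbs_mass_cons.
exists mu; split=> //; apply/eqP; rewrite eq_le entropy_le_pressure//=.
have [K K0 WK] := run_weight_bound.
have z20 : 0 < ((1 - z) ^+ 2)^-1 by rewrite invr_gt0 exprn_gt0.
apply: (entropy_ge_weight inv run_weight_gt0 K0 z20 WK).
  by move=> w; rewrite muE gibbs_mass_le.
exact: expect_run_weight.
Qed.

Lemma ln1D_ge (x : R) : `|x| <= 2^-1 -> - ln (1 + x) <= - x + 2 * x ^+ 2.
Proof.
rewrite ler_norml => /andP[x1 x2].
have x0 : 0 < 1 + x by lra.
have xi : 0 < (1 + x)^-1 by rewrite invr_gt0.
rewrite -lnV ?posrE// (_ : (1 + x)^-1 = 1 + ((1 + x)^-1 - 1)); last by ring.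
apply: le_trans (le_ln1Dx _) _; first by rewrite ltrBrDl subrr.
have -> : (1 + x)^-1 - 1 = - x + x ^+ 2 / (1 + x) by field; rewrite gt_eqF.
rewrite lerD2l mulrC ler_wpM2r ?sqr_ge0//.
by rewrite -[leRHS]invrK lef_pV2 ?posrE ?invr_gt0//; lra.
Qed.

(* The perturbed weight still bounds the entropy, while [nu] attains the bound
   for the unperturbed one. *)
Lemma tangent_inequality (nu : probability fullshift R) (chi H : seq 'I_4 -> R)
    (kappa : R) k :
  invariant_measure left_shift nu ->
  (forall w, `|chi w| <= 2^-1) ->
  (forall x n, (k <= n)%N -> chi (word x n) = chi (word x k)) ->
  0 < kappa -> (forall w, kappa <= H w) ->
  (forall w, w != [::] ->
     \sum_(b : 'I_4) run_weight (b :: w) * (1 + chi (b :: w)) * H (b :: w) <= H w) ->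
  ((pressure + t * \int[nu]_x phi R x)%:E <= entropy left_shift nu)%E ->
  \int[nu]_x chi (word x k) <= \int[nu]_x (2 * chi (word x k) ^+ 2).
Proof.
move=> inv chi2 chik k0 kH WH opt.
have chi0 w : 0 < 1 + chi w by have := chi2 w; rewrite ler_norml => /andP[]; lra.
pose W w := run_weight w * (1 + chi w).
have W0 w : 0 < W w by rewrite mulr_gt0 ?run_weight_gt0.
have [K K0 WK] := word_weight_bound W0 k0 kH WH.
pose L := \int[nu]_x - ln (1 + chi (word x k)).
have Wl : \int[nu]_x - ln (W (word x n)) @[n --> \oo] --> pressure + t * \int[nu]_x phi R x + L.
  rewrite -(cvg_shiftn k).
  have E : [sequence \int[nu]_x - ln (W (word x (n + k)))]_n =
      (fun n => \int[nu]_x - ln (run_weight (word x (n + k))) + L).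
    apply/funext => n; rewrite /L -expectD; last 2 first.
    - exact: (bounded_measurable_word (fun w => - ln (run_weight w))).
    - exact: (bounded_measurable_word (fun w => - ln (1 + chi w))).
    apply: eq_Rintegral => x _.
    by rewrite /W lnM ?posrE ?run_weight_gt0// opprD (chik x (n + k)%N)// leq_addl.
  rewrite E; apply: cvgD; last exact: cvg_cst.
  by rewrite (cvg_shiftn k (fun n => \int[nu]_x - ln (run_weight (word x n)))); exact: expect_run_weight.
have := le_trans opt (entropy_le_weight inv W0 K0 WK Wl).
rewrite lee_fin lerDl => L0.
have bc : bounded_measurable (fun x => chi (word x k)).
  exact: (bounded_measurable_word chi).
have b2 : bounded_measurable (fun x => 2 * chi (word x k) ^+ 2).
  exact: (bounded_measurable_word (fun w => 2 * chi w ^+ 2)).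
rewrite -subr_ge0 addrC -expectN// -expectD//; last exact: bounded_measurableN.
apply: le_trans L0 _; apply: le_expect.
- exact: (bounded_measurable_word (fun w => - ln (1 + chi w))).
- by apply: bounded_measurableD => //; exact: bounded_measurableN.
- by move=> x; exact: ln1D_ge.
Qed.

(** The perturbation is the difference of the two cylinder indicators. Prepending [b] or [b']
    produces the same run, so its effect on the eigenfunction equation cancels and [h] remains a
    solution; the tangent inequality is then divided by s. *)
Lemma optimal_exchange (nu : probability fullshift R) b b' w :
  invariant_measure left_shift nu ->
  ((pressure + t * \int[nu]_x phi R x)%:E <= entropy left_shift nu)%E ->
  cls b = cls b' -> pr nu (b :: w) <= pr nu (b' :: w).
Proof.
move=> inv opt bb'.
pose k := (size w).+1.
pose chi (y : seq 'I_4) : R := (take k y == b :: w)%:R - (take k y == b' :: w)%:R.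
have chi1 y : `|chi y| <= 1.
  by rewrite /chi; do 2 case: eqP => _; rewrite ?subrr ?subr0 ?sub0r ?normrN ?normr0 ?normr1.
have H (s : R) : 0 < s -> s <= 2^-1 -> \int[nu]_x chi (word x k) <= 2 * s.
  move=> s0 s2; pose chis y := s * chi y.
  have chisb y : `|chis y| <= s.
    by rewrite normrM gtr0_norm// ler_piMr// ltW.
  have : \int[nu]_x chis (word x k) <= \int[nu]_x (2 * chis (word x k) ^+ 2).
    apply: (@tangent_inequality nu chis supersolution 1) => //.
    - by move=> y; exact: le_trans s2.
    - by move=> x n kn; rewrite /chis /chi !take_word.
    - exact: supersolution_ge1.
    - move=> y y0.
      have -> : \sum_(c : 'I_4) run_weight (c :: y) * (1 + chis (c :: y)) * supersolution (c :: y)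
        = \sum_(c : 'I_4) run_weight (c :: y) * h (run (c :: y)) +
          \sum_(c : 'I_4) s * chi (c :: y) * (run_weight (c :: y) * h (run (c :: y))).
        rewrite -big_split /=; apply: eq_bigr => c _.
        rewrite /supersolution (_ : (c :: y == [::]) = false)// /chis; ring.
      rewrite /supersolution (negPf y0) /run_weight eigen_run// gerDl.
      pose G c := s * (take (size w) y == w)%:R * (run_weight (c :: y) * h (run (c :: y))).
      rewrite (eq_bigr (fun c => (c == b)%:R * G c - (c == b')%:R * G c)); last first.
        move=> c _; rewrite /chi /= !eqseq_cons /G /run_weight.
        by case: (c == b); case: (c == b'); case: (take _ _ == w); rewrite /= ?mulr1n ?mulr0n; ring.
      rewrite sumrB.
      have S c' : \sum_c (c == c')%:R * G c = G c'.
        rewrite (bigD1 c')//= eqxx mul1r big1 ?addr0// => c /negPf ->.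
        by rewrite mul0r.
      have r : run (b :: y) = run (b' :: y) by rewrite !run_cons// bb'.
      by rewrite !S /G /run_weight r subrr.
  have bc : bounded_measurable (fun x => chi (word x k)).
    exact: (bounded_measurable_word chi).
  have -> : \int[nu]_x chis (word x k) = s * \int[nu]_x chi (word x k) by rewrite expectZ.
  move=> /le_trans.
  have -> : 2 * s = (2 * s ^+ 2) / s by field; rewrite gt_eqF.
  rewrite ler_pdivlMr// mulrC; apply.
  rewrite -[leRHS](expect_cst nu); apply: le_expect.
  - exact: (bounded_measurable_word (fun w => 2 * chis w ^+ 2)).
  - exact: bounded_measurable_cst.
  - move=> x; rewrite ler_pM2l// -[leLHS]real_normK ?num_real// lerXn2r ?nnegrE//.
    exact: ltW.
have bI u : bounded_measurable (fun x => (word x (size u) == u)%:R : R).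
  exact: bounded_measurable_cyl.
have -> : pr nu (b :: w) = \int[nu]_x chi (word x k) + pr nu (b' :: w).
  rewrite -!expect_cyl -expectD//; last exact: (bounded_measurable_word chi).
  by apply: eq_Rintegral => x _; rewrite /chi take_word// -[size (b :: w)]/k -[size (b' :: w)]/k subrK.
rewrite gerDr; apply/ler_addgt0Pr => e e0; rewrite add0r.
apply: (@le_trans _ _ (2 * Num.min 2^-1 (e / 2))).
  by apply: H; rewrite ?ge_min ?lexx// lt_min invr_gt0 ltr0n divr_gt0.
have : Num.min 2^-1 (e / 2) <= e / 2 by rewrite ge_min lexx orbT.
lra.
Qed.

Let kap := 1 + m / 2.
Let a n := v n - kap * h n.
Let A := ((1 - z) ^+ 2)^-1 + kap / (1 - z).

(* [a] solves the linearised eigenfunction equation for the perturbation of the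
   weight by the sign of the class of the first letter; [kap] is chosen so that
   the constant terms cancel. *)
Let tilt_bound n : (0 < n)%N -> `|a n| <= A.
Proof.
move=> n0; have /andP[h1 h2] := h_bounds n0; have /andP[v1 v2] := v_bounds n0.
have k0 : 0 < kap by rewrite /kap ltr_wpDr// divr_ge0// ltW.
have kh : kap * h n <= kap / (1 - z) by rewrite ler_pM2l.
have kh0 : 0 <= kap * h n by rewrite mulr_ge0 ?(ltW k0)//; lra.
rewrite ler_norml /A /a; apply/andP; split; last by lra.
have : 0 <= ((1 - z) ^+ 2)^-1 by lra.
lra.
Qed.

(** The terms of first order in [s] agree. Lowering both weights by [d], of order s^2, gains d * r
    >= d, which absorbs the two remaining terms, each at most d / 2. *)
Let tilt_algebra (r B C s g d : R) : g = 1 \/ g = -1 -> 1 <= r ->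
  `|B| <= A -> `|C| <= A -> 0 < s -> 4 * A * s <= 1 -> d = 4 * A * s ^+ 2 ->
  (1 + (s * g - d)) * (r - 1 + s * g * B) + (1 + (s * - g - d)) * (1 - s * g * C)
    <= r + s * g * (r - 2 + B - C).
Proof.
move=> g1 r1 BA CA s0 As dE.
have d0 : 0 <= d.
  have A0 : 0 <= A := le_trans (normr_ge0 B) BA.
  by rewrite dE mulr_ge0 ?sqr_ge0// mulr_ge0.
have g2 : g * g = 1 by case: g1 => ->; lra.
have gBC : - (g * (B - C)) <= 2 * A.
  move: BA CA; rewrite !ler_norml => /andP[? ?] /andP[? ?].
  by case: g1 => ->; lra.
have e1 : s * d * - (g * (B - C)) <= d / 2.
  apply: (@le_trans _ _ (s * d * (2 * A))); first by rewrite ler_wpM2l// mulr_ge0// ltW.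
  rewrite (_ : s * d * (2 * A) = d * (4 * A * s) / 2); last by field.
  by rewrite ler_pM2r ?invr_gt0// ler_piMr.
have e2 : s ^+ 2 * (B + C) <= d / 2.
  rewrite dE (_ : _ / 2 = s ^+ 2 * (2 * A)); last by field.
  rewrite ler_wpM2l ?sqr_ge0//.
  by move: BA CA; rewrite !ler_norml => /andP[? ?] /andP[? ?]; lra.
have e3 : d * 1 <= d * r by rewrite ler_wpM2l.
rewrite -subr_ge0.
have -> : r + s * g * (r - 2 + B - C) -
    ((1 + (s * g - d)) * (r - 1 + s * g * B) + (1 + (s * - g - d)) * (1 - s * g * C)) =
    d * r - s * d * - (g * (B - C)) - (g * g) * s ^+ 2 * (B + C) by ring.
rewrite g2 mul1r; lra.
Qed.

Let A_ge1 : 1 <= A.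
Proof.
have k1 : 1 <= kap by rewrite /kap lerDl divr_ge0// ltW.
have i1 : 1 <= (1 - z)^-1 by rewrite invf_ge1// gerBl ltW// z_gt0.
have : 0 <= ((1 - z) ^+ 2)^-1 by rewrite invr_ge0 sqr_ge0.
rewrite /A; have : 1 * 1 <= kap / (1 - z) by apply: ler_pM.
lra.
Qed.

(** The sign [g] of the class is not neutral for [h], so the eigenfunction has to be moved along: h
    + s g a is a supersolution for the weight tilted by s g - d. Both values of [i] together balance
    the classes. *)
Lemma optimal_class_le (nu : probability fullshift R) (i : bool) :
  invariant_measure left_shift nu ->
  ((pressure + t * \int[nu]_x phi R x)%:E <= entropy left_shift nu)%E ->
  \int[nu]_x (if cls (x 0%N) == i then 1 else -1 : R) <= 0.
Proof.
move=> inv opt.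
pose g y : R := if cls (head ord0 y) == i then 1 else -1.
have g1 y : g y = 1 \/ g y = -1 by rewrite /g; case: ifP; [left|right].
have A1 := A_ge1.
have bg : bounded_measurable (fun x => g (word x 1)) by exact: (bounded_measurable_word g).
have Hs (s : R) : 0 < s -> 4 * A * s <= 1 -> \int[nu]_x g (word x 1) <= (4 * A + 8) * s.
  move=> s0 As; pose d := 4 * A * s ^+ 2.
  have s4 : s <= 4^-1.
    rewrite -[leRHS]mul1r ler_pdivlMr// mulrC.
    by apply: le_trans As; rewrite ler_pM2r//; lra.
  have ds : d <= s by rewrite /d expr2 mulrA ler_piMl// ltW.
  have d0 : 0 <= d by rewrite /d !mulr_ge0 ?sqr_ge0//; lra.
  pose chi y := s * g y - d.
  have chis y : `|chi y| <= 2 * s.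
    by rewrite ler_norml /chi; case: (g1 y) => ->; apply/andP; split; lra.
  have : \int[nu]_x chi (word x 1) <= \int[nu]_x (2 * chi (word x 1) ^+ 2).
    apply: (@tangent_inequality nu chi
      (fun y => if y == [::] then 1 else h (run y) + s * g y * a (run y)) (2^-1)) => //.
    - by move=> y; apply: le_trans (chis y) _; lra.
    - by move=> x n n0; rewrite /chi /g; case: n n0 => // n _; rewrite !wordS.
    - move=> y; case: eqP => [_|/eqP y0]; first by lra.
      have /andP[h1 _] := h_bounds (run_gt0 y0).
      have : `|s * g y * a (run y)| <= 2^-1.
        rewrite !normrM gtr0_norm// (_ : `|g y| = 1) ?mulr1; last first.
          by case: (g1 y) => ->; rewrite ?normrN normr1.
        apply: (@le_trans _ _ (s * A)); first by rewrite ler_pM2l// tilt_bound// run_gt0.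
        lra.
      rewrite ler_norml => /andP[]; lra.
    - move=> y y0; rewrite (negPf y0).
      pose r := run y; pose j := cls (head ord0 y); pose gj : R := if j == i then 1 else -1.
      pose F l := if l == j then
          z / 2 * decay r.+1 * (1 + (s * gj - d)) * (h r.+1 + s * gj * a r.+1)
        else z / 2 * decay 1 * (1 + (s * - gj - d)) * (h 1%N + s * - gj * a 1%N).
      have gN b : cls b != j -> g (b :: y) = - gj.
        by rewrite /g /gj /=; case: (cls b); case: (j); case: (i) => //=; rewrite opprK.
      rewrite (eq_bigr (fun b => F (cls b))); last first.
        move=> b _; rewrite /run_weight run_cons// /F /chi /=; case: ifP => bj.
          by rewrite /g /= /gj (eqP bj).
        by rewrite gN ?bj.
      rewrite (sum_cls j) /F eqxx (_ : (~~ j == j) = false); last by rewrite /j; case: (cls _).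
      have r0 : (0 < r)%N by rewrite run_gt0.
      pose B := z * decay r.+1 * a r.+1; pose C := z * decay 1 * a 1%N.
      have zd n : 0 <= z * decay n <= 1.
        rewrite mulr_ge0 ?(ltW z_gt0) ?(ltW (decay_gt0 _))//= mulr_ile1 ?decay_le1 ?(ltW z_gt0)//.
          exact/ltW/decay_gt0.
        exact/ltW/z_lt1.
      have BA n : (0 < n)%N -> `|z * decay n * a n| <= A.
        move=> n0; have /andP[zd0 zd1] := zd n.
        rewrite normrM (ger0_norm zd0) -[leRHS]mul1r.
        by apply: ler_pM => //; exact: tilt_bound.
      have hr := hS r0; have vr := vS r0; have h1 := h1E; have v1 := v1E.
      have /andP[hr1 _] := h_bounds r0.
      have gj1 : gj = 1 \/ gj = -1 by rewrite /gj; case: ifP; [left|right].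
      have H := tilt_algebra gj1 hr1 (BA r.+1 isT) (BA 1%N isT) s0 As (erefl d).
      have -> : g y = gj by [].
      have -> : z / 2 * decay r.+1 * (1 + (s * gj - d)) * (h r.+1 + s * gj * a r.+1) *+ 2 =
        (1 + (s * gj - d)) * (h r - 1 + s * gj * B) by rewrite hr /B; field.
      have -> : z / 2 * decay 1 * (1 + (s * - gj - d)) * (h 1%N + s * - gj * a 1%N) *+ 2 =
        (1 + (s * - gj - d)) * (z * decay 1 * h 1%N - s * gj * C) by rewrite /C; field.
      rewrite h1.
      apply: le_trans H _; rewrite lerD2l.
      (* Here B = (v r - h r) - kap (h r - 1) and C = m - kap; the constants cancel exactly when 2
         kap = 2 + m. *)
      suff -> : h r - 2 + B - C = a r by [].
      rewrite /B /C /a /kap -/m in v1 *; move: h1 v1 hr vr; rewrite -/m => h1 v1 hr vr.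
      have x1 : z * decay r.+1 * h r.+1 = h r - 1 by rewrite [in RHS]hr; ring.
      have x2 : z * decay r.+1 * v r.+1 = v r - h r by rewrite [in RHS]vr; ring.
      have e1 : z * decay r.+1 * (v r.+1 - (1 + m / 2) * h r.+1) =
        (v r - h r) - (1 + m / 2) * (h r - 1) by rewrite mulrBr (mulrCA _ (1 + m / 2)) x1 x2.
      have e2 : z * decay 1 * (v 1%N - (1 + m / 2) * h 1%N) = m - (1 + m / 2).
        by rewrite mulrBr (mulrCA _ (1 + m / 2)) h1 v1 mulr1.
      by rewrite e1 e2; field.
  have bchi : bounded_measurable (fun x => chi (word x 1)) by exact: (bounded_measurable_word chi).
  have -> : \int[nu]_x chi (word x 1) = s * \int[nu]_x g (word x 1) - d.
    rewrite /chi expectD ?expectZ ?expect_cst//; last exact: bounded_measurable_cst.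
    apply: bounded_measurableM => //; exact: bounded_measurable_cst.
  have : \int[nu]_x (2 * chi (word x 1) ^+ 2) <= 8 * s ^+ 2.
    rewrite -[leRHS](expect_cst nu); apply: le_expect.
    - exact: (bounded_measurable_word (fun w => 2 * chi w ^+ 2)).
    - exact: bounded_measurable_cst.
    - move=> x; have : chi (word x 1) ^+ 2 <= (2 * s) ^+ 2.
        rewrite -[leLHS]real_normK ?num_real// lerXn2r ?nnegrE ?mulr_ge0// ltW//.
      rewrite exprMn; lra.
  move=> e1 e2; rewrite -(ler_pM2l s0).
  have -> : s * ((4 * A + 8) * s) = d + 8 * s ^+ 2 by rewrite /d; ring.
  lra.
have -> : \int[nu]_x (if cls (x 0%N) == i then 1 else -1 : R) = \int[nu]_x g (word x 1).
  by apply: eq_Rintegral.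
apply/ler_addgt0Pr => e e0; rewrite add0r.
have A8 : 0 < 4 * A + 8 by lra.
have A4 : 0 < 4 * A by lra.
apply: (@le_trans _ _ ((4 * A + 8) * Num.min (4 * A)^-1 (e / (4 * A + 8)))).
  apply: Hs; first by rewrite lt_min invr_gt0 A4 divr_gt0.
  by rewrite mulrC -ler_pdivlMr// mul1r ge_min lexx.
by rewrite mulrC -ler_pdivlMr// ge_min lexx orbT.
Qed.

End renewal_weights.

(** * Equilibrium states and the limits of their cylinder masses *)

Section equilibrium.
Variable R : realType.
Implicit Types nu mu : probability fullshift R.

Lemma expect_energy nu (t : R) :
  \int[nu]_x (t * dot (- 1, 0) (@Phi R x)) = - (t * \int[nu]_x phi R x).
Proof.
rewrite -expectZ; last exact: bounded_measurable_phi.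
rewrite -expectN; last first.
  apply: bounded_measurableM; first exact: bounded_measurable_cst.
  exact: bounded_measurable_phi.
apply: eq_Rintegral => x _; rewrite /dot /phi /=; ring.
Qed.

Lemma equilibrium_optimal nu (t z : R) T U : renewal_data t z T U ->
  equilibrium_state (fun x => t * dot (- 1, 0) (@Phi R x)) nu ->
  ((pressure z + t * \int[nu]_x phi R x)%:E <= entropy left_shift nu)%E.
Proof.
move=> D [inv opt].
have [mu [muinv _ muE]] := gibbs_measure D.
have := opt mu muinv; rewrite muE !expect_energy -EFinD addrK.
by rewrite EFinD -leeBrDr// -EFinN.
Qed.

Lemma equilibrium_exists (t : R) : 0 <= t ->
  exists mu, equilibrium_state (fun x => t * dot (- 1, 0) (@Phi R x)) mu.
Proof.
move=> t0; have [z [T [U D]]] := renewal_data_exists t0.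
have [mu [muinv _ muE]] := gibbs_measure D.
exists mu; split=> // nu nuinv; rewrite muE !expect_energy -EFinD addrK.
have := entropy_le_pressure D nuinv.
by rewrite EFinD -leeBlDr// -EFinN.
Qed.

Lemma entropy_le_ln4 nu : invariant_measure left_shift nu ->
  (entropy left_shift nu <= (ln 4)%:E)%E.
Proof.
move=> inv.
have q0 (w : seq 'I_4) : 0 < 4^-1 :> R by rewrite invr_gt0.
have [K K0 WK] : exists2 K : R, 0 < K & forall n, \sum_(w : n.-tuple 'I_4) word_weight (fun=> 4^-1) w <= K.
  apply: (@word_weight_bound _ _ (fun=> 1) 1) => // w _.
  by rewrite sumr_const card_ord mulr1 -(mulr_natr 4^-1) mulVf ?pnatr_eq0.
apply: (entropy_le_weight inv q0 K0 WK).
rewrite (_ : (fun _ => _) = fun=> ln 4); first exact: cvg_cst.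
by apply/funext => k; rewrite expect_cst lnV ?posrE// opprK.
Qed.

Section equilibrium_facts.
Variables (t : R) (nu : probability fullshift R).
Hypothesis t_gt0 : 0 < t.
Hypothesis eqs : equilibrium_state (fun x => t * dot (- 1, 0) (@Phi R x)) nu.

Let inv : invariant_measure left_shift nu. Proof. by case: eqs. Qed.

Lemma equilibrium_exchange b b' w :
  cls b = cls b' -> pr nu (b :: w) = pr nu (b' :: w).
Proof.
move=> bb'; have [z [T [U D]]] := renewal_data_exists (ltW t_gt0).
have opt := equilibrium_optimal D eqs.
by apply/eqP; rewrite eq_le !(optimal_exchange D w inv opt).
Qed.

Lemma equilibrium_class : \int[nu]_x (if cls (x 0%N) then 1 else -1 : R) = 0.
Proof.
have [z [T [U D]]] := renewal_data_exists (ltW t_gt0).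
have opt := equilibrium_optimal D eqs.
apply/eqP; rewrite eq_le; apply/andP; split.
  have := optimal_class_le (ltW t_gt0) D true inv opt.
  by congr (_ <= _); apply: eq_Rintegral => x _; case: cls.
rewrite -oppr_le0 -expectN; last first.
  exact: (bounded_measurable_word (fun w => if cls (head ord0 w) then 1 else -1 : R) 1).
have := optimal_class_le (ltW t_gt0) D false inv opt.
by congr (_ <= _); apply: eq_Rintegral => x _; case: cls; rewrite //= opprK.
Qed.

(** By exchange there is one unknown mass per class; total mass 1 and the balance of the classes
    determine both. *)
Lemma equilibrium_letter a : pr nu [:: a] = 4^-1.
Proof.
have E (G : 'I_4 -> R) : \int[nu]_x G (x 0%N) = \sum_(b : 'I_4) G b * pr nu [:: b].
  transitivity (\int[nu]_x G (head ord0 (word x 1))); first exact: eq_Rintegral.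
  rewrite (expect_word _ (fun w => G (head ord0 w))).
  rewrite (sum_tuple_cons 0 (fun w => G (head ord0 w) * pr nu w)).
  by apply: eq_bigr => b _; rewrite (sum_tuple0 (fun w => G (head ord0 (b :: w)) * pr nu (b :: w))).
have := E (fun b => if cls b then 1 else -1); rewrite equilibrium_class.
have := pr_cons [::] inv; rewrite pr_nil.
pose i0 : 'I_4 := inord 0; pose i2 : 'I_4 := inord 2.
have c0 : cls i0 = false by rewrite /cls /i0 inordK.
have c2 : cls i2 = true by rewrite /cls /i2 inordK.
pose F i := if i then pr nu [:: i2] else pr nu [:: i0].
have FE b : pr nu [:: b] = F (cls b).
  by rewrite /F; case: ifP => cb; apply: equilibrium_exchange; rewrite cb ?c0 ?c2.
rewrite (eq_bigr (fun b => F (cls b))) => [|b _]; last exact: FE.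
rewrite [X in _ -> _ = X -> _](eq_bigr (fun b => (if cls b then 1 else -1) * F (cls b))) => [|b _]; last first.
  by rewrite FE.
rewrite (sum_cls true) (sum_cls true (fun i => (if i then 1 else -1) * F i)) /=.
rewrite (FE a) /F => h1 h2; case: (cls a); lra.
Qed.

(** The pressure is positive and entropy is at most ln 4, so t times the mean of [phi] is at most ln
    4. On the cylinder the class changes inside the word, hence [phi] is at least [cbar (size w)]
    there. *)
Lemma equilibrium_nonconst w : run w != size w ->
  pr nu w * (t * cbar R (size w)) <= ln 4.
Proof.
move=> wc; have [z [T [U D]]] := renewal_data_exists (ltW t_gt0).
have := le_trans (equilibrium_optimal D eqs) (entropy_le_ln4 inv).
rewrite lee_fin => H.
have P0 := pressure_gt0 D.
have b1 := bounded_measurable_cyl R w.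
have : pr nu w * cbar R (size w) <= \int[nu]_x phi R x.
  rewrite mulrC -expect_cyl -expectZ//; apply: le_expect.
  - by apply: bounded_measurableM => //; exact: bounded_measurable_cst.
  - exact: bounded_measurable_phi.
  move=> x; case: eqP => [xw|_]; last by rewrite mulr0 phi_ge0.
  rewrite mulr1 /phi; case: (runP x) => [xr|[r [r0 xr xr']]].
    by move: wc; rewrite -xw (@run_word x (size w) (size w))// size_word eqxx.
  rewrite (Phi_run _ r0 xr xr') /=; apply: le_cbar.
  move: wc; rewrite -{1}xw (run_word_min _ r0 xr xr').
  by case: leqP => // rw; rewrite ?eqxx // => _; exact: ltnW.
rewrite -(ler_pM2l t_gt0); lra.
Qed.

End equilibrium_facts.

(** The additional factor 1/2 in the exponent is the choice of the class. *)
Definition ground_mass (w : seq 'I_4) : R :=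
  if w == [::] then 1 else if run w == size w then 2^-1 ^+ (size w).+1 else 0.

Lemma ground_mass_ge0 w : 0 <= ground_mass w.
Proof. by rewrite /ground_mass; case: ifP => // _; case: ifP => // _; rewrite exprn_ge0// invr_ge0. Qed.

Lemma ground_mass_consE b w : w != [::] -> ground_mass (b :: w) =
  if cls b == cls (head ord0 w) then ground_mass w / 2 else 0.
Proof.
move=> w0; rewrite /ground_mass run_cons_size// (negPf w0) /=.
by case: ifP => [/andP[-> ->]|]; [rewrite exprSr | case: (cls b == _) => //= ->; rewrite mul0r].
Qed.

Lemma ground_mass_letter a : ground_mass [:: a] = 4^-1.
Proof. by rewrite /ground_mass /=; field. Qed.

Lemma ground_mass_cons w : \sum_(b : 'I_4) ground_mass (b :: w) = ground_mass w.
Proof.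
have [->|w0] := eqVneq w [::].
  rewrite (eq_bigr (fun=> 4^-1)) => [|a _]; last exact: ground_mass_letter.
  by rewrite sumr_const card_ord {1}/ground_mass /=; field.
pose F i := if i == cls (head ord0 w) then ground_mass w / 2 else 0.
rewrite (eq_bigr (fun b => F (cls b))) => [|b _]; last exact: ground_mass_consE.
rewrite (sum_cls (cls (head ord0 w))) /F eqxx.
rewrite (_ : (~~ cls (head ord0 w) == cls (head ord0 w)) = false); last by case: cls.
by field.
Qed.

Lemma ground_mass_rcons w : ground_mass w = \sum_(a : 'I_4) ground_mass (rcons w a).
Proof.
have [->|w0] := eqVneq w [::].
  rewrite (eq_bigr (fun=> 4^-1)) => [|a _]; last exact: ground_mass_letter.
  by rewrite sumr_const card_ord {1}/ground_mass /=; field.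
have wr0 a : (rcons w a == [::]) = false by rewrite -size_eq0 size_rcons.
pose F i := if i == cls (head ord0 w) then ground_mass w / 2 else 0.
rewrite (eq_bigr (fun b => F (cls b))) => [|b _]; last first.
  rewrite /F /ground_mass wr0 (negPf w0) run_rcons// size_rcons.
  case: (boolP (run w == size w)) => [_|wc].
    case: (cls b == _); first by rewrite eqxx exprSr.
    by rewrite eqn_leq ltnn andbF.
  rewrite mul0r if_same ifF//.
  by apply/negP => /eqP e; have := run_size w; rewrite e ltnn.
rewrite (sum_cls (cls (head ord0 w))) /F eqxx.
rewrite (_ : (~~ cls (head ord0 w) == cls (head ord0 w)) = false); last by case: cls.
by field.
Qed.

(** Induction by prepending a letter: invariance and exchange give pr w = 2 pr (b :: w) + 2 pr (c ::
    w) with [b] and [c] in different classes, and the mass of the word that breaks the class tends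
    to 0. *)
Lemma equilibrium_cvg_pos (t : nat -> R) (mus : nat -> probability fullshift R) :
  (forall n, 0 < t n) -> t n @[n --> \oo] --> +oo ->
  (forall n, equilibrium_state (fun x => t n * dot (- 1, 0) (@Phi R x)) (mus n)) ->
  forall w, pr (mus n) w @[n --> \oo] --> ground_mass w.
Proof.
move=> t0 too eqs.
have nonc w : run w != size w -> pr (mus n) w @[n --> \oo] --> (0 : R).
  move=> wc; apply/cvgrPdist_le => e e0.
  have c0 := cbar_gt0 R (size w).
  have [N _ HN] : \forall n \near \oo, ln 4 / (cbar R (size w) * e) < t n.
    by move/cvgryPgt : too; apply.
  exists N => // n /= /HN; rewrite ltr_pdivrMr ?mulr_gt0// => Hn.
  have := equilibrium_nonconst (t0 n) (eqs n) wc => H.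
  rewrite sub0r normrN ger0_norm ?pr_ge0//.
  have tc : 0 < t n * cbar R (size w) by rewrite mulr_gt0.
  rewrite -(ler_pM2r tc); apply: le_trans H _; apply: le_trans (ltW Hn) _.
  by rewrite mulrA mulrC.
elim=> [|b w IH].
  rewrite (_ : (fun _ => _) = fun=> 1); first exact: cvg_cst.
  by apply/funext => n; exact: pr_nil.
have [->|w0] := eqVneq w [::].
  rewrite ground_mass_letter (_ : (fun _ => _) = fun=> 4^-1); first exact: cvg_cst.
  by apply/funext => n; exact: (equilibrium_letter (t0 n) (eqs n)).
rewrite ground_mass_consE//; case: ifP => bw; last first.
  by apply: nonc; rewrite run_cons_size// bw.
pose c : 'I_4 := if cls b then inord 0 else inord 2.
have cb : cls c = ~~ cls b by rewrite /c /cls; case: ifP => _; rewrite inordK.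
have cw : pr (mus n) (c :: w) @[n --> \oo] --> (0 : R).
  by apply: nonc; rewrite run_cons_size// cb -(eqP bw); case: (cls b).
have E : (fun n => pr (mus n) (b :: w)) =
    (fun n => (pr (mus n) w - pr (mus n) (c :: w) *+ 2) / 2).
  apply/funext => n; have [inv _] := eqs n.
  rewrite -(pr_cons w inv).
  pose F i := if i == cls b then pr (mus n) (b :: w) else pr (mus n) (c :: w).
  rewrite (eq_bigr (fun a => F (cls a))) => [|a _]; last first.
    rewrite /F; case: eqP => [ab|/eqP ab]; first exact: (equilibrium_exchange (t0 n) (eqs n)).
   
    apply: (equilibrium_exchange (t0 n) (eqs n)); rewrite cb.
    by move: ab; case: (cls a); case: (cls b).
  rewrite (sum_cls (cls b)) /F eqxx (_ : (~~ cls b == cls b) = false); last by case: cls.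
  by field.
rewrite E; apply: cvgM; last exact: cvg_cst.
rewrite -[ground_mass w]subr0; apply: cvgB => //.
rewrite -(mul0rn _ 2).
apply: cvgMn.
exact: cw.
Qed.

(** A sequence tending to infinity may start with nonpositive parameters, which are cut off. *)
Lemma equilibrium_cvg (t : nat -> R) (mus : nat -> probability fullshift R) :
  t n @[n --> \oo] --> +oo ->
  (forall n, equilibrium_state (fun x => t n * dot (- 1, 0) (@Phi R x)) (mus n)) ->
  forall w, pr (mus n) w @[n --> \oo] --> ground_mass w.
Proof.
move=> too eqs w.
have [N _ HN] : \forall n \near \oo, 0 < t n by move/cvgryPgt : too; apply.
rewrite -(cvg_shiftn N).
apply: (@equilibrium_cvg_pos (fun n => t (n + N)%N) (fun n => mus (n + N)%N)).
- by move=> n; apply: HN; exact: leq_addl.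
- by rewrite (cvg_shiftn N t).
- by move=> n; exact: eqs.
Qed.

End equilibrium.

(** * Weak convergence is convergence of cylinder masses *)

Section weak_convergence.
Variable R : realType.
Implicit Types nu mu : probability fullshift R.

(** A representative point of each cylinder; composing with [pad] makes a continuous function depend
    on finitely many letters. *)
Definition pad (w : seq 'I_4) : fullshift := fun k => nth ord0 w k.

Lemma word_pad x n : word (pad (word x n)) n = word x n.
Proof. by apply/wordP => i ni; rewrite /pad nth_word. Qed.

Lemma compact_fullshift : compact [set: fullshift].
Proof.
have := @tychonoff nat (fun=> discrete_topology 'I_4) (fun=> setT).
rewrite (_ : [set f | _] = [set: fullshift]); last exact/seteqP.
apply=> _; apply: finite_compact; exact: (@finite_finset 'I_4).
Qed.

(** Uniform continuity, from the near-covering form of compactness: near a point, both [y] and its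
    padded word lie in one cylinder on which [g] varies little. *)
Lemma continuous_uniform_word (g : fullshift -> R) : continuous g ->
  forall e, 0 < e -> \forall n \near \oo, forall x,
    `|g (pad (word x n)) - g x| <= e.
Proof.
move=> cg e e0; have e20 : 0 < e / 2 by rewrite divr_gt0.
have /compact_near_coveringP cov := compact_fullshift.
have := cov nat \oo (fun n x => `|g (pad (word x n)) - g x| <= e) _ _.
move=> C; suff [N _ HN] : \forall n \near \oo, [set: fullshift] `<=`
    (fun x => `|g (pad (word x n)) - g x| <= e).
  by exists N => // n Nn x; exact: HN.
apply: C => x _.
have /cvgrPdist_le /(_ _ e20) /nbhs_wordP [N HN] := cg x.
exists ([set y | word y N = word x N], [set n | (N <= n)%N]).
  by split; [exact: nbhs_word|exists N].
case=> y n [/= yN nN].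
have h1 := HN y yN.
have h2 : `|g x - g (pad (word y n))| <= e / 2.
  apply: HN => /=; rewrite -yN.
  by apply: (word_sub nN); exact: word_pad.
by move: h1 h2; rewrite !ler_norml; lra.
Qed.

Lemma bounded_measurable_continuous (g : fullshift -> R) :
  continuous g -> bounded_measurable g.
Proof.
move=> cg; split.
  apply: (measurable_fun_cvg (h := fun n x => g (pad (word x n)))).
    by move=> n; exact: (bounded_measurable_word (fun w => g (pad w)) n).1.
  move=> x _; apply/cvgrPdist_le => e e0.
  apply: filterS (continuous_uniform_word cg e0) => n /(_ x).
  by rewrite distrC.
have [N _ /(_ N (leqnn N)) HN] := continuous_uniform_word cg (@ltr01 R).
have [_ [M HM]] := bounded_measurable_word (fun w => g (pad w)) N.
exists (M + 1) => x.
rewrite (_ : g x = g (pad (word x N)) - (g (pad (word x N)) - g x)); last by ring.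
by apply: le_trans (ler_normB _ _) _; apply: lerD.
Qed.

Lemma expect_uniform_word mu (g : fullshift -> R) e N : continuous g ->
  (forall x, `|g (pad (word x N)) - g x| <= e) ->
  `|\int[mu]_x g (pad (word x N)) - \int[mu]_x g x| <= e.
Proof.
move=> cg H; have b1 := bounded_measurable_word (fun w => g (pad w)) N.
have b2 := bounded_measurable_continuous cg.
rewrite -(expectN mu b2) -expectD//; last exact: bounded_measurableN.
have bd : bounded_measurable (fun x => g (pad (word x N)) - g x).
  by apply: bounded_measurableD => //; exact: bounded_measurableN.
rewrite ler_norml; apply/andP; split.
  rewrite -[leLHS](expect_cst mu); apply: le_expect => //.
    exact: bounded_measurable_cst.
  by move=> x; have := H x; rewrite ler_norml => /andP[].
rewrite -[leRHS](expect_cst mu); apply: le_expect => //.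
  exact: bounded_measurable_cst.
by move=> x; have := H x; rewrite ler_norml => /andP[].
Qed.

Lemma weak_cvg_word (mus : nat -> probability fullshift R) mu :
  (forall w, pr (mus n) w @[n --> \oo] --> pr mu w) -> weak_cvg mus mu.
Proof.
move=> H g cg; apply/cvgrPdist_le => e e0.
have e30 : 0 < e / 3 by rewrite divr_gt0.
have [N _ /(_ N (leqnn N)) HN] := continuous_uniform_word cg e30.
have : \int[mus n]_x g (pad (word x N)) @[n --> \oo] -->
    \int[mu]_x g (pad (word x N)).
  rewrite (expect_word _ (fun w => g (pad w))).
  under eq_fun do rewrite (expect_word _ (fun w => g (pad w))).
  apply: cvg_big => [|w _]; last by apply: cvgM; [exact: cvg_cst|exact: H].
  exact: add_continuous.
move/cvgrPdist_le => /(_ _ e30); apply: filterS => n h1.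
have h2 := expect_uniform_word mu cg HN.
have h3 := expect_uniform_word (mus n) cg HN.
move: h1 h2 h3; rewrite !ler_norml; lra.
Qed.

Lemma weak_cvg_pr (mus : nat -> probability fullshift R) mu :
  weak_cvg mus mu -> forall w, pr (mus n) w @[n --> \oo] --> pr mu w.
Proof.
move=> H w; rewrite -expect_cyl; under eq_fun do rewrite -expect_cyl.
by apply: H => x; exact: (@continuous_word _ (fun v => (v == w)%:R : R)).
Qed.

End weak_convergence.

(** * The ground state and its failure of ergodicity *)

Section ground.
Variable R : realType.
Implicit Types nu mu : probability fullshift R.

Lemma ground_measure_exists : exists mu : probability fullshift R,
  invariant_measure left_shift mu /\ forall w, pr mu w = ground_mass R w.
Proof.
have [mu muE] := @cylinder_extension R (ground_mass R)
  (@ground_mass_ge0 R) erefl (@ground_mass_rcons R).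
exists mu; split=> //; apply: invariant_prP => w.
under eq_bigr do rewrite muE.
by rewrite ground_mass_cons muE.
Qed.

Variable mu : probability fullshift R.
Hypothesis mu_inv : invariant_measure left_shift mu.
Hypothesis muE : forall w, pr mu w = ground_mass R w.

(** Equality is taken on measurable sets because a measure is here a function on all subsets, and
    cylinder masses determine it on the measurable ones. *)
Lemma ground_states nu : GS (@Phi R) (- 1, 0) nu <->
  (forall A : set fullshift, measurable A -> nu A = mu A).
Proof.
split=> [[nuinv [t [mus [_ too eqs wc]]]]|nuE].
  apply: eq_probability_word => w; rewrite muE.
  rewrite -(cvg_lim (@Rhausdorff R) (weak_cvg_pr wc (w := w))).
  exact: (cvg_lim (@Rhausdorff R) (equilibrium_cvg too eqs (w := w))).
split=> [A mA|].
  rewrite !nuE ?mu_inv//.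
  by rewrite -[X in measurable X]setTI; exact: measurable_left_shift.
have [mus eqs] : {mus : nat -> probability fullshift R &
    forall n, equilibrium_state (fun x => n.+1%:R * dot (- 1, 0) (@Phi R x)) (mus n)}.
  by apply: (@choice _ _ (fun n m => equilibrium_state _ m)) => n; apply: equilibrium_exists; exact: ler0n.
exists (fun n => n.+1%:R), mus; split=> //.
- by move=> m n mn; rewrite ltr_nat.
- have := @cvgr_idn R; rewrite -cvg_shiftS; exact.
apply: weak_cvg_word => w; rewrite /pr nuE; last exact: measurable_cyl.
rewrite -/(pr mu w) muE; apply: (fun H => equilibrium_cvg H eqs (w := w)).
have := @cvgr_idn R; rewrite -cvg_shiftS; exact.
Qed.

(** The points that meet both classes; null because [ground_mass] vanishes on words meeting both. *)
Let N : set fullshift := \bigcup_n [set x | run (word x n) != n].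

Let negligible_N : mu.-negligible N.
Proof.
apply: negligible_bigcup => n.
have mQ := measurable_word (fun w => run w != n) n.
apply/negligibleP; first exact: mQ.
apply: etrans (esym (probability_fineK mu mQ)) _; rewrite -expect_indic//; congr EFin.
transitivity (\int[mu]_x ((run (word x n) != n)%:R : R)).
  apply: eq_Rintegral => x _; rewrite indicE; congr (_%:R).
  by congr nat_of_bool; apply/idP/idP => [/set_mem//|?]; exact: mem_set.
rewrite (expect_word mu (fun w => (run w != n)%:R)) big1// => w _.
case: eqP => [|wn]; first by rewrite mul0r.
rewrite muE /ground_mass size_tuple (_ : (run w == n) = false); last exact/eqP.
by rewrite (_ : (_ == _) = false) ?mulr0//; apply/eqP => w0; apply: wn; apply: etrans (size_tuple w); rewrite w0.
Qed.

Let class_tail (x : fullshift) : ~ N x -> forall j, cls (x j) = cls (x 0%N).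
Proof.
move=> Nx; case: (runP x) => // -[r [r0 xr xr']]; exfalso; apply: Nx.
exists r.+1 => //; rewrite /mkset (run_word_min _ r0 xr xr').
by rewrite (minn_idPl (leqnSn r)) neq_ltn ltnSn.
Qed.

(** The test set consists of the points eventually in {2,3}: it equals its preimage exactly, whereas
    the set of points always in {2,3} does not. The letters 2 and 0, of mass 1/4, exclude mass 0 for
    it and for its complement. *)
Lemma ground_measure_not_ergodic : ~ ergodic left_shift mu.
Proof.
move=> [_ erg].
pose A : set fullshift := \bigcup_n \bigcap_(j in [set j | (n <= j)%N]) [set x | cls (x j) = true].
have mA : measurable A.
  apply: bigcup_measurable => n _; apply: bigcap_measurable => [|j _]; first by exists n => /=.
  rewrite (_ : [set x | _] = [set x : fullshift | cls (nth ord0 (word x j.+1) j) = true]).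
    exact: (measurable_word (fun w => cls (nth ord0 w j) = true)).
  by apply/seteqP; split=> x /=; rewrite nth_word.
have fA : left_shift @^-1` A = A.
  apply/seteqP; split=> x [n _ xn].
    exists n.+1 => // -[//|j] /= nj; exact: (xn j).
  exists n => // j /= nj; apply: (xn j.+1); exact: leq_trans nj _.
have mass a S : measurable S -> mu S = 0%E -> ~ (cyl [:: a] `<=` N `|` S).
  move=> mS S0 sub.
  have : mu.-negligible (cyl [:: a]).
    apply: (negligibleS sub); apply: negligibleU; first exact: negligible_N.
    exact/negligibleP.
  move/negligibleP => /(_ (measurable_cyl [:: a])) e.
  have := muE [:: a]; rewrite /pr e ground_mass_letter /= => /esym/eqP.
  by rewrite invr_eq0 pnatr_eq0.
have letter (x : fullshift) a : cyl [:: a] x -> x 0%N = a.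
  by rewrite /cyl /= /word /= => -[].
case: (erg _ mA fA) => muA.
  apply: (mass (inord 2) A mA muA).
  move=> x /letter x0; have [Nx|Nx] := pselect (N x); [by left|right].
  by exists 0%N => // j _ /=; rewrite (class_tail Nx) x0 /cls inordK.
have muCA : mu (~` A) = 0%E by rewrite probability_setC// muA subee.
apply: (mass (inord 0) _ (measurableC mA) muCA).
move=> x /letter x0; have [Nx|Nx] := pselect (N x); [by left|right].
move=> [n _ /(_ n (leqnn n))] /=.
by rewrite (class_tail Nx) x0 /cls inordK.
Qed.

End ground.

(** * The rotation set at the origin *)

Section rotation_set.
Variable R : realType.
Implicit Types nu mu : probability fullshift R.

Lemma continuous_word_limit (g : fullshift -> R) (G : seq 'I_4 -> R) (e : nat -> R) :
  e n @[n --> \oo] --> (0 : R) -> (forall x n, `|g x - G (word x n.+1)| <= e n) ->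
  continuous g.
Proof.
move=> e0 gG x A /nbhs_ballP [d /= d0 dA].
have d20 : 0 < d / 2 by rewrite divr_gt0.
have /cvgrPdist_lt /(_ _ d20) [N _ /(_ N (leqnn N)) HN] := e0.
apply: filterS (nbhs_word x N.+1) => y /= yx; apply: dA; rewrite -ball_normE /=.
have h1 := gG x N; have h2 := gG y N; move: h1 h2 HN.
by rewrite yx !ler_norml !ltr_norml /=; lra.
Qed.

(** For k >= 3 one has dbar k = 1 / (10 k - 27), and 10 k - 27 >= k holds exactly from k = 3 on. *)
Lemma dbar_bounds k : (0 < k)%N -> 0 <= dbar R k <= k%:R^-1.
Proof.
move=> k0; rewrite /dbar; case: ltnP => k3; first by rewrite lexx invr_ge0 ler0n.
have k3' : 3 <= k%:R :> R by rewrite ler_nat.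
rewrite /cbar ltnNge k3 /= /invlog expR_gt0 expRK natrB; last exact: ltnW.
rewrite -invrN invr_ge0 lef_pV2 ?posrE ?ltr0n//; last by lra.
by apply/andP; split; lra.
Qed.

Lemma dbar_ge k : (2 < k)%N -> k%:R^-1 / 10 <= dbar R k.
Proof.
move=> k3; rewrite /dbar ltnNge k3 /=.
have k3' : 3 <= k%:R :> R by rewrite ler_nat.
rewrite /cbar ltnNge k3 /= /invlog expR_gt0 expRK natrB; last exact: ltnW.
rewrite -invrN -invfM lef_pV2 ?posrE; lra.
Qed.

Lemma continuous_phi : continuous (phi R).
Proof.
apply: (@continuous_word_limit _ (fun w => cbar R (run w)) (fun n => cbar R n.+1)) => [|x n] /=.
  by have := @cvg_cbar R; rewrite -cvg_shiftS.
by rewrite distrC ger0_norm; have /andP[] := phi_approx R x n.+1.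
Qed.

Definition psi (x : fullshift) : R := (@Phi R x).2.

(** As long as the word stays in one class the approximation is 0: the run is then at least the
    length, so the true value is at most the harmonic term. *)
Lemma continuous_psi : continuous psi.
Proof.
apply: (continuous_word_limit (e := @harmonic R)
  (G := fun w => if run w == size w then 0 else
    if cls (head ord0 w) then - dbar R (run w) else dbar R (run w))).
  exact: cvg_harmonic.
move=> x n; rewrite /psi /harmonic size_word.
have h0 : 0 <= n.+1%:R^-1 :> R by rewrite invr_ge0 ler0n.
case: (runP x) => [xr|[r [r0 xr xr']]].
  by rewrite Phi_norun// (@run_word x n.+1 n.+1)// eqxx subrr normr0.
rewrite (Phi_run _ r0 xr xr') (run_word_min _ r0 xr xr') wordS [head _ _]/= [_.2]/=.
have /andP[d0 d1] := dbar_bounds r0.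
case: eqP => [/minn_idPr nr|nr].
  have {}d1 : dbar R r <= n.+1%:R^-1.
    by apply: le_trans d1 _; rewrite lef_pV2 ?posrE ?ltr0n// ler_nat.
  by case: cls; rewrite subr0 ?normrN ger0_norm.
have /minn_idPl -> : (r <= n.+1)%N.
  by rewrite leqNgt; apply/negP => /ltnW /minn_idPr.
by rewrite subrr normr0.
Qed.

Lemma expect_dirac (x : fullshift) (g : fullshift -> R) :
  bounded_measurable g -> \int[(\d_x : probability fullshift R)]_y g y = g x.
Proof.
move=> [mg _]; rewrite /Rintegral integral_dirac//; last exact/measurable_EFinP.
by rewrite diracT mul1e.
Qed.

Lemma pr_dirac_shift (x : fullshift) w :
  \sum_(b : 'I_4) pr (\d_x : probability fullshift R) (b :: w) =
  pr (\d_(left_shift x) : probability fullshift R) w.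
Proof. by rewrite -pr_preimage_shift /pr; congr fine; rewrite /= /dirac !indicE. Qed.

(** The uniform measure on a periodic orbit, given by its cylinder masses; the integral formula
    passes from functions of words to continuous ones by uniform approximation. *)
Lemma orbit_average (x : fullshift) n : (0 < n)%N -> iter n left_shift x = x ->
  exists mu, invariant_measure left_shift mu /\ forall g : fullshift -> R,
    continuous g -> \int[mu]_y g y = (\sum_(i < n) g (iter i left_shift x)) / n%:R.
Proof.
move=> n0 xn; pose d i : probability fullshift R := \d_(iter i left_shift x).
have nR : n%:R != 0 :> R by rewrite pnatr_eq0 -lt0n.
have [|||mu muE] := @cylinder_extension R (fun w => (\sum_(i < n) pr (d i) w) / n%:R).
- by move=> w; rewrite divr_ge0// sumr_ge0// => i _; exact: pr_ge0.
- under eq_bigr do rewrite pr_nil.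
  by rewrite sumr_const card_ord divff.
- move=> w; rewrite -mulr_suml exchange_big; congr (_ / _).
  by apply: eq_bigr => i _; exact: pr_rcons.
exists mu; split=> [|g cg].
  apply: invariant_prP => w; under eq_bigr do rewrite muE.
  rewrite muE -mulr_suml exchange_big; congr (_ / _).
  under eq_bigr do rewrite pr_dirac_shift -iterS.
  case: n n0 xn {muE nR} => // n _ xn.
  by rewrite big_ord_recr [RHS]big_ord_recl /= addrC -[left_shift _]/(iter n.+1 left_shift x) xn.
apply/eqP; rewrite -subr_eq0 -normr_eq0 eq_le normr_ge0 andbT.
apply/ler_addgt0Pr => e e0; rewrite add0r.
have e20 : 0 < e / 2 by rewrite divr_gt0.
have [N _ /(_ N (leqnn N)) HN] := continuous_uniform_word cg e20.
have h1 := expect_uniform_word mu cg HN.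
have h2 : `|\int[mu]_y g (pad (word y N)) -
    (\sum_(i < n) g (iter i left_shift x)) / n%:R| <= e / 2.
  rewrite (expect_word _ (fun w => g (pad w))).
  under eq_bigr do rewrite muE mulrA mulr_sumr.
  rewrite -mulr_suml exchange_big -mulrBl -sumrB.
  rewrite normrM (ger0_norm (x := n%:R^-1)) ?invr_ge0// ler_pdivrMr ?ltr0n//.
  apply: le_trans (ler_norm_sum _ _ _) _.
  rewrite mulr_natr -[X in _ <= _ *+ X](card_ord n) -sumr_const; apply: ler_sum => i _.
  rewrite -(expect_word _ (fun w => g (pad w))) -(expect_dirac (iter i left_shift x) (g := g)).
    exact: expect_uniform_word.
  exact: bounded_measurable_continuous.
by move: h1 h2; rewrite !ler_norml; lra.
Qed.

Lemma Rot_phi_ge0 v : Rot (@Phi R) v -> 0 <= v.1.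
Proof. by case=> mu _ <- /=; apply: Rintegral_ge0 => x _; exact: phi_ge0. Qed.

Lemma Rot_origin : Rot (@Phi R) (0, 0).
Proof.
have [mu [inv muE]] := @orbit_average (fun=> ord0) 1 isT erefl.
have Phi0 : @Phi R (fun=> ord0) = (0, 0) by apply: Phi_norun.
exists mu => //; rewrite /rv.
have := muE _ continuous_phi; have := muE _ continuous_psi.
by rewrite !big_ord1 divr1 /= /phi /psi Phi0 divr1 => -> ->.
Qed.

(** Either the run is at least k, so that |psi| <= 1 / k, or phi >= cbar k while |psi| <= 1.
    Integrated, it shows that a vanishing mean of [phi] forces that of [psi] to vanish. *)
Lemma psi_le k x : (0 < k)%N -> `|psi x| <= k%:R^-1 + phi R x / cbar R k.
Proof.
move=> k0; have c0 := cbar_gt0 R k.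
have k0' : 0 <= k%:R^-1 :> R by rewrite invr_ge0 ler0n.
rewrite /psi /phi; case: (runP x) => [xr|[r [r0 xr xr']]].
  by rewrite Phi_norun//= normr0 mul0r addr0.
rewrite (Phi_run _ r0 xr xr') /=; have /andP[d0 d1] := dbar_bounds r0.
rewrite (_ : `|_| = dbar R r); last by case: cls; rewrite ?normrN ger0_norm.
case: (leqP k r) => kr.
  apply: (@le_trans _ _ k%:R^-1).
    by apply: le_trans d1 _; rewrite lef_pV2 ?posrE ?ltr0n// ler_nat.
  by rewrite lerDl divr_ge0// ltW// cbar_gt0.
apply: (@le_trans _ _ 1).
  by apply: le_trans d1 _; rewrite invf_le1 ?ltr0n// ler1n.
rewrite -[leLHS]add0r; apply: lerD => //.
by rewrite ler_pdivlMr// mul1r le_cbar// ltnW.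
Qed.

Lemma expect_psi_eq0 mu : \int[mu]_x phi R x = 0 -> \int[mu]_x psi x = 0.
Proof.
move=> p0; apply/eqP; rewrite -normr_eq0 eq_le normr_ge0 andbT.
apply/ler_addgt0Pr => e e0; rewrite add0r.
have [k _ /(_ k (leqnn k))] : \forall k \near \oo, k.+1%:R^-1 < e :> R.
  by have /cvgrPdist_lt /(_ e e0) := @cvg_harmonic R; apply: filterS => n;
    rewrite sub0r normrN ger0_norm ?invr_ge0 ?ler0n.
move=> ke; apply: le_trans (ltW ke).
have bp := bounded_measurable_phi R.
have bs := bounded_measurable_continuous continuous_psi.
have bb : bounded_measurable (fun x => k.+1%:R^-1 + (cbar R k.+1)^-1 * phi R x).
  apply: bounded_measurableD; first exact: bounded_measurable_cst.
  by apply: bounded_measurableM => //; exact: bounded_measurable_cst.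
have E : \int[mu]_x (k.+1%:R^-1 + (cbar R k.+1)^-1 * phi R x) = k.+1%:R^-1.
  rewrite expectD ?expect_cst ?expectZ ?p0 ?mulr0 ?addr0//.
    exact: bounded_measurable_cst.
  by apply: bounded_measurableM => //; exact: bounded_measurable_cst.
have H x := @psi_le k.+1 x isT.
rewrite ler_norml -{1}E -{2}E -expectN//; apply/andP; split.
  apply: le_expect => //; first exact: bounded_measurableN.
  by move=> x; have := H x; rewrite ler_norml mulrC => /andP[].
by apply: le_expect => // x; have := H x; rewrite ler_norml mulrC => /andP[].
Qed.

Lemma boundary_origin : boundary (Rot (@Phi R)) (0, 0).
Proof.
split; first exact: (subset_closure Rot_origin).
rewrite /interior => /nbhs_ballP [e /= e0 /(_ (- (e / 2), 0)) H].
have /Rot_phi_ge0 /= : Rot (@Phi R) (- (e / 2), 0).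
  apply: H; split=> /=; last exact: ballxx.
  by rewrite -ball_normE /= sub0r opprK ger0_norm ?divr_ge0 ?ltW// ltr_pdivrMr//; lra.
lra.
Qed.

Lemma exposed_origin_line :
  supporting_line (Rot (@Phi R)) [set v | dot (- 1, 0) v = 0] /\
  [set (0, 0)] = Rot (@Phi R) `&` [set v | dot (- 1, 0) v = 0].
Proof.
have dotE (v : R * R) : dot (- 1, 0) v = - v.1 by rewrite /dot /=; ring.
split.
  exists (- 1, 0), 0; split=> //.
  - by apply/eqP => -[/eqP]; rewrite oppr_eq0 oner_eq0.
  - by move=> v /Rot_phi_ge0; rewrite dotE oppr_le0.
  by exists (0, 0); split; [exact: Rot_origin|rewrite /= dotE oppr0].
apply/seteqP; split=> [_ ->|v].
  by split; [exact: Rot_origin|rewrite /= dotE oppr0].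
case=> -[mu _ <-]; rewrite /= dotE /= => /eqP; rewrite oppr_eq0 => /eqP p0.
by rewrite /rv p0 (expect_psi_eq0 p0).
Qed.

(** Along the period the runs are N, N - 1, ..., 1 in the class [s], and then 1 in the other class,
    where the second coordinate is 0. *)
Lemma Rot_slope N (s : bool) : (0 < N)%N ->
  Rot (@Phi R) ((Cbar R N + cbar R 1) / N.+1%:R,
    (if s then - \sum_(i < N) dbar R i.+1 else \sum_(i < N) dbar R i.+1) / N.+1%:R).
Proof.
move=> N0; pose c (b : bool) : 'I_4 := if b then inord 2 else inord 0.
have cE b : cls (c b) = b by case: b; rewrite /cls /c inordK.
pose x : fullshift := fun k => if (k %% N.+1)%N == N then c (~~ s) else c s.
have xE k : (k < N)%N -> cls (x k) = s.
  by move=> kN; rewrite /x modn_small ?ltnS 1?ltnW// ltn_eqF// cE.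
have xN : cls (x N) = ~~ s by rewrite /x modn_small// eqxx cE.
have xper : iter N.+1 left_shift x = x.
  by apply/funext => k; rewrite iter_shift /x modnDl.
have [mu [inv muE]] := orbit_average (ltn0Sn N) xper.
have Phi1 i : (i < N)%N -> @Phi R (iter i left_shift x) =
    (cbar R (N - i), if s then - dbar R (N - i) else dbar R (N - i)).
  move=> iN; rewrite (@Phi_run R (iter i left_shift x) (N - i)) ?subn_gt0//.
  - by rewrite iter_shift addn0 xE.
  - by move=> j jN; rewrite !iter_shift addn0 !xE// -ltn_subRL.
  - by rewrite !iter_shift addn0 subnKC ?(ltnW iN)// xN xE//; case: (s).
have PhiN : @Phi R (iter N left_shift x) = (cbar R 1, 0).
  rewrite (@Phi_run R (iter N left_shift x) 1)//.
  - by rewrite /dbar /= oppr0 if_same.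
  - by case.
  - rewrite !iter_shift addn0 addn1 xN (_ : cls _ = s); first by case: (s).
    by rewrite /x modnn ltn_eqF// cE.
exists mu => //; rewrite /rv (muE _ continuous_phi) (muE _ continuous_psi).
congr (_ / _, _ / _); rewrite big_ord_recr /= /phi /psi PhiN /=.
  rewrite /Cbar big_add1 /= big_mkord; congr (_ + _).
  rewrite (reindex_inj rev_ord_inj)/=; apply: eq_bigr => i _.
  by rewrite (Phi1 _ (ltn_ord (rev_ord i))) /= subKn.
rewrite addr0 (_ : (if s then _ else _) = \sum_(i < N) (if s then - dbar R i.+1 else dbar R i.+1)).
  rewrite (reindex_inj rev_ord_inj)/=; apply: eq_bigr => i _.
  by rewrite (Phi1 _ (ltn_ord (rev_ord i))) /= subKn.
by case: s {x xE xN xper muE Phi1 PhiN}; rewrite ?sumrN.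
Qed.

(** The runs 1 and 2, where [dbar] is 0, account for the constant: 1 + 1/2 <= 2. *)
Lemma dbar_sum_harmonic N :
  series (@harmonic R) N.+2 <= 10 * (\sum_(i < N.+2) dbar R i.+1) + 2.
Proof.
rewrite /series /harmonic /= big_mkord; elim: N => [|N IH].
  rewrite !big_ord_recr !big_ord0 /=.
  have /andP[h1 _] := dbar_bounds (ltn0Sn 0); have /andP[h2 _] := dbar_bounds (ltn0Sn 1).
  by rewrite invr1; lra.
rewrite big_ord_recr [X in 10 * X]big_ord_recr /=.
have := @dbar_ge N.+3 isT; move: (dbar R N.+3) IH; move: (\sum_(i < _) _) (\sum_(i < _) _) (N.+3%:R^-1) => u v w z; lra.
Qed.

(** The line passes through the origin, so its constant is 0 and the period cancels from the
    inequality at each orbit. If b2 were nonzero, the bounded first sums would bound the harmonic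
    series. *)
Lemma supporting_line_origin H : supporting_line (Rot (@Phi R)) H -> H (0, 0) ->
  [set v | dot (- 1, 0) v = 0] = H.
Proof.
move=> [[b1 b2] [c [b0 -> sup _]]] /=; rewrite /dot /= !mulr0 addr0 => c0.
have bnd N s : (0 < N)%N -> b1 * (Cbar R N + cbar R 1) +
    b2 * (if s then - \sum_(i < N) dbar R i.+1 else \sum_(i < N) dbar R i.+1) <= 0.
  move=> N0; have := sup _ (Rot_slope s N0); rewrite /dot /= -c0 !mulrA -mulrDl.
  by rewrite pmulr_lle0// invr_gt0 ltr0n.
have [b20|b20] := eqVneq b2 0.
  have b10 : b1 != 0 by apply: contra_neq b0 => ->; rewrite b20.
  apply/seteqP; split=> v /=; rewrite -c0 b20 !mul0r !addr0 mulN1r => /eqP.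
    by rewrite oppr_eq0 => /eqP ->; rewrite mulr0.
  by rewrite mulf_eq0 (negPf b10) => /eqP ->; rewrite oppr0.
exfalso; apply: (@dvg_harmonic R); apply: nondecreasing_is_cvgn.
  by apply: nondecreasing_series => n _ _; rewrite invr_ge0.
exists (10 * (`|b1| * (Cmax R + cbar R 1) / `|b2|) + 2) => _ [n _ <-].
apply: (@le_trans _ _ (series (@harmonic R) n.+2)).
  apply: nondecreasing_series => //; last by rewrite ltnW.
  by move=> k _ _; rewrite invr_ge0.
apply: le_trans (dbar_sum_harmonic n) _.
rewrite lerD2r ler_pM2l// ler_pdivlMr ?normr_gt0// mulrC.
(* The class of the orbit is chosen so that its second sum has the sign of [b2]. *)
have := bnd n.+2 (b2 < 0) isT; move: (\sum_(i < _) _) => D b2D.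
have {}b2D : `|b2| * D <= - (b1 * (Cbar R n.+2 + cbar R 1)).
  move: b2D; case: ltP => b2s; [rewrite ltr0_norm//|rewrite ger0_norm//]; lra.
apply: le_trans b2D _; apply: le_trans (ler_norm _) _.
have c1 := cbar_gt0 R 1; have C0 := Cbar_ge0 R n.+2.
rewrite normrN normrM ler_wpM2l// ger0_norm; last by rewrite addr_ge0// ltW.
by rewrite lerD2r Cbar_le.
Qed.

Lemma smooth_origin : smooth_point (Rot (@Phi R)) (0, 0).
Proof.
split; first exact: boundary_origin.
have [sup E] := exposed_origin_line.
exists [set v | dot (- 1, 0) v = 0]; split=> [|H [supH H0]].
  by split=> //; rewrite /= /dot /= !mulr0 addr0.
exact: supporting_line_origin.
Qed.

End rotation_set.

Theorem proposition4 (R : realType) :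
  [/\ boundary (Rot (@Phi R)) (0, 0),
      exposed_point (Rot (@Phi R)) (0, 0) & smooth_point (Rot (@Phi R)) (0, 0)] /\
  exists mu : probability fullshift R,
    [/\ invariant_measure left_shift mu, ~ ergodic left_shift mu
      & forall nu : probability fullshift R, GS (@Phi R) (- 1, 0) nu <->
          (forall A : set fullshift, measurable A -> nu A = mu A)].
Proof.
split.
  split; [exact: boundary_origin| |exact: smooth_origin].
  by exists [set v | dot (- 1, 0) v = 0]; exact: exposed_origin_line.
have [mu [inv muE]] := ground_measure_exists R.
exists mu; split=> // [|nu]; first exact: ground_measure_not_ergodic muE.
exact: ground_states.
Qed.
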